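(* Let $T_1, T_2, \dots, T_k$ be $k$ commuting contractions on a Hilbert space $\mathcal{H}$. Then the following are equivalent: (i) There exist $k$ commuting unitaries $U_1, U_2, \dots, U_k$ on a Hilbert space $\mathcal{K} \supseteq \mathcal{H}$ satisfying $$T_1^{n_1} T_2^{n_2} \cdots T_k^{n_k} = \mathcal{P}_\mathcal{H}\, U_1^{n_1} U_2^{n_2} \cdots U_k^{n_k} \vert_\mathcal{H}$$ for all $n_1, n_2, \dots, n_k \in \mathbb{N}$. (ii) The $k$-tuple $(T_1, T_2, \dots, T_k)$ satisfies a matricial von Neumann inequality: for every $n$ and all polynomials $p_{i,j}$ in $k$ variables, $1\le i,j\le n$, $$\left\|\left(p_{i,j}(T_1, \dots, T_k)\right)_{i,j}\right\| \leq \sup_{(z_1, \dots, z_k) \in \mathbb{T}^k}\left\|\left(p_{i,j}(z_1, \dots , z_k)\right)_{i,j}\right\| .$$ (iii) Let $\mathcal{A} \subset C(\mathbb{T}^k)$ be the (non-selfadjoint) operator algebra that is the closed linear span of the polynomials on $\mathbb{T}^k$. The map $\phi: \mathcal{A} \to \mathcal{B}(\mathcal{H})$ determined by $z_1^{n_1} z_2^{n_2} \cdots z_k^{n_k} \mapsto T_1^{n_1} T_2^{n_2} \cdots T_k^{n_k}$ is a (well-defined) completely contractive representation. (iv) The representation $T: \mathbb{N}^k \to \mathcal{B}(\mathcal{H})$ that maps the canonical generators $e_i$ to $T_i$ has extension property (A).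
   Context: $\mathbb{N}$ contains $0$; $\mathbb{T}$ is the unit circle; $\mathcal{P}_\mathcal{H}$ is the orthogonal projection onto $\mathcal{H}$. Polynomials are in the variables $z_1,\dots,z_k$ with complex coefficients. An operator algebra is a norm-closed unital algebra of operators, not necessarily self-adjoint; representations are unital homomorphisms. The matrix $(p_{i,j}(T_1,\dots,T_k))_{i,j}$ acts on $\mathcal{H}^{n}$. For the additive semigroup $P=\mathbb{N}^k$, let $V:P\to\mathcal{B}(\ell_2(P))$, $V_p\delta_q=\delta_{p+q}$, be the left-regular representation and $\mathcal{A}_\lambda(P)=\overline{\mathrm{alg}}\{V_p:p\in P\}$ the norm-closed algebra it generates. A representation (unital semigroup homomorphism) $T:P\to\mathcal{B}(\mathcal{H})$ has extension property (A) if there is a completely contractive representation $\phi:\mathcal{A}_\lambda(P)\to\mathcal{B}(\mathcal{H})$ with $\phi(V_p)=T(p)$ for all $p\in P$. *)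

(* Defs.v *)
From HB Require Import structures.
From mathcomp Require Import all_boot all_order all_algebra finmap complex.
From mathcomp Require Import all_classical all_reals ereal topology normedtype.
From mathcomp Require Import esum ring lra.
From mathcomp.analysis.showcase Require summability.
From mathcomp Require Import -(notations) mpoly.

Set Implicit Arguments.
Unset Strict Implicit.
Unset Printing Implicit Defensive.

Import Order.TTheory GRing.Theory Num.Theory.
Import numFieldNormedType.Exports.

Local Open Scope classical_set_scope.
Local Open Scope complex_scope.
Local Open Scope ring_scope.

(* Norms of complex normed spaces take their values in R[i]; rnorm is the norm
   as a real number. *)
Definition rnorm (R : realType) (V : normedZmodType R[i]) (x : V) : R :=
  complex.Re `|x|.

Section rnorm_theory.
Context (R : realType).

Lemma rnormE (V : normedZmodType R[i]) (x : V) : (rnorm x)%:C = `|x|.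
Proof. by rewrite /rnorm RRe_real// normr_real. Qed.

Lemma rnorm_ge0 (V : normedZmodType R[i]) (x : V) : 0 <= rnorm x.
Proof. by rewrite -ler0c rnormE. Qed.

Lemma rnormC (z : R[i]) : rnorm z ^+ 2 = complex.Re z ^+ 2 + complex.Im z ^+ 2.
Proof. by apply: complexI; rewrite rmorphXn/= rnormE add_Re2_Im2. Qed.

Lemma rnormD (V : normedZmodType R[i]) (x y : V) :
  rnorm (x + y) <= rnorm x + rnorm y.
Proof. by rewrite -lecR rmorphD/= !rnormE ler_normD. Qed.

Lemma rnormM (x y : R[i]) : rnorm (x * y) = rnorm x * rnorm y.
Proof. by apply: complexI; rewrite rmorphM/= !rnormE normrM. Qed.

Lemma rnorm0 (V : normedZmodType R[i]) : rnorm (0 : V) = 0.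
Proof. by apply: complexI; rewrite rnormE normr0. Qed.

End rnorm_theory.

(* The inner product is linear in its first argument. *)
HB.mixin Record isHilbert (R : realType) (H : Type)
    & CompleteNormedModule R[i] H := {
  hdot : {dot H for @Num.conj R[i]};
  hdot_norm : forall x : H, hdot x x = `|x| ^+ 2
}.

#[short(type="hilbertType")]
HB.structure Definition Hilbert (R : realType) :=
  { H of CompleteNormedModule R[i] H & isHilbert R H }.

Section bounded_operators.
Context (K : numFieldType) (V : normedModType K).

Definition bop_pred : {pred (V -> V)} :=
  mem [set f : V -> V | linear f /\ continuous f].

Record bop := Bop { bop_fun :> V -> V; bopP : bop_fun \in bop_pred }.

HB.instance Definition _ := [isSub for bop_fun].
HB.instance Definition _ := [Choice of bop by <:].

Lemma bop_submod_closed : submod_closed bop_pred.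
Proof.
split.
  rewrite inE/=; split; first by move=> a x y; rewrite /= scaler0 addr0.
  by move=> x; exact: cvg_cst.
move=> a f g; rewrite !inE => -[lf cf] [lg cg]; split.
  move=> b x y.
  rewrite -![(a *: f + g) _]/(a *: f _ + g _) lf lg !scalerDr !scalerA.
  by rewrite [a * b]mulrC !addrA; congr (_ + _); rewrite -!addrA; congr (_ + _);
    rewrite addrC.
move=> x; apply: cvgD; last exact: cg.
by apply: cvgZl_tmp; exact: cf.
Qed.

HB.instance Definition _ := GRing.isSubmodClosed.Build _ _ bop_pred
  bop_submod_closed.
HB.instance Definition _ := [SubChoice_isSubLmodule of bop by <:].

Lemma bop_linear (T : bop) : linear T.
Proof. by have := bopP T; rewrite inE => -[]. Qed.

Lemma bop_continuous (T : bop) : continuous T.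
Proof. by have := bopP T; rewrite inE => -[]. Qed.

HB.instance Definition _ (T : bop) :=
  GRing.isLinear.Build K V V *:%R T (bop_linear T).

Lemma bop_ext (S T : bop) : S =1 T -> S = T.
Proof. by move=> ST; apply/val_inj/funext. Qed.

Lemma bopDE (S T : bop) x : (S + T) x = S x + T x. Proof. by []. Qed.

Lemma bopZE (a : K) (T : bop) x : (a *: T) x = a *: T x. Proof. by []. Qed.

Lemma bop_id_subproof : idfun \in bop_pred.
Proof. by rewrite inE; split => // x. Qed.

Definition bop_id := Bop bop_id_subproof.

Lemma bop_comp_subproof (S T : bop) : S \o T \in bop_pred.
Proof.
rewrite inE; split; first by move=> a x y; rewrite /= !linearP.
move=> x; apply: continuous_comp; exact: bop_continuous.
Qed.

Definition bop_comp (S T : bop) := Bop (bop_comp_subproof S T).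

Lemma bop_compA : associative bop_comp.
Proof. by move=> S T U; apply: bop_ext. Qed.

Lemma bop_comp1l : left_id bop_id bop_comp.
Proof. by move=> S; apply: bop_ext. Qed.

Lemma bop_comp1r : right_id bop_id bop_comp.
Proof. by move=> S; apply: bop_ext. Qed.

Lemma bop_compDl : left_distributive bop_comp +%R.
Proof. by move=> S T U; apply: bop_ext. Qed.

Lemma bop_compDr : right_distributive bop_comp +%R.
Proof. by move=> S T U; apply: bop_ext => x; exact: (linearD S (T x) (U x)). Qed.

HB.instance Definition _ := GRing.Zmodule_isPzRing.Build bop
  bop_compA bop_comp1l bop_comp1r bop_compDl bop_compDr.

End bounded_operators.

Section l2.
Context (R : realType) (I : choiceType).
Implicit Types (f g : I -> R[i]^o) (A : {fset I}).

Definition l2sq f : \bar R := \esum_(i in [set: I]) (rnorm (f i) ^+ 2)%:E.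

Definition l2_pred : {pred (I -> R[i]^o)} :=
  mem [set f : I -> R[i]^o | (l2sq f < +oo)%E].

Record l2 := L2 { l2_fun :> I -> R[i]^o; l2P : l2_fun \in l2_pred }.

HB.instance Definition _ := [isSub for l2_fun].
HB.instance Definition _ := [Choice of l2 by <:].

Definition l2psum f A : R := \sum_(i <- A) rnorm (f i) ^+ 2.

Lemma l2psum_le_l2sq f A : ((l2psum f A)%:E <= l2sq f)%E.
Proof.
apply: esum_ge; exists [set` A]; first by split => //; exact: finite_fset.
by rewrite fsbig_finite//= set_fsetK sumEFin.
Qed.

Lemma l2sq_le f M : (forall A, l2psum f A <= M) -> (l2sq f <= M%:E)%E.
Proof.
move=> fM; apply: ge_ereal_sup => _ [F [finF _] <-].
by rewrite fsbig_finite//= sumEFin lee_fin fM.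
Qed.

Lemma l2sq_ge0 f : (0 <= l2sq f)%E.
Proof. by apply: esum_ge0 => i _; rewrite lee_fin sqr_ge0. Qed.

Lemma l2sqP f M : (forall A, l2psum f A <= M) -> f \in l2_pred.
Proof.
by move=> fM; rewrite inE/=; apply: le_lt_trans (l2sq_le fM) _; rewrite ltry.
Qed.

#[local] Hint Resolve l2sq_ge0 : core.

Definition l2sqr f : R := fine (l2sq f).

Lemma l2sqrE f : f \in l2_pred -> l2sq f = (l2sqr f)%:E.
Proof.
by rewrite inE/= => foo; rewrite fineK// ge0_fin_numE.
Qed.

Lemma l2sqr_ge0 f : 0 <= l2sqr f. Proof. exact: fine_ge0. Qed.

#[local] Hint Resolve l2sqr_ge0 : core.

Lemma l2psum_le f A : f \in l2_pred -> l2psum f A <= l2sqr f.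
Proof. by move=> /l2sqrE fE; rewrite -lee_fin -fE l2psum_le_l2sq. Qed.

Lemma l2sqr_le f M : (forall A, l2psum f A <= M) -> l2sqr f <= M.
Proof. by move=> fM; rewrite -lee_fin -(l2sqrE (l2sqP fM)) l2sq_le. Qed.


Lemma l2psumD f g A (t : R) : 0 < t ->
  l2psum (f + g) A <= (1 + t) * l2psum f A + (1 + t^-1) * l2psum g A.
Proof.
move=> t0; rewrite /l2psum !mulr_sumr -big_split/=; apply: ler_sum => i _.
have : rnorm (f i + g i) ^+ 2 <= (rnorm (f i) + rnorm (g i)) ^+ 2.
  by rewrite lerXn2r ?nnegrE ?addr_ge0 ?rnorm_ge0// rnormD.
move/le_trans; apply.
rewrite -subr_ge0 [leRHS](_ : _ = t^-1 * (t * rnorm (f i) - rnorm (g i)) ^+ 2).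
  by rewrite mulr_ge0 ?sqr_ge0// invr_ge0 ltW.
by field; rewrite gt_eqF.
Qed.

Lemma l2psumZ (a : R[i]) f A : l2psum (a *: f) A = rnorm a ^+ 2 * l2psum f A.
Proof.
by rewrite /l2psum mulr_sumr; apply: eq_bigr => i _; rewrite -exprMn -rnormM.
Qed.

Lemma l2_submod_closed : submod_closed l2_pred.
Proof.
split.
  by apply: (@l2sqP _ 0) => A; rewrite /l2psum big1// => i _; rewrite rnorm0 expr0n.
move=> a f g fl gl.
apply: (@l2sqP _ ((1 + 1) * (rnorm a ^+ 2 * l2sqr f) + (1 + 1^-1) * l2sqr g)) => A.
apply: le_trans (l2psumD _ _ _ ltr01) _.
rewrite lerD// ler_wpM2l ?addr_ge0 ?invr_ge0// ?l2psum_le//.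
by rewrite l2psumZ ler_wpM2l ?sqr_ge0// l2psum_le.
Qed.

HB.instance Definition _ := GRing.isSubmodClosed.Build _ _ l2_pred
  l2_submod_closed.
HB.instance Definition _ := [SubChoice_isSubLmodule of l2 by <:].

Lemma l2_ext (x y : l2) : x =1 y -> x = y.
Proof. by move=> xy; apply/val_inj/funext. Qed.

Definition l2norm (x : l2) : R := Num.sqrt (fine (l2sq x)).

Lemma l2norm_sqr x : l2norm x ^+ 2 = l2sqr x.
Proof. exact/sqr_sqrtr/l2sqr_ge0. Qed.

Lemma l2norm_ge0 x : 0 <= l2norm x. Proof. exact: sqrtr_ge0. Qed.

#[local] Hint Resolve l2norm_ge0 : core.

Lemma l2norm_le (x : l2) M : 0 <= M ->
  (forall A, l2psum x A <= M ^+ 2) -> l2norm x <= M.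
Proof.
move=> M0 xM; rewrite -(@ler_pXn2r _ 2)// ?nnegrE// l2norm_sqr.
exact: l2sqr_le.
Qed.

Lemma le_l2norm (x : l2) i : rnorm (x i) <= l2norm x.
Proof.
rewrite -(@ler_pXn2r _ 2)// ?nnegrE ?rnorm_ge0// l2norm_sqr.
by apply: le_trans (l2psum_le [fset i]%fset (l2P x)); rewrite /l2psum big_seq_fset1.
Qed.

Lemma l2norm0_eq0 x : l2norm x = 0 -> x = 0.
Proof.
move=> x0; apply: l2_ext => i; apply/eqP; rewrite -normr_eq0 -rnormE.
rewrite (_ : rnorm _ = 0)//; apply/eqP.
by rewrite eq_le rnorm_ge0 andbT -x0 le_l2norm.
Qed.

Lemma l2normD x y : l2norm (x + y) <= l2norm x + l2norm y.
Proof.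
have [/l2norm0_eq0->|x0] := eqVneq (l2norm x) 0; first by rewrite add0r lerDr.
have [/l2norm0_eq0->|y0] := eqVneq (l2norm y) 0; first by rewrite addr0 lerDl.
apply: l2norm_le => [|A]; first exact: addr_ge0.
have px : 0 < l2norm x by rewrite lt_def x0 l2norm_ge0.
have py : 0 < l2norm y by rewrite lt_def y0 l2norm_ge0.
pose t := l2norm y / l2norm x.
have t0 : 0 < t by rewrite divr_gt0.
apply: le_trans (l2psumD x y A t0) _.
have -> : (l2norm x + l2norm y) ^+ 2 =
    (1 + t) * l2norm x ^+ 2 + (1 + t^-1) * l2norm y ^+ 2.
  by rewrite /t; field; rewrite x0 y0.
by rewrite !l2norm_sqr lerD// ler_wpM2l ?l2psum_le ?l2P// addr_ge0// ?invr_ge0 ltW.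
Qed.

Lemma l2normZ_le a x : l2norm (a *: x) <= rnorm a * l2norm x.
Proof.
apply: l2norm_le => [|A]; first by rewrite mulr_ge0// rnorm_ge0.
by rewrite l2psumZ exprMn ler_wpM2l ?sqr_ge0// l2norm_sqr l2psum_le// l2P.
Qed.

Lemma l2normZ a x : l2norm (a *: x) = rnorm a * l2norm x.
Proof.
apply/eqP; rewrite eq_le l2normZ_le/=.
have [->|a0] := eqVneq a 0; first by rewrite rnorm0 mul0r.
have := l2normZ_le a^-1 (a *: x); rewrite scalerA mulVf// scale1r => h.
apply: le_trans (ler_wpM2l (rnorm_ge0 a) h) _.
rewrite mulrA -rnormM divff// (_ : rnorm (1 : R[i]) = 1) ?mul1r//.
by apply: complexI; rewrite rnormE normr1.
Qed.

Lemma l2normC_le (x y : l2) :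
  (l2norm (x + y))%:C <= (l2norm x)%:C + (l2norm y)%:C.
Proof. by rewrite -rmorphD lecR l2normD. Qed.

Lemma l2normC_Z (a : R[i]) (x : l2) : (l2norm (a *: x))%:C = `|a| * (l2norm x)%:C.
Proof. by rewrite l2normZ rmorphM/= rnormE. Qed.

Lemma l2normC_eq0 (x : l2) : (l2norm x)%:C = 0 -> x = 0.
Proof. by move/complexI/l2norm0_eq0. Qed.

HB.instance Definition _ := @Lmodule_isNormed.Build R[i] l2
  (fun x => (l2norm x)%:C) l2normC_le l2normC_Z l2normC_eq0.

Lemma l2_normE (x : l2) : `|x| = (l2norm x)%:C. Proof. by []. Qed.

End l2.

Lemma rnorm_dist (R : realType) (V : normedZmodType R[i]) (x y : V) :
  `|rnorm x - rnorm y| <= rnorm (x - y).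
Proof.
have rnormB : rnorm (y - x) = rnorm (x - y).
  by apply: complexI; rewrite !rnormE distrC.
have h1 := rnormD (x - y) y; have h2 := rnormD (y - x) x.
rewrite !subrK rnormB in h1 h2.
by rewrite ler_norml; apply/andP; split; lra.
Qed.


Lemma complexC_complete (R : realType) (F : set_system R[i]^o) :
  ProperFilter F -> cauchy F -> cvg F.
Proof.
move=> FF /cauchy_ballP Fc.
have Fball (e : R) : 0 < e ->
    \forall x \near F & y \near F, rnorm (x - y : R[i]^o) < e.
  move=> e0; have := Fc e%:C; rewrite ltcR => /(_ e0).
  apply: filterS => -[x y]; rewrite -ball_normE/= /ball_/= => xy.
  by rewrite -ltcR rnormE.
have ReIm (z : R[i]^o) : `|complex.Re z| <= rnorm z /\ `|complex.Im z| <= rnorm z.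
  by split; rewrite -(@ler_pXn2r _ 2)// ?nnegrE ?rnorm_ge0// rnormC
    real_normK ?num_real// ?lerDl ?lerDr sqr_ge0.
pose rp (z : R[i]^o) : R := complex.Re z.
pose ip (z : R[i]^o) : R := complex.Im z.
have cvR : cvg (rp @ F).
  apply: cauchy_cvg; apply/cauchy_ballP => e e0.
  rewrite near_map2.
  apply: filterS (Fball _ e0) => -[x y] /=; rewrite -ball_normE/= => xy.
  apply: le_lt_trans xy; have := (ReIm (x - y)).1.
  by case: x y => [a b] [c d].
have cvI : cvg (ip @ F).
  apply: cauchy_cvg; apply/cauchy_ballP => e e0.
  rewrite near_map2.
  apply: filterS (Fball _ e0) => -[x y] /=; rewrite -ball_normE/= => xy.
  apply: le_lt_trans xy; have := (ReIm (x - y)).2.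
  by case: x y => [a b] [c d].
set a := lim (rp @ F); set b := lim (ip @ F).
apply/cvg_ex; exists (a +i* b : R[i]^o); apply/cvgrPdist_lt => e e0.
have eE : e = (complex.Re e)%:C by rewrite RRe_real// gtr0_real.
have e1 : 0 < complex.Re e by rewrite -ltcR -eE.
have e2 : 0 < complex.Re e / 2 by rewrite divr_gt0.
have /cvgrPdist_lt/(_ _ e2) nR := cvR.
have /cvgrPdist_lt/(_ _ e2) nI := cvI.
near=> z.
have h1 : `|a - complex.Re z| < complex.Re e / 2 by near: z.
have h2 : `|b - complex.Im z| < complex.Re e / 2 by near: z.
rewrite eE -rnormE ltcR.
rewrite -(@ltr_pXn2r _ 2) ?nnegrE ?rnorm_ge0 ?ltW// rnormC.
have -> : complex.Re ((a +i* b : R[i]^o) - z) = a - complex.Re z by case: (z).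
have -> : complex.Im ((a +i* b : R[i]^o) - z) = b - complex.Im z by case: (z).
have H1 : (a - complex.Re z) ^+ 2 < (complex.Re e / 2) ^+ 2.
  by rewrite -[ltLHS]real_normK ?num_real// ltr_pXn2r ?nnegrE// ltW.
have H2 : (b - complex.Im z) ^+ 2 < (complex.Re e / 2) ^+ 2.
  by rewrite -[ltLHS]real_normK ?num_real// ltr_pXn2r ?nnegrE// ltW.
apply: lt_le_trans (ltrD H1 H2) _.
have -> : (complex.Re e / 2) ^+ 2 + (complex.Re e / 2) ^+ 2 = (complex.Re e) ^+ 2 / 2.
  by field.
by rewrite ler_pdivrMr// ler_peMr ?sqr_ge0// ler1n.
Unshelve. all: by end_near. Qed.

Section l2_complete.
Context (R : realType) (I : choiceType).

Lemma l2_complete (F : set_system (l2 R I)) :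
  ProperFilter F -> cauchy F -> cvg F.
Proof.
move=> FF /cauchy_ballP Fc.
have Fball (e : R) : 0 < e -> \forall x \near F & y \near F, l2norm (x - y) < e.
  move=> e0; have := Fc e%:C; rewrite ltcR => /(_ e0).
  apply: filterS => -[x y]; rewrite -ball_normE/= /ball_/= => xy.
  by rewrite -ltcR.
pose ev (i : I) (x : l2 R I) : R[i]^o := x i.
have cvF i : cvg (ev i @ F).
  apply: complexC_complete; apply/cauchy_ballP => e e0.
  have eE : e = (complex.Re e)%:C by rewrite RRe_real// gtr0_real.
  have e1 : 0 < complex.Re e by rewrite -ltcR -eE.
  rewrite near_map2; apply: filterS (Fball _ e1) => -[x y] /= xy.
  rewrite -ball_normE/= eE -rnormE ltcR.
  by apply: le_lt_trans xy; exact: (le_l2norm (x - y) i).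
pose g i : R[i]^o := lim (ev i @ F).
have key (e : R) : 0 < e -> \forall x \near F,
    forall A : {fset I}, l2psum (l2_fun x - g) A <= e ^+ 2.
  move=> e0; have := Fball _ e0 => -[[P Q] /= [FP FQ] PQ].
  near=> x => A.
  have Px : P x by near: x.
  have cvS : (fun y : l2 R I => l2psum (l2_fun x - l2_fun y) A)
      y @[y --> F] --> l2psum (l2_fun x - g) A.
    apply: cvg_big => [|i _]; first exact: add_continuous.
    have : (x i - ev i y) @[y --> F] --> x i - g i.
      by apply: cvgB; [exact: cvg_cst|exact: cvF].
    move=> h.
    have h1 : rnorm (x i - ev i y : R[i]^o) @[y --> F] --> rnorm (x i - g i : R[i]^o).
      apply/cvgrPdist_lt => d d0.
      have /cvgrPdist_lt/(_ d%:C) := h; rewrite ltcR => /(_ d0).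
      apply: filterS => y; rewrite /= -rnormE ltcR.
      exact: le_lt_trans (rnorm_dist _ _).
    by apply: cvgM; exact: h1.
  apply: (cvgr_to_le cvS).
  near=> y; have Qy : Q y by near: y.
  have := PQ (x, y) (conj Px Qy) => /= /ltW xy.
  apply: le_trans (@l2psum_le _ _ (x - y) A (l2P (x - y))) _.
  by rewrite -l2norm_sqr lerXn2r// nnegrE ?l2norm_ge0// ltW.
have gl : g \in @l2_pred R I.
  have /filter_ex[x xg] := key 1 ltr01.
  have xgl : (l2_fun x - g) \in @l2_pred R I by apply: l2sqP xg.
  have -> : g = l2_fun x - (l2_fun x - g) by rewrite opprB addrC subrK.
  by rewrite rpredB// l2P.
apply/cvg_ex; exists (L2 gl); apply/cvgrPdist_lt => e e0.
have eE : e = (complex.Re e)%:C by rewrite RRe_real// gtr0_real.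
have e1 : 0 < complex.Re e by rewrite -ltcR -eE.
have e2 : 0 < complex.Re e / 2 by rewrite divr_gt0.
apply: filterS (key _ e2) => x xg.
rewrite distrC eE l2_normE ltcR.
apply: (@le_lt_trans _ _ (complex.Re e / 2)).
  by apply: l2norm_le; [exact: ltW|exact: xg].
by rewrite ltr_pdivrMr// ltr_pMr// ltr1n.
Unshelve. all: by end_near. Qed.

HB.instance Definition _ := Uniform_isComplete.Build (l2 R I) l2_complete.

End l2_complete.

Section l2_dot.
Context (R : realType) (I : choiceType).
Implicit Types (x y z : l2 R I) (h : I -> R[i]^o).

#[local] Existing Instance summability.totally_filter.

Definition l2dot x y : R[i] :=
  summability.sum (fun i => x i * Num.conj (y i) : R[i]^o).

Lemma partial_sumE h (A : {fset I}) :
  summability.partial_sum h A = \sum_(i <- A) h i.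
Proof. by rewrite /summability.partial_sum big_seq_fsetE. Qed.

Lemma sum_eq h l :
  summability.partial_sum h @ summability.totally --> l ->
  summability.sum h = l.
Proof. by move=> hl; exact/cvg_lim. Qed.

Lemma l2_sqr_cvg x :
  summability.partial_sum (fun i => (rnorm (x i) ^+ 2)%:C : R[i]^o)
    @ summability.totally --> ((l2sqr x)%:C : R[i]^o).
Proof.
apply/cvgrPdist_lt => e e0.
have eE : e = (complex.Re e)%:C by rewrite RRe_real// gtr0_real.
have e1 : 0 < complex.Re e by rewrite -ltcR -eE.
have [A0 A0x] : exists A0, l2sqr x - complex.Re e < l2psum x A0.
  apply: contrapT => /forallNP nx.
  have : l2sqr x <= l2sqr x - complex.Re e.
    by apply: l2sqr_le => A; rewrite leNgt; apply/negP/nx.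
  by rewrite leNgt ltrBlDr ltrDl e1.
exists A0 => // A /= A0A.
have {A0A} A0A : l2psum x A0 <= l2psum x A.
  rewrite /l2psum [leRHS](big_fsetID _ (mem A0))/=.
  set S := (X in _ <= \sum_(i <- X) _ + _).
  have -> : S = A0.
    rewrite /S; congr (enum_fset _); apply/fsetP => i; rewrite !inE; apply/idP/idP => [/andP[]//|iA0].
    by rewrite iA0 andbT; exact: (fsubsetP A0A).
  by rewrite lerDl sumr_ge0// => i _; rewrite sqr_ge0.
have Ax := l2psum_le A (l2P x).
rewrite partial_sumE -(rmorph_sum (real_complex R)) -rmorphB/= eE -rnormE ltcR.
have -> : rnorm ((l2sqr x - l2psum x A)%:C : R[i]^o) = `|l2sqr x - l2psum x A|.
  by apply: complexI; rewrite rnormE normc_def/= expr0n addr0 sqrtr_sqr.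
by rewrite ger0_norm ?subr_ge0//; lra.
Qed.

Lemma polarization (a b : R[i]) : a * Num.conj b =
  4^-1 * ((rnorm (a + b) ^+ 2)%:C - (rnorm (a - b) ^+ 2)%:C +
    ('i * (rnorm (a + 'i * b) ^+ 2)%:C - 'i * (rnorm (a - 'i * b) ^+ 2)%:C)).
Proof.
have sq (c : R[i]) : (rnorm c ^+ 2)%:C = c * Num.conj c.
  by rewrite rmorphXn/= rnormE normCK.
have jc : Num.conj ('i : R[i]) = - 'i.
  by apply/eqP; rewrite eq_complex/= oppr0 !eqxx.
have j2 : ('i : R[i]) * 'i = -1 by rewrite -expr2 sqr_i.
rewrite !sq !(rmorphD, rmorphN, rmorphM)/= jc.
move: ('i : R[i]) j2 (Num.conj a) (Num.conj b) => {jc} j j2 c d.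
rewrite [RHS](_ : _ = 4^-1 * ((a * d + b * c) * 2 +
  (j * j) * 2 * (b * c - a * d))); last by ring.
by rewrite j2; field.
Qed.

Lemma l2dot_cvg x y :
  summability.partial_sum (fun i => x i * Num.conj (y i) : R[i]^o)
    @ summability.totally --> (l2dot x y : R[i]^o).
Proof.
pose p z (A : {fset I}) : R[i]^o :=
  summability.partial_sum (fun i => (rnorm (z i) ^+ 2)%:C : R[i]^o) A.
pose j : R[i] := 'i.
have pE : summability.partial_sum (fun i => x i * Num.conj (y i) : R[i]^o) =
    4^-1 \*: (p (x + y) - p (x - y) +
      (j \*: p (x + j *: y) - j \*: p (x - j *: y))).
  apply/funext => A; rewrite partial_sumE.
  transitivity (4^-1 * (p (x + y) A - p (x - y) A +
      (j * p (x + j *: y) A - j * p (x - j *: y) A))); last by [].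
  rewrite /p !partial_sumE !mulr_sumr -!sumrB -big_split/= mulr_sumr.
  by apply: eq_bigr => i _; exact: polarization.
have : cvg (summability.partial_sum (fun i => x i * Num.conj (y i) : R[i]^o)
    @ summability.totally).
  rewrite pE; apply/cvg_ex; eexists; apply: cvgZl_tmp; apply: cvgD.
    by apply: cvgB; exact: l2_sqr_cvg.
  by apply: cvgB; apply: cvgZl_tmp; exact: l2_sqr_cvg.
by [].
Qed.

Lemma l2dotC x y : l2dot x y = Num.conj (l2dot y x).
Proof.
apply: sum_eq; apply/cvgrPdist_lt => e e0.
have /cvgrPdist_lt/(_ _ e0) := @l2dot_cvg y x.
apply: filterS => A; rewrite !partial_sumE -norm_conjC rmorphB rmorph_sum/=.
congr (`|_ - _| < _); apply: eq_bigr => i _.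
by rewrite rmorphM/= conjCK mulrC.
Qed.

Lemma l2dot_linearl a x y z : l2dot (a *: x + y) z = a * l2dot x z + l2dot y z.
Proof.
apply: sum_eq.
rewrite [X in X @ _](_ : _ = a \*:
    summability.partial_sum (fun i => x i * Num.conj (z i) : R[i]^o) +
    summability.partial_sum (fun i => y i * Num.conj (z i) : R[i]^o)).
  by apply: cvgD; [apply: cvgZl_tmp|]; exact: l2dot_cvg.
apply/funext => A.
rewrite -[RHS]/(a * summability.partial_sum _ A + summability.partial_sum _ A).
rewrite !partial_sumE mulr_sumr -big_split/=; apply: eq_bigr => i _.
by rewrite mulrA -mulrDl.
Qed.

Lemma l2dot_norm x : l2dot x x = `|x| ^+ 2.
Proof.
rewrite l2_normE -rmorphXn/= l2norm_sqr; apply: sum_eq.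
rewrite (_ : (fun i => _) = (fun i => (rnorm (x i) ^+ 2)%:C : R[i]^o)).
  exact: l2_sqr_cvg.
by apply/funext => i; rewrite rmorphXn/= rnormE normCK.
Qed.

Lemma l2dot_addl y : zmod_morphism (l2dot^~ y).
Proof.
by move=> a b; rewrite addrC -scaleN1r l2dot_linearl mulN1r addrC.
Qed.

Lemma l2dot_scalel y : scalable_for *%R (l2dot^~ y).
Proof.
move=> a x; have := l2dot_linearl a x 0 y; rewrite addr0 => ->.
by rewrite -[0]/(0 : l2 R I) -(subrr x) l2dot_addl subrr addr0.
Qed.

Lemma l2dot_addr x : zmod_morphism (l2dot x).
Proof.
by move=> a b; rewrite !(l2dotC x) -rmorphB/= -l2dot_addl.
Qed.

Lemma l2dot_scaler x : scalable_for (@Num.conj R[i] \; *%R) (l2dot x).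
Proof.
by move=> a y; rewrite l2dotC l2dot_scalel rmorphM/= -l2dotC.
Qed.

HB.instance Definition _ := isBilinear.Build R[i] (l2 R I) (l2 R I) R[i]
  *%R (@Num.conj R[i] \; *%R) l2dot
  l2dot_addl l2dot_addr l2dot_scalel l2dot_scaler.

Lemma l2dot_herm x y : l2dot x y = (-1) ^+ false * Num.conj (l2dot y x).
Proof. by rewrite expr0 mul1r -l2dotC. Qed.

HB.instance Definition _ := isHermitianSesquilinear.Build R[i] (l2 R I)
  false (@Num.conj R[i]) l2dot l2dot_herm.

Lemma l2dot_gt0 x : x != 0 -> 0 < l2dot x x.
Proof. by move=> x0; rewrite l2dot_norm exprn_gt0// normr_gt0. Qed.

HB.instance Definition _ := isDotProduct.Build R[i] (l2 R I) l2dot l2dot_gt0.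

HB.instance Definition _ := isHilbert.Build R (l2 R I) l2dot_norm.

End l2_dot.

Section hilbert_operators.
Context (R : realType) (H : hilbertType R).

Definition is_adjoint (S T : bop H) : Prop :=
  forall x y : H, hdot (T x) y = hdot x (S y).

Definition unitary (U : bop H) : Prop :=
  exists V : bop H, [/\ is_adjoint V U, V * U = 1 & U * V = 1].

Definition orthogonal_projection (M : set H) (P : bop H) : Prop :=
  forall x : H, M (P x) /\ forall y, M y -> hdot (x - P x) y = 0.

End hilbert_operators.

Section norms.
Context (R : realType).

Definition opnorm (V : normedModType R[i]) (T : bop V) : \bar R :=
  ereal_sup [set (rnorm (T x))%:E | x in [set x : V | rnorm x <= 1]].

(* The norm of the Hilbert direct sum of n copies of V; it is used to let
   matrices act on V^n. *)
Definition vnorm (V : normedZmodType R[i]) n (x : 'I_n -> V) : R :=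
  Num.sqrt (\sum_i rnorm (x i) ^+ 2).

Definition opmxnorm (V : normedModType R[i]) n (M : 'M[bop V]_n) : \bar R :=
  ereal_sup [set (vnorm (fun i => \sum_j M i j (x j)))%:E |
             x in [set x : 'I_n -> V | vnorm x <= 1]].

Definition cmxnorm n (A : 'M[R[i]]_n) : \bar R :=
  ereal_sup [set (vnorm (fun i => (A *m x) i 0))%:E |
             x in [set x : 'cV[R[i]]_n | vnorm (fun i => x i 0) <= 1]].

(* The closure of A for N, where N is meant to be an extended norm. *)
Definition norm_closure (E : zmodType) (N : E -> \bar R) (A : set E) : set E :=
  [set x | forall e : R, 0 < e -> exists2 a, A a & (N (x - a)%R < e%:E)%E].

End norms.

Section operator_algebras.
Context (R : realType).

Definition subalgebra (V : normedModType R[i]) (A : set (bop V)) : Prop :=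
  [/\ A 1, forall (a : R[i]) S T, A S -> A T -> A (a *: S + T)
    & forall S T, A S -> A T -> A (S * T)].

Definition generated_algebra (V : normedModType R[i]) (X : set (bop V)) :
  set (bop V) := smallest (@subalgebra V) X.

(* Completely contractive representations on H of the algebra A, given inside
   an algebra E with unit [one] and product [mul] whose matrices are normed by
   [N]. The values of phi outside of A are irrelevant. *)
Definition cc_representation (E : lmodType R[i]) (one : E) (mul : E -> E -> E)
    (N : forall n, 'M[E]_n -> \bar R) (A : set E) (H : hilbertType R)
    (phi : E -> bop H) : Prop :=
  [/\ phi one = 1,
      {in A &, forall x y, phi (x + y) = phi x + phi y},
      forall a : R[i], {in A, forall x, phi (a *: x) = a *: phi x},
      {in A &, forall x y, phi (mul x y) = phi x * phi y}
    & forall n (M : 'M[E]_n), (forall i j, A (M i j)) ->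
        (opmxnorm (map_mx phi M) <= N n M)%E].

End operator_algebras.

Definition monom (E : pzRingType) k (x : 'I_k -> E) (m : 'I_k -> nat) : E :=
  \prod_i x i ^+ m i.

(* mpoly.mmap would require the operators to form a nonzero ring. *)
Definition poly_eval (R : realType) (H : hilbertType R) k (T : 'I_k -> bop H)
    (p : mpoly k R[i]) : bop H :=
  \sum_(m <- msupp p) mcoeff m p *: monom T m.

Section torus.
Context (R : realType) (k : nat).

Definition torus : set 'rV[R[i]^o]_k := [set z | forall i, `|z 0 i| = 1].

Implicit Type f : torus -> R[i]^o.

Definition supnorm f : \bar R :=
  ereal_sup [set (rnorm (f z))%:E | z in [set: torus]].

Definition torus_mxnorm n (M : 'M[torus -> R[i]^o]_n) : \bar R :=
  ereal_sup [set cmxnorm (map_mx (fun f => f z : R[i]) M) | z in [set: torus]].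

Definition torus_poly (p : mpoly k R[i]) : torus -> R[i]^o :=
  fun z => meval (\val z 0) p.

Definition torus_monom (m : 'I_k -> nat) : torus -> R[i]^o :=
  fun z => monom (\val z 0) m.

Definition torus_algebra : set (torus -> R[i]^o) :=
  [set f | continuous f] `&` norm_closure supnorm (range torus_poly).

End torus.
Arguments torus : clear implicits.

Lemma bounded_bop (R : realType) (V : normedModType R[i]) (f : V -> V) :
  linear f -> (forall x, `|f x| <= `|x|) -> f \in @bop_pred _ V.
Proof.
move=> lf f1; rewrite inE; split => //.
pose F : {linear V -> V} := HB.pack f (GRing.isLinear.Build _ _ _ _ f lf).
apply: (@bounded_linear_continuous _ _ _ F); apply/linear_boundedP.
exists 1; split => // r r1 x; apply: le_trans (f1 x) _.
by rewrite ler_peMl// ltW.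
Qed.

Section left_regular.
Context (R : realType) (k : nat).

Local Notation Nk := {ffun 'I_k -> nat}.

Implicit Types (p q r : Nk) (f : l2 R Nk).

Definition lek p q := [forall i, p i <= q i]%N.

Definition subk q p : Nk := [ffun i => (q i - p i)%N].

Lemma subkK p q : lek p q -> p + subk q p = q.
Proof. by move=> /forallP pq; apply/ffunP => i; rewrite !ffunE; exact: subnKC. Qed.

Lemma addkK p r : subk (p + r) p = r.
Proof. by apply/ffunP => i; rewrite !ffunE; exact: addKn. Qed.

Lemma lek_addr p r : lek p (p + r).
Proof. by apply/forallP => i; rewrite !ffunE; exact: leq_addr. Qed.

(* (V_p f)(p + r) = f r, and V_p f vanishes outside of p + N^k. *)
Definition shift_fun p (f : Nk -> R[i]^o) : Nk -> R[i]^o :=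
  fun q => if lek p q then f (subk q p) else 0.

Lemma shift_psum p f (A : {fset Nk}) :
  l2psum (shift_fun p f) A <= l2norm f ^+ 2.
Proof.
rewrite l2norm_sqr.
pose B : {fset Nk} := [fset q in A | lek p q]%fset.
apply: (@le_trans _ _ (l2psum f [fset subk q p | q in B]%fset)); last first.
  exact/l2psum_le/l2P.
rewrite /l2psum big_imfset/=; last first.
  move=> q r; rewrite !inE/= => /andP[_ /subkK {2}<-] /andP[_ /subkK {2}<-].
  by move=> ->.
rewrite big_fset/= [leRHS]big_mkcond/= big_seq_cond [leRHS]big_seq_cond.
apply: ler_sum => q _; rewrite /shift_fun; case: ifP => // _.
by rewrite rnorm0 expr0n.
Qed.

Definition shift_vec p f : l2 R Nk := L2 (l2sqP (shift_psum p f)).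

Lemma shift_linear p : linear (shift_vec p).
Proof.
move=> a f g; apply: l2_ext => q.
change (shift_fun p (a *: f + g) q =
  a *: shift_fun p f q + shift_fun p g q).
by rewrite /shift_fun; case: ifP => // _; rewrite scaler0 addr0.
Qed.

Lemma shift_le p f : `|shift_vec p f| <= `|f|.
Proof.
rewrite !l2_normE lecR; apply: l2norm_le; first exact: l2norm_ge0.
exact: shift_psum.
Qed.

Definition left_regular p : bop (l2 R Nk) :=
  Bop (bounded_bop (@shift_linear p) (shift_le p)).

Lemma l2_delta_subproof q : (fun r => (r == q)%:R : R[i]^o) \in @l2_pred R Nk.
Proof.
apply: (@l2sqP _ _ _ 1) => A; rewrite /l2psum.
case: (boolP (q \in A)) => qA; last first.
  rewrite big_seq_cond big1 ?ler01// => r /andP[rA _].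
  by rewrite (negbTE (memPn qA r rA)) rnorm0 expr0n.
rewrite (big_fsetD1 q)//= eqxx big_seq_cond big1 ?addr0.
  by rewrite (_ : rnorm _ = 1) ?expr1n//; apply: complexI; rewrite rnormE normr1.
move=> r; rewrite !inE => /andP[/andP[/negbTE-> _] _].
by rewrite rnorm0 expr0n.
Qed.

Definition l2_delta q : l2 R Nk := L2 (l2_delta_subproof q).

Lemma left_regularE p q : left_regular p (l2_delta q) = l2_delta (p + q).
Proof.
apply: l2_ext => r; change (shift_fun p (l2_delta q) r = (r == p + q)%:R).
rewrite /shift_fun; case: ifPn => [pr|npr].
  change ((subk r p == q)%:R = (r == p + q)%:R :> R[i]^o); congr (nat_of_bool _)%:R.
  by apply/eqP/eqP => [<-|->]; rewrite ?addkK// subkK.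
case: eqP npr => // ->; by rewrite lek_addr.
Qed.

Definition left_regular_algebra : set (bop (l2 R Nk)) :=
  norm_closure (@opnorm R _) (generated_algebra (range left_regular)).

Definition extension_property_A (H : hilbertType R) (T : Nk -> bop H) : Prop :=
  exists phi : bop (l2 R Nk) -> bop H,
    @cc_representation R (bop (l2 R Nk)) 1 *%R (@opmxnorm R _)
      left_regular_algebra H phi /\
    forall p, phi (left_regular p) = T p.

End left_regular.

Section commuting_monomials.
Context (E : pzRingType) (k : nat) (T : 'I_k -> E).
Context (T_comm : forall i j, T i * T j = T j * T i).

Lemma monom0 : monom T (0 : {ffun 'I_k -> nat}) = 1.
Proof. by rewrite /monom big1// => i _; rewrite ffunE expr0. Qed.

Lemma monomD (p q : {ffun 'I_k -> nat}) : monom T (p + q) = monom T p * monom T q.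
Proof.
rewrite /monom; elim: (index_enum _) => [|i s IH].
  by rewrite !big_nil mulr1.
rewrite !big_cons IH ffunE exprD -!mulrA; congr (_ * _).
rewrite !mulrA; congr (_ * _); apply: commr_prod => j _.
exact/commrX/commr_sym/commrX/T_comm.
Qed.

Lemma monom_gen i : monom T ([ffun j => (j == i : nat)] : {ffun 'I_k -> nat}) = T i.
Proof.
rewrite /monom (eq_bigr (fun j => if j == i then T i else 1)); last first.
  by move=> j _; rewrite ffunE; case: eqP => [->|_]; rewrite ?expr1 ?expr0.
by rewrite -big_mkcond/= big_pred1_eq.
Qed.

End commuting_monomials.

(* Main.v *)
Require Import Defs.
From HB Require Import structures.
From mathcomp Require Import all_boot all_order all_algebra finmap complex.
From mathcomp Require Import all_classical all_reals ereal topology normedtype.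
From mathcomp Require Import cyclic separable cyclotomic ring lra.
From mathcomp Require Import -(notations) mpoly.

(** All four conditions are equivalent to one inequality between real numbers,
  [von_neumann T]: a bound [C] for a matrix polynomial on the torus is also a bound
  for its value at [T].

  A dilation implies the inequality because compressions do not increase norms and
  because commuting isometries satisfy it ([isometry_von_neumann]). The latter is a
  discrete form of the spectral theorem: the orbit of a vector is sampled on a large
  finite box; the discrete Fourier transform decomposes the action of a polynomial in the
  isometries into its values at points of the torus, up to boundary effects that
  disappear as the box grows. A scalar matrix has the same norm on [H^n] as on [C^n],
  by the Gram-Schmidt process ([scalar_matrix_bound]).

  The inequality says that evaluation at [T] is completely contractive on the
  polynomials on the torus, so it extends to their closure ([cc_extension]). The same
  holds for the algebra generated by the left regular representation: its generators
  are commuting isometries with approximate joint eigenvectors at all points of the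
  torus, so that the norm of a matrix polynomial in them is its supremum on the torus
  ([left_regular_lower_bound]). Conversely a completely contractive representation of
  either algebra gives back the inequality at the polynomials.

  It remains to construct a dilation from the inequality. A polynomial with finite-rank
  coefficients is encoded by the scalar functions [p(z) <x, h> conj <y, h>] of a point
  [z] of the torus and a vector [h]. On the real parts of their combinations, pairing
  with [T] is a positive functional, because a unital contractive map is positive
  ([contractive_positive], [tensor_graph_positive]). Every function dominated by a
  finite sum of [|<x, h>|^2] lies between two such combinations, so that the extension
  theorem of M. Riesz gives a positive functional, or state, on all the dominated
  functions ([state_exists]); this step plays the part of Arveson's extension theorem,
  and the next one that of Stinespring's dilation theorem. The functions whose squares
  are dominated form a pre-Hilbert space for the state. Multiplication by the coordinate
  [z i] preserves its form, and the functions [<x, h>] form an isometric copy of [H] to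
  which these multiplications compress as [T]. Completing this space ([completion]) and
  projecting onto the copy of [H] ([orthogonal_projection_exists])
  gives the dilation ([unitary_dilation]). *)

Set Implicit Arguments.
Unset Strict Implicit.
Unset Printing Implicit Defensive.

Import Order.TTheory GRing.Theory Num.Theory.
Import numFieldNormedType.Exports.

Local Open Scope classical_set_scope.
Local Open Scope complex_scope.
Local Open Scope ring_scope.

(** * Complex scalars and positive semidefinite forms *)

Section scalars.
Context (R : realType).
Implicit Types (z w : R[i]).

Lemma rnorm_conj z : rnorm (Num.conj z) = rnorm z.
Proof. by apply: complexI; rewrite !rnormE norm_conjC. Qed.

Lemma rnorm_real (r : R) : rnorm (r%:C) = `|r|.
Proof.
by apply: complexI; rewrite rnormE normc_def/= expr0n addr0 sqrtr_sqr.
Qed.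

Lemma rnorm1 : rnorm (1 : R[i]) = 1.
Proof. by rewrite -[1]/(1%:C) rnorm_real normr1. Qed.

Lemma rnormX z n : rnorm (z ^+ n) = rnorm z ^+ n.
Proof.
by elim: n => [|n IH]; rewrite ?expr0 ?rnorm1// !exprS rnormM IH.
Qed.

Lemma mul_conj z : z * Num.conj z = (rnorm z ^+ 2)%:C.
Proof. by rewrite rmorphXn/= rnormE normCK. Qed.

Lemma ReM z w : complex.Re (z * w) =
  complex.Re z * complex.Re w - complex.Im z * complex.Im w.
Proof. by case: z w => [a b] [c d]. Qed.

Lemma ImM z w : complex.Im (z * w) =
  complex.Re z * complex.Im w + complex.Im z * complex.Re w.
Proof. by case: z w => [a b] [c d]. Qed.

Lemma ReD z w : complex.Re (z + w) = complex.Re z + complex.Re w.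
Proof. by case: z w => [a b] [c d]. Qed.

Lemma ImD z w : complex.Im (z + w) = complex.Im z + complex.Im w.
Proof. by case: z w => [a b] [c d]. Qed.

Lemma ReN z : complex.Re (- z) = - complex.Re z.
Proof. by case: z. Qed.

Lemma Re_sum I (r : seq I) (F : I -> R[i]) :
  complex.Re (\sum_(i <- r) F i) = \sum_(i <- r) complex.Re (F i).
Proof. by apply: (big_morph _ ReD). Qed.

Lemma Re_conj z : complex.Re (Num.conj z) = complex.Re z.
Proof. by case: z. Qed.

Lemma Im_conj z : complex.Im (Num.conj z) = - complex.Im z.
Proof. by case: z. Qed.

Lemma ReIm_eq z w : complex.Re z = complex.Re w ->
  complex.Im z = complex.Im w -> z = w.
Proof. by case: z w => [a b] [c d] /= -> ->. Qed.

Lemma conjC_rmul (r : R) : Num.conj (r%:C) = r%:C :> R[i].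
Proof. by apply: ReIm_eq; rewrite ?Re_conj ?Im_conj//= oppr0. Qed.

End scalars.

Section rnorms.
Context (R : realType) (V : normedModType R[i]).
Implicit Types x y : V.

Lemma rnormZ (a : R[i]) x : rnorm (a *: x) = rnorm a * rnorm x.
Proof. by apply: complexI; rewrite rmorphM/= !rnormE normrZ. Qed.

Lemma rnormN x : rnorm (- x) = rnorm x.
Proof. by apply: complexI; rewrite !rnormE normrN. Qed.

Lemma rnormB_sym x y : rnorm (x - y) = rnorm (y - x).
Proof. by rewrite -rnormN opprB. Qed.

Lemma rnorm_eq0 x : rnorm x = 0 -> x = 0.
Proof. by move=> x0; apply/eqP; rewrite -normr_eq0 -rnormE x0. Qed.

Lemma rnorm_triangle x y z : rnorm (x - z) <= rnorm (x - y) + rnorm (y - z).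
Proof. by apply: le_trans (rnormD _ _); rewrite addrA subrK. Qed.

Lemma rnorm_sum I (r : seq I) (F : I -> V) :
  rnorm (\sum_(i <- r) F i) <= \sum_(i <- r) rnorm (F i).
Proof.
elim/big_rec2: _ => [|i a b _ h]; first by rewrite rnorm0.
by apply: le_trans (rnormD _ _) _; rewrite lerD2l.
Qed.

End rnorms.

(** Positive semidefinite Hermitian forms: the setting common to Hilbert spaces
  and to spaces that are still to be completed. *)
Record semi_inner (R : realType) (X : lmodType R[i]) (s : X -> X -> R[i]) : Prop :=
  SemiInner {
    semi_innerPl : forall a f g h, s (a *: f + g) h = a * s f h + s g h;
    semi_innerC : forall f g, s g f = Num.conj (s f g);
    semi_inner_ge0 : forall f, 0 <= s f f }.

Definition seminorm (R : realType) (X : lmodType R[i]) (s : X -> X -> R[i])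
  (f : X) : R := Num.sqrt (complex.Re (s f f)).

Section semi_inner_theory.
Context (R : realType) (X : lmodType R[i]) (s : X -> X -> R[i]).
Context (hs : semi_inner s).
Implicit Types (f g h : X).

Lemma formDl f g h : s (f + g) h = s f h + s g h.
Proof. by rewrite -[f]scale1r (semi_innerPl hs) mul1r scale1r. Qed.

Lemma form0l h : s 0 h = 0.
Proof. by apply: (addrI (s 0 h)); rewrite -formDl !addr0. Qed.

Lemma formZl a f h : s (a *: f) h = a * s f h.
Proof. by rewrite -[a *: f]addr0 (semi_innerPl hs) form0l addr0. Qed.

Lemma formNl f h : s (- f) h = - s f h.
Proof. by rewrite -scaleN1r formZl mulN1r. Qed.

Lemma formDr f g h : s h (f + g) = s h f + s h g.
Proof. by rewrite !(semi_innerC hs _ h) formDl rmorphD. Qed.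

Lemma formZr a f h : s h (a *: f) = Num.conj a * s h f.
Proof. by rewrite !(semi_innerC hs _ h) formZl rmorphM. Qed.

Lemma formNr f h : s h (- f) = - s h f.
Proof. by rewrite !(semi_innerC hs _ h) formNl rmorphN. Qed.

Lemma form0r h : s h 0 = 0.
Proof. by rewrite (semi_innerC hs) form0l rmorph0. Qed.

Lemma form_suml I (r : seq I) (F : I -> X) h :
  s (\sum_(i <- r) F i) h = \sum_(i <- r) s (F i) h.
Proof. exact: (big_morph (fun f => s f h) (fun f g => formDl f g h) (form0l h)). Qed.

Lemma form_sumr I (r : seq I) (F : I -> X) h :
  s h (\sum_(i <- r) F i) = \sum_(i <- r) s h (F i).
Proof. exact: (big_morph (s h) (fun f g => formDr f g h) (form0r h)). Qed.

Lemma Re_form_ge0 f : 0 <= complex.Re (s f f).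
Proof. by have := semi_inner_ge0 hs f; rewrite lecE => /andP[]. Qed.

Lemma seminorm_ge0 f : 0 <= seminorm s f. Proof. exact: sqrtr_ge0. Qed.

Lemma seminorm_sqr f : seminorm s f ^+ 2 = complex.Re (s f f).
Proof. exact/sqr_sqrtr/Re_form_ge0. Qed.

Lemma form_diag f : s f f = (seminorm s f ^+ 2)%:C.
Proof.
rewrite seminorm_sqr RRe_real//; exact/ger0_real/(semi_inner_ge0 hs).
Qed.

Lemma Re_formC f g : complex.Re (s g f) = complex.Re (s f g).
Proof. by rewrite (semi_innerC hs) Re_conj. Qed.

Lemma seminorm_sqrD f g : seminorm s (f + g) ^+ 2 =
  seminorm s f ^+ 2 + seminorm s g ^+ 2 + 2 * complex.Re (s f g).
Proof.
rewrite !seminorm_sqr !(formDl, formDr) !ReD [complex.Re (s g f)]Re_formC; ring.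
Qed.

Lemma seminorm_sqrB f g : seminorm s (f - g) ^+ 2 =
  seminorm s f ^+ 2 + seminorm s g ^+ 2 - 2 * complex.Re (s f g).
Proof.
rewrite !seminorm_sqr !(formDl, formDr, formNl, formNr, opprK) !(ReD, ReN).
rewrite [complex.Re (s g f)]Re_formC; ring.
Qed.

Lemma seminormZ a f : seminorm s (a *: f) = rnorm a * seminorm s f.
Proof.
apply/eqP; rewrite -(@eqrXn2 _ 2)// ?mulr_ge0 ?rnorm_ge0 ?seminorm_ge0//.
rewrite seminorm_sqr formZl formZr mulrA mul_conj form_diag -rmorphM/=.
by rewrite exprMn.
Qed.

Lemma cauchy_schwarz f g : rnorm (s f g) <= seminorm s f * seminorm s g.
Proof.
rewrite -(@ler_pXn2r _ 2)// ?nnegrE ?mulr_ge0 ?rnorm_ge0 ?seminorm_ge0//.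
set a := seminorm s f; set b := seminorm s g; set c := rnorm (s f g).
(* expand the square of the seminorm of f - t <f, g> g, for a real t *)
have h (t : R) : 0 <= a ^+ 2 - 2 * t * c ^+ 2 + t ^+ 2 * c ^+ 2 * b ^+ 2.
  have := sqr_ge0 (seminorm s (f - (t%:C * s f g) *: g)).
  rewrite seminorm_sqrB seminormZ rnormM rnorm_real formZr rmorphM/= conjC_rmul.
  rewrite -[_ * _ * s f g]mulrA [_ * s f g]mulrC mul_conj -rmorphM/= -/a -/b -/c.
  by rewrite !exprMn real_normK ?num_real//; congr (0 <= _); ring.
have a0 : 0 <= a := seminorm_ge0 f.
have [b0|b0] := eqVneq b 0.
  have [c0|c0] := eqVneq c 0; first by rewrite c0 expr0n sqr_ge0.
  have c2 : c ^+ 2 != 0 by rewrite expf_neq0.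
  (* the bound is affine in t with negative slope: this t makes it equal to -1 *)
  have := h ((a ^+ 2 + 1) / (2 * c ^+ 2)); rewrite b0 expr0n/= mulr0 addr0.
  rewrite [X in 0 <= X](_ : _ = - 1); first by rewrite oppr_ge0 ler10.
  by field; rewrite c0.
have b2 : 0 < b ^+ 2 by rewrite exprn_gt0// lt_def b0 seminorm_ge0.
have := h (b ^- 2).
rewrite [X in 0 <= X](_ : _ = (a ^+ 2 * b ^+ 2 - c ^+ 2) / b ^+ 2); last by field.
by rewrite pmulr_lge0 ?invr_gt0// subr_ge0 exprMn.
Qed.

End semi_inner_theory.

Section hilbert_basics.
Context (R : realType) (H : hilbertType R).
Implicit Types x y : H.

Lemma hdot_semi_inner : semi_inner (fun x y : H => hdot x y).
Proof.
split=> [a f g h|f g|f].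
- by rewrite linearPl.
- by rewrite hermC expr0 mul1r.
- by rewrite hdot_norm exprn_ge0.
Qed.

Lemma hdot_seminorm x : seminorm (fun x y : H => hdot x y) x = rnorm x.
Proof.
rewrite /seminorm hdot_norm -rnormE -rmorphXn/= sqrtr_sqr ger0_norm//.
exact: rnorm_ge0.
Qed.

Lemma hdot_rnorm x : hdot x x = (rnorm x ^+ 2)%:C.
Proof. by rewrite hdot_norm rmorphXn/= rnormE. Qed.

Lemma hdotC x y : hdot y x = Num.conj (hdot x y).
Proof. exact: (semi_innerC hdot_semi_inner). Qed.

End hilbert_basics.

(** * Norms of vectors and of matrices of operators *)

Section vector_norm.
Context (R : realType) (V : normedModType R[i]) (n : nat).
Implicit Types x y : 'I_n -> V.

Lemma vnorm_ge0 x : 0 <= vnorm x. Proof. exact: sqrtr_ge0. Qed.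

Lemma vnorm_sqr x : vnorm x ^+ 2 = \sum_i rnorm (x i) ^+ 2.
Proof. by rewrite sqr_sqrtr// sumr_ge0// => i _; exact: sqr_ge0. Qed.

Lemma vnorm_ext x y : x =1 y -> vnorm x = vnorm y.
Proof. by move=> xy; congr vnorm; exact/funext. Qed.

Lemma le_vnorm m x (W : normedModType R[i]) (y : 'I_m -> W) (c : R) : 0 <= c ->
  \sum_i rnorm (x i) ^+ 2 <= c ^+ 2 * \sum_i rnorm (y i) ^+ 2 ->
  vnorm x <= c * vnorm y.
Proof.
move=> c0 xy; rewrite -(@ler_pXn2r _ 2)// ?nnegrE ?mulr_ge0 ?sqrtr_ge0//.
rewrite exprMn !sqr_sqrtr ?sumr_ge0// => i _; exact: sqr_ge0.
Qed.

Lemma rnorm_le_vnorm x i : rnorm (x i) <= vnorm x.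
Proof.
rewrite -(@ler_pXn2r _ 2)// ?nnegrE ?rnorm_ge0 ?vnorm_ge0// vnorm_sqr.
by rewrite (bigD1 i)//= lerDl sumr_ge0// => j _; exact: sqr_ge0.
Qed.

Lemma vnorm0_eq x : vnorm x = 0 -> forall i, x i = 0.
Proof.
move=> x0 i; apply/rnorm_eq0/eqP; rewrite eq_le rnorm_ge0 andbT -x0.
exact: rnorm_le_vnorm.
Qed.

Lemma vnormZ (a : R[i]) x : vnorm (fun i => a *: x i) = rnorm a * vnorm x.
Proof.
apply/eqP; rewrite -(@eqrXn2 _ 2)// ?mulr_ge0 ?vnorm_ge0 ?rnorm_ge0//.
rewrite exprMn !vnorm_sqr mulr_sumr; apply/eqP/eq_bigr => i _.
by rewrite rnormZ exprMn.
Qed.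

Lemma vnorm_le_max x (c : R) : 0 <= c -> (forall i, rnorm (x i) <= c) ->
  vnorm x <= n%:R * c.
Proof.
move=> c0 xc; rewrite -(@ler_pXn2r _ 2)// ?nnegrE ?mulr_ge0 ?vnorm_ge0//.
rewrite vnorm_sqr; apply: (@le_trans _ _ (\sum_(i < n) c ^+ 2)).
  by apply: ler_sum => i _; rewrite lerXn2r ?nnegrE ?rnorm_ge0.
rewrite sumr_const card_ord -[leLHS]mulr_natl exprMn ler_wpM2r ?sqr_ge0//.
by rewrite -natrX ler_nat; case: (n) => // m; rewrite expnS expn1 leq_pmulr.
Qed.

(** Minkowski: sum the estimates (a + b)^2 <= (1 + t) a^2 + (1 + 1/t) b^2 over the
  coordinates; when [t] is the ratio of the two norms, the resulting bound is the
  square of the sum of the norms. *)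
Lemma vnormD x y : vnorm (fun i => x i + y i) <= vnorm x + vnorm y.
Proof.
have [/vnorm0_eq x0|x0] := eqVneq (vnorm x) 0.
  rewrite (@vnorm_ext _ y) ?lerDr ?vnorm_ge0// => i.
  by rewrite x0 add0r.
have [/vnorm0_eq y0|y0] := eqVneq (vnorm y) 0.
  rewrite (@vnorm_ext _ x) ?lerDl ?vnorm_ge0// => i.
  by rewrite y0 addr0.
have px : 0 < vnorm x by rewrite lt_def x0 vnorm_ge0.
have py : 0 < vnorm y by rewrite lt_def y0 vnorm_ge0.
pose t := vnorm y / vnorm x.
have t0 : 0 < t by rewrite divr_gt0.
rewrite -(@ler_pXn2r _ 2)// ?nnegrE ?addr_ge0 ?vnorm_ge0//.
have sumD : vnorm (fun i => x i + y i) ^+ 2 <=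
    (1 + t) * vnorm x ^+ 2 + (1 + t^-1) * vnorm y ^+ 2.
  rewrite !vnorm_sqr !mulr_sumr -big_split/=; apply: ler_sum => i _.
  have : rnorm (x i + y i) ^+ 2 <= (rnorm (x i) + rnorm (y i)) ^+ 2.
    by rewrite lerXn2r ?nnegrE ?addr_ge0 ?rnorm_ge0// rnormD.
  move/le_trans; apply.
  rewrite -subr_ge0 [leRHS](_ : _ = t^-1 * (t * rnorm (x i) - rnorm (y i)) ^+ 2).
    by rewrite mulr_ge0 ?sqr_ge0// invr_ge0 ltW.
  by field; rewrite gt_eqF.
apply: le_trans sumD _; rewrite [leLHS](_ : _ = (vnorm x + vnorm y) ^+ 2)//.
by rewrite /t; field; rewrite x0 y0.
Qed.

End vector_norm.

Section vector_norm_comparison.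
Context (R : realType).

Lemma vnorm1 (V : normedModType R[i]) (v : 'I_1 -> V) : vnorm v = rnorm (v ord0).
Proof. by rewrite /vnorm big_ord1 sqrtr_sqr ger0_norm// rnorm_ge0. Qed.

Lemma vnorm_mono (V W : normedModType R[i]) n (x : 'I_n -> V) (y : 'I_n -> W) :
  (forall i, rnorm (x i) <= rnorm (y i)) -> vnorm x <= vnorm y.
Proof.
move=> xy; rewrite -[leRHS]mul1r; apply: le_vnorm => //; rewrite expr1n mul1r.
by apply: ler_sum => i _; rewrite lerXn2r ?nnegrE ?rnorm_ge0.
Qed.

Lemma vnorm_entries (V V' : normedModType R[i]) n (F : 'I_n -> 'I_n -> V)
    (v : 'I_n -> V') (d : R) : 0 <= d ->
  (forall i j, rnorm (F i j) <= d * rnorm (v j)) ->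
  vnorm (fun i => \sum_j F i j) <= d * (n%:R * (n%:R * vnorm v)).
Proof.
move=> d0 Fd; rewrite mulrCA; apply: vnorm_le_max.
  by rewrite !mulr_ge0 ?vnorm_ge0.
move=> i; apply: le_trans (rnorm_sum _ _) _.
apply: (@le_trans _ _ (\sum_(j < n) d * vnorm v)).
  by apply: ler_sum => j _; apply: le_trans (Fd i j) _; rewrite ler_wpM2l// rnorm_le_vnorm.
by rewrite sumr_const card_ord -[leLHS]mulr_natl mulrCA.
Qed.

End vector_norm_comparison.

Section norm_bounds.
Context (R : realType).

(** Homogeneity turns a bound on the unit ball into a bound everywhere. *)
Lemma unit_ball_bound (X : Type) (sc : R -> X -> X) (g nm : X -> R) (c : R) :
  (forall t x, 0 <= t -> g (sc t x) = t * g x) ->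
  (forall t x, 0 <= t -> nm (sc t x) = t * nm x) ->
  (forall x, 0 <= nm x) -> (forall x, 0 <= g x) ->
  (forall x, nm x <= 1 -> g x <= c) -> forall x, g x <= c * nm x.
Proof.
move=> gsc nsc n0 g0 gc x.
have [x0|x0] := eqVneq (nm x) 0.
  rewrite x0 mulr0 leNgt; apply/negP => gx.
  have c0 : 0 <= c by apply: le_trans (gc x _); rewrite ?x0.
  have t0 : 0 <= (c + 1) / g x by rewrite divr_ge0// addr_ge0.
  have := gc (sc ((c + 1) / g x) x); rewrite nsc// x0 mulr0 ler01 => /(_ isT).
  by rewrite gsc// divfK ?gt_eqF// leNgt ltrDl ltr01.
have px : 0 < nm x by rewrite lt_def x0 n0.
have t0 : 0 <= (nm x)^-1 by rewrite invr_ge0.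
have := gc (sc (nm x)^-1 x); rewrite nsc// mulVf// lexx => /(_ isT).
by rewrite gsc// ler_pdivrMl// mulrC.
Qed.

Lemma opnorm_le (V : normedModType R[i]) (S : bop V) (c : R) :
  (opnorm S <= c%:E)%E <-> 0 <= c /\ forall x, rnorm (S x) <= c * rnorm x.
Proof.
split=> [Sc|[c0 Sc]]; last first.
  apply: ge_ereal_sup => _ [x /= x1 <-]; rewrite lee_fin.
  by apply: le_trans (Sc x) _; rewrite ler_piMr.
have Sc1 x : rnorm x <= 1 -> rnorm (S x) <= c.
  by move=> x1; rewrite -lee_fin; apply: le_trans Sc; apply: ereal_sup_ubound; exists x.
split; first by have := Sc1 0; rewrite linear0 rnorm0 ler01 => /(_ isT).
apply: (@unit_ball_bound _ (fun t x => t%:C *: x)) => // [t x t0|t x t0||];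
  rewrite ?linearZ/= ?rnormZ ?rnorm_real ?ger0_norm//;
  move=> x; exact: rnorm_ge0.
Qed.

Lemma opmxnorm_le (V : normedModType R[i]) n (M : 'M[bop V]_n) (c : R) :
  (opmxnorm M <= c%:E)%E <->
  0 <= c /\ forall x, vnorm (fun i => \sum_j M i j (x j)) <= c * vnorm x.
Proof.
split=> [Mc|[c0 Mc]]; last first.
  apply: ge_ereal_sup => _ [x /= x1 <-]; rewrite lee_fin.
  by apply: le_trans (Mc x) _; rewrite ler_piMr.
have Mc1 x : vnorm x <= 1 -> vnorm (fun i => \sum_j M i j (x j)) <= c.
  by move=> x1; rewrite -lee_fin; apply: le_trans Mc; apply: ereal_sup_ubound; exists x.
split.
  apply: le_trans (Mc1 (fun=> 0) _); first exact: vnorm_ge0.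
  by rewrite /vnorm big1 ?sqrtr0// => i _; rewrite rnorm0 expr0n.
apply: (@unit_ball_bound _ (fun t x => (fun i => t%:C *: x i))) => [t x t0|t x t0|x|x|//].
- rewrite -[in RHS](ger0_norm t0) -rnorm_real -vnormZ; apply: vnorm_ext => i.
  by rewrite scaler_sumr; apply: eq_bigr => j _; rewrite linearZ.
- by rewrite vnormZ rnorm_real ger0_norm.
- exact: vnorm_ge0.
- exact: vnorm_ge0.
Qed.

Lemma cmxnorm_le n (A : 'M[R[i]]_n) (c : R) :
  (cmxnorm A <= c%:E)%E <->
  0 <= c /\ forall x : 'I_n -> R[i]^o,
    vnorm (fun i => \sum_j A i j * x j : R[i]^o) <= c * vnorm x.
Proof.
have AE (x : 'cV[R[i]]_n) :
    vnorm (fun i => (A *m x) i 0) = vnorm (fun i => \sum_j A i j * x j 0 : R[i]^o).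
  by congr (Num.sqrt _); apply: eq_bigr => i _; rewrite mxE.
split=> [Ac|[c0 Ac]]; last first.
  apply: ge_ereal_sup => _ [x /= x1 <-]; rewrite lee_fin AE.
  apply: le_trans (Ac (fun i => x i 0)) _; rewrite ler_piMr//.
have Ac1 (x : 'I_n -> R[i]^o) : vnorm x <= 1 ->
    vnorm (fun i => \sum_j A i j * x j : R[i]^o) <= c.
  move=> x1; rewrite -lee_fin; apply: le_trans Ac; apply: ereal_sup_ubound.
  exists (\col_i x i) => /=.
    by rewrite (_ : (fun i => _) = x)//; apply/funext => i; rewrite mxE.
  rewrite AE; congr (vnorm _)%:E; apply/funext => i.
  by apply: eq_bigr => j _; rewrite mxE.
split.
  apply: le_trans (Ac1 (fun=> 0) _); first exact: vnorm_ge0.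
  by rewrite /vnorm big1 ?sqrtr0// => i _; rewrite rnorm0 expr0n.
apply: (@unit_ball_bound _ (fun t x => (fun i => t%:C *: x i))) => [t x t0|t x t0|x|x|//].
- rewrite -[in RHS](ger0_norm t0) -rnorm_real -vnormZ; apply: vnorm_ext => i.
  by rewrite scaler_sumr; apply: eq_bigr => j _; exact: mulrCA.
- by rewrite vnormZ rnorm_real ger0_norm.
- exact: vnorm_ge0.
- exact: vnorm_ge0.
Qed.

Lemma opmxnorm_ge0 (V : normedModType R[i]) n (M : 'M[bop V]_n) : (0 <= opmxnorm M)%E.
Proof.
have h : vnorm (fun _ : 'I_n => 0 : V) = 0.
  by rewrite /vnorm big1 ?sqrtr0// => i _; rewrite rnorm0 expr0n.
apply: le_trans (_ : _ <= (vnorm (fun i => \sum_j M i j 0))%:E)%E _.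
  by rewrite lee_fin vnorm_ge0.
by apply: ereal_sup_ubound; exists (fun=> 0) => //=; rewrite h.
Qed.

Lemma cmxnorm_ge0 n (A : 'M[R[i]]_n) : (0 <= cmxnorm A)%E.
Proof.
have h : vnorm (fun i : 'I_n => (0 : 'cV[R[i]]_n) i 0) = 0.
  by rewrite /vnorm big1 ?sqrtr0// => i _; rewrite mxE rnorm0 expr0n.
apply: le_trans (_ : _ <= (vnorm (fun i => (A *m (0 : 'cV[R[i]]_n))%R i 0%R))%:E)%E _.
  by rewrite mulmx0 h.
by apply: ereal_sup_ubound; exists 0 => //=; rewrite h.
Qed.

(** All the norms of the theorem are suprema in the extended reals; this reduces
  their comparison to inequalities between real numbers. *)
Lemma le_of_bounds (x y : \bar R) : (0 <= y)%E ->
  (forall c : R, (y <= c%:E)%E -> (x <= c%:E)%E) -> (x <= y)%E.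
Proof.
by case: y => [y _ ->//||]; rewrite ?leey.
Qed.

Lemma le_eps (x y c : R) : 0 <= c ->
  (forall e, 0 < e -> x <= y + e * c) -> x <= y.
Proof.
move=> c0 h; rewrite leNgt; apply/negP => yx.
have c1 : 0 < c + 1 by rewrite ltr_wpDl.
have e0 : 0 < (x - y) / (c + 1) by rewrite divr_gt0// subr_gt0.
have := h _ e0; rewrite -lerBlDl mulrAC ler_pdivlMr// ler_pM2l ?subr_gt0//.
by rewrite leNgt ltrDl ltr01.
Qed.

End norm_bounds.

Section torus_facts.
Context (R : realType) (k : nat).

Lemma torus_one_subproof : torus R k (const_mx 1).
Proof. by move=> i; rewrite mxE normr1. Qed.

Definition torus_one : torus R k := SigSub (mem_set torus_one_subproof).

Lemma torus_rnorm (z : torus R k) i : rnorm ((\val z) 0 i) = 1.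
Proof.
by apply: complexI; rewrite rnormE; have := set_valP z; apply.
Qed.
 
End torus_facts.

Section poly_eval_theory.
Context (R : realType) (H : hilbertType R) (k : nat) (T : 'I_k -> bop H).
Implicit Types (p q : mpoly k R[i]).

Lemma poly_evalE (d : seq (multinom k)) p : uniq d -> {subset msupp p <= d} ->
  poly_eval T p = \sum_(m <- d) mcoeff m p *: monom T m.
Proof.
move=> du pd; rewrite /poly_eval [RHS](bigID [in msupp p])/= [X in _ + X]big1 ?addr0.
  rewrite -[RHS]big_filter; apply: perm_big; apply: uniq_perm.
  - exact: msupp_uniq.
  - exact: filter_uniq.
  - by move=> m; rewrite mem_filter; case: (boolP (m \in msupp p)) => // /pd ->.
by move=> m /memN_msupp_eq0 ->; rewrite scale0r.
Qed.

Lemma poly_evalP a p q :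
  poly_eval T (a *: p + q) = a *: poly_eval T p + poly_eval T q.
Proof.
pose d := undup (msupp (a *: p + q) ++ msupp p ++ msupp q).
have du : uniq d by exact: undup_uniq.
rewrite !(@poly_evalE d)//; try by move=> m; rewrite mem_undup !mem_cat => ->;
  rewrite ?orbT.
rewrite scaler_sumr -big_split/=; apply: eq_bigr => m _.
by rewrite mcoeffD mcoeffZ scalerDl scalerA.
Qed.

Lemma poly_evalD p q : poly_eval T (p + q) = poly_eval T p + poly_eval T q.
Proof. by rewrite -[p]scale1r poly_evalP !scale1r. Qed.

Lemma poly_eval0 : poly_eval T 0 = 0.
Proof. by rewrite /poly_eval msupp0 big_nil. Qed.

Lemma poly_evalZ a p : poly_eval T (a *: p) = a *: poly_eval T p.
Proof. by rewrite -[a *: p]addr0 poly_evalP poly_eval0 addr0. Qed.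

Lemma poly_evalB p q : poly_eval T (p - q) = poly_eval T p - poly_eval T q.
Proof. by rewrite -scaleN1r addrC poly_evalP scaleN1r addrC. Qed.

Lemma poly_eval_sum I (r : seq I) (F : I -> mpoly k R[i]) :
  poly_eval T (\sum_(i <- r) F i) = \sum_(i <- r) poly_eval T (F i).
Proof. exact: (big_morph _ poly_evalD poly_eval0). Qed.

Lemma poly_evalX (m : multinom k) : poly_eval T (mpolyX R[i] m) = monom T m.
Proof. by rewrite /poly_eval msuppX big_seq1 mcoeffX eqxx scale1r. Qed.

Lemma monom_ext (E : pzRingType) (x : 'I_k -> E) (m1 m2 : 'I_k -> nat) :
  m1 =1 m2 -> monom x m1 = monom x m2.
Proof. by move=> mm; apply: eq_bigr => i _; rewrite mm. Qed.

Lemma poly_eval1 : poly_eval T 1 = 1.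
Proof.
rewrite -mpolyX0 poly_evalX /monom big1// => i _.
by rewrite mnm0E expr0.
Qed.

Lemma monom_addn (E : pzRingType) (x : 'I_k -> E) (m1 m2 : 'I_k -> nat) :
  (forall i j, x i * x j = x j * x i) ->
  monom x (fun i => m1 i + m2 i)%N = monom x m1 * monom x m2.
Proof.
move=> xC; pose f (m : 'I_k -> nat) := [ffun i => m i] : {ffun 'I_k -> nat}.
have fE m : monom x m = monom x (f m) by apply: monom_ext => i; rewrite ffunE.
rewrite (fE m1) (fE m2) -monomD//; apply: monom_ext => i.
by rewrite !ffunE.
Qed.

Context (T_comm : forall i j, T i * T j = T j * T i).

Lemma bop_mulZl a (S S' : bop H) : (a *: S) * S' = a *: (S * S').
Proof. exact: bop_ext. Qed.

Lemma bop_mulZr a (S S' : bop H) : S * (a *: S') = a *: (S * S').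
Proof. by apply: bop_ext => x; rewrite -[LHS]/(S (a *: S' x)) linearZ. Qed.

Lemma poly_evalM p q : poly_eval T (p * q) = poly_eval T p * poly_eval T q.
Proof.
rewrite [p in LHS]mpolyE [q in LHS]mpolyE mulr_suml poly_eval_sum {2}/poly_eval.
rewrite mulr_suml; apply: eq_bigr => m _.
rewrite mulr_sumr poly_eval_sum [poly_eval T q]/poly_eval mulr_sumr; apply: eq_bigr => m' _.
rewrite -scalerAl -scalerAr !poly_evalZ -mpolyXD poly_evalX.
rewrite bop_mulZl bop_mulZr -monom_addn//; do 2 congr (_ *: _).
by apply: monom_ext => i; rewrite mnmDE.
Qed.

End poly_eval_theory.

(** * Orthonormal families *)

Section orthonormal.
Context (R : realType) (H : hilbertType R).

Definition orthonormal n (e : 'I_n -> H) : Prop :=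
  forall i j, hdot (e i) (e j) = (i == j)%:R.

Let hs := hdot_semi_inner H.

Lemma orthonormal_coef n (e : 'I_n -> H) (c : 'I_n -> R[i]) j :
  orthonormal e -> hdot (\sum_i c i *: e i) (e j) = c j.
Proof.
move=> eo; rewrite (form_suml hs) (bigD1 j)//= big1 ?addr0.
  by rewrite (formZl hs) eo eqxx mulr1.
by move=> i /negbTE ij; rewrite (formZl hs) eo ij mulr0.
Qed.

Lemma orthonormal_rnorm n (e : 'I_n -> H) (c : 'I_n -> R[i]) :
  orthonormal e -> rnorm (\sum_i c i *: e i) ^+ 2 = \sum_i rnorm (c i) ^+ 2.
Proof.
move=> eo; apply: complexI; rewrite -hdot_rnorm (form_sumr hs) rmorph_sum/=.
apply: eq_bigr => i _.
by rewrite (formZr hs) orthonormal_coef// mulrC mul_conj.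
Qed.

(** Gram-Schmidt: the residue of each new vector, once normalized, joins the
  orthonormal family unless it vanishes. *)
Lemma gram_schmidt (s : seq H) : exists n (e : 'I_n -> H),
  orthonormal e /\ forall x, x \in s -> x = \sum_i hdot x (e i) *: e i.
Proof.
suff [e [eu eo es]] : exists e : seq H, [/\ uniq e,
    {in e &, forall u v, hdot u v = (u == v)%:R} &
    forall x, x \in s -> x = \sum_(v <- e) hdot x v *: v].
  exists (size e), (fun i => e`_i); split=> [i j|x xs].
    by rewrite eo ?mem_nth// nth_uniq.
  by rewrite {1}(es x xs) (big_nth 0) big_mkord.
elim: s => [|x s [e [eu eo es]]]; first by exists [::].
pose p := \sum_(v <- e) hdot x v *: v.
have pe v : v \in e -> hdot p v = hdot x v.
  move=> ve; rewrite /p (form_suml hs) (bigD1_seq v)//= big_seq_cond big1 ?addr0.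
    by rewrite (formZl hs) (eo v v)// eqxx mulr1.
  by move=> w /andP[we /negbTE wv]; rewrite (formZl hs) (eo w v)// wv mulr0.
have [xp|xp] := eqVneq (x - p) 0.
  exists e; split=> // y; rewrite inE => /orP[/eqP->|/es//].
  by apply/eqP; rewrite -subr_eq0 xp.
set r := x - p in xp.
have re v : v \in e -> hdot r v = 0.
  by move=> ve; rewrite /r (formDl hs) (formNl hs) pe// subrr.
have r0 : rnorm r != 0 by apply: contra xp => /eqP/rnorm_eq0->.
pose u := (rnorm r)^-1%:C *: r.
have ue v : v \in e -> hdot u v = 0 by move=> ve; rewrite (formZl hs) re// mulr0.
have eu0 v : v \in e -> hdot v u = 0 by move=> ve; rewrite hdotC ue// rmorph0.
have uu : hdot u u = 1.
  rewrite hdot_rnorm rnormZ rnorm_real ger0_norm ?invr_ge0 ?rnorm_ge0//.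
  by rewrite mulVf// expr1n.
have une : u \notin e.
  by apply/negP => /ue/eqP; rewrite uu oner_eq0.
have ne v : v \in e -> (u == v) = false.
  by move=> ve; apply/negbTE; apply: contraNneq une => ->.
exists (u :: e); split=> /=; first by rewrite une.
  move=> v w; rewrite !inE => /orP[/eqP->|ve] /orP[/eqP->|we].
  - by rewrite uu eqxx.
  - by rewrite ue// ne.
  - by rewrite eu0// eq_sym ne.
  - exact: eo.
move=> y; rewrite inE big_cons => /orP[/eqP->|ys]; last first.
  rewrite [hdot y u](_ : _ = 0) ?scale0r ?add0r -?es//.
  rewrite (es y ys) (form_suml hs) big_seq big1// => v ve.
  by rewrite (formZl hs) eu0// mulr0.
have -> : hdot x u = (rnorm r)%:C.
  rewrite -(subrK p x) -/r (formDl hs) [hdot p u](_ : _ = 0) ?addr0.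
    rewrite (formZr hs) hdot_rnorm conjC_rmul -rmorphM/=; congr _%:C.
    by rewrite expr2 mulrA mulVf// mul1r.
  rewrite /p (form_suml hs) big_seq big1// => v ve.
  by rewrite (formZl hs) eu0// mulr0.
by rewrite /u scalerA -rmorphM/= divff// scale1r -/p /r subrK.
Qed.

(** A scalar matrix has the same norm on [H^n] as on [C^n]: coordinates in an
  orthonormal family split a vector of [H^n] into vectors of [C^n]. *)
Lemma scalar_matrix_bound n (A : 'M[R[i]]_n) (c : R) (y : 'I_n -> H) :
  0 <= c ->
  (forall x : 'I_n -> R[i]^o,
    vnorm (fun i => \sum_j A i j * x j : R[i]^o) <= c * vnorm x) ->
  vnorm (fun i => \sum_j A i j *: y j) <= c * vnorm y.
Proof.
move=> c0 Ac; have [m [e [eo ye]]] := gram_schmidt [seq y j | j <- enum 'I_n].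
have yE j : y j = \sum_l hdot (y j) (e l) *: e l.
  by apply: ye; apply/map_f; rewrite mem_enum.
apply: le_vnorm => //.
have -> : \sum_j rnorm (y j) ^+ 2 = \sum_l \sum_j rnorm (hdot (y j) (e l)) ^+ 2.
  rewrite exchange_big/=; apply: eq_bigr => j _.
  by rewrite {1}(yE j) orthonormal_rnorm.
have -> : \sum_i rnorm (\sum_j A i j *: y j) ^+ 2 =
    \sum_l \sum_i rnorm (\sum_j A i j * hdot (y j) (e l)) ^+ 2.
  rewrite exchange_big/=; apply: eq_bigr => i _.
  rewrite -(orthonormal_rnorm _ eo); congr (rnorm _ ^+ 2).
  under [RHS]eq_bigr do rewrite scaler_suml.
  rewrite exchange_big/=; apply: eq_bigr => j _.
  rewrite {1}(yE j) scaler_sumr; apply: eq_bigr => l _.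
  by rewrite scalerA.
rewrite mulr_sumr; apply: ler_sum => l _.
have /(lerXn2r 2) := Ac (fun j => hdot (y j) (e l)).
by rewrite !nnegrE ?mulr_ge0 ?vnorm_ge0// exprMn !vnorm_sqr; apply.
Qed.

End orthonormal.

(** * Characters of finite boxes *)

Section counting_limit.
Context (R : realType).

Lemma bernoulli_le (x : R) k : 0 <= x <= 1 -> 1 - k%:R * x <= (1 - x) ^+ k.
Proof.
move=> /andP[x0 x1]; elim: k => [|k IH]; first by rewrite mul0r subr0 expr0.
rewrite exprS; apply: (@le_trans _ _ ((1 - x) * (1 - k%:R * x))); last first.
  by rewrite ler_wpM2l// subr_ge0.
rewrite -subr_ge0 -natr1 [leRHS](_ : _ = k%:R * x ^+ 2); last by ring.
by rewrite mulr_ge0// sqr_ge0.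
Qed.

(** The boxes of side [N] and [N + d] have asymptotically the same size, so that
  estimates which hold up to boundary effects of width [d] become exact. *)
Lemma box_ratio_limit (a b : R) (k d : nat) : 0 <= a ->
  (forall N, (N ^ k)%:R * a <= ((N + d) ^ k)%:R * b) -> a <= b.
Proof.
move=> a0 ab; rewrite leNgt; apply/negP => ba.
pose N := Num.bound (a * (k * d)%:R / (a - b)).
have := archi_boundP (_ : 0 <= a * (k * d)%:R / (a - b)).
rewrite divr_ge0 ?mulr_ge0// ?subr_ge0 ?ltW// => /(_ isT); rewrite -/N => Nlt.
have N0 : 0 < N%:R :> R.
  by apply: le_lt_trans Nlt; rewrite divr_ge0 ?mulr_ge0// subr_ge0 ltW.
have M0 : 0 < (N + d)%:R :> R by rewrite natrD ltr_wpDr.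
have hB : 1 - k%:R * (d%:R / (N + d)%:R) <= (1 - d%:R / (N + d)%:R) ^+ k :> R.
  apply: bernoulli_le; rewrite divr_ge0// ler_pdivrMr// mul1r ler_nat.
  exact: leq_addl.
have MN : 1 - d%:R / (N + d)%:R = N%:R / (N + d)%:R :> R.
  by rewrite natrD; field; rewrite -natrD gt_eqF.
have h : (N%:R / (N + d)%:R) ^+ k * a <= b.
  rewrite expr_div_n mulrAC ler_pdivrMr ?exprn_gt0// mulrC [leRHS]mulrC.
  by have := ab N; rewrite !natrX mulrC.
rewrite MN in hB; have {}h := le_trans (ler_wpM2r a0 hB) h.
move: h; rewrite leNgt => /negP; apply.
have e : (1 - k%:R * (d%:R / (N + d)%:R)) * a = a - a * (k * d)%:R / (N + d)%:R.
  rewrite natrM; move: ((N + d)%:R : R) M0 => n n0.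
  by field; rewrite gt_eqF.
rewrite e ltrBrDl -ltrBrDr ltr_pdivrMr// [ltRHS]mulrC -ltr_pdivrMr ?subr_gt0//.
by apply: lt_le_trans Nlt _; rewrite ler_nat leq_addr.
Qed.

Lemma card_box (k N d : nat) :
  #|[pred b : {ffun 'I_k -> 'I_(N + d)} | [forall i, b i < N]%N]| = (N ^ k)%N.
Proof.
pose P := [pred i : 'I_(N + d) | i < N]%N.
rewrite -[RHS](_ : #|(ffun_on P : pred {ffun 'I_k -> 'I_(N + d)})| = _).
  by apply: eq_card => b; rewrite [LHS]inE; apply/forallP/ffun_onP => bP i;
    have := bP i; rewrite !inE.
rewrite card_ffun_on card_ord; congr (_ ^ _)%N.
rewrite -sum1_card (big_ord_narrow (leq_addr d N))/= sum_nat_const card_ord.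
by rewrite muln1.
Qed.

End counting_limit.

Section parseval.
Context (R : realType) (K : hilbertType R).

(** Stated for any matrix of coefficients with orthogonal columns, so that it serves
  for the Fourier transform and for its inverse. *)
Lemma parseval (I J : finType) (c : J -> I -> R[i]) (L : R) (x : I -> K) :
  (forall g g', \sum_w c w g * Num.conj (c w g') = (g == g')%:R * L%:C) ->
  \sum_w rnorm (\sum_g c w g *: x g) ^+ 2 = L * \sum_g rnorm (x g) ^+ 2.
Proof.
move=> orth; apply: complexI; rewrite rmorphM !rmorph_sum/=.
have hs := hdot_semi_inner K.
transitivity (\sum_g \sum_g' (\sum_w c w g * Num.conj (c w g')) * hdot (x g) (x g')).
  transitivity (\sum_w \sum_g \sum_g' c w g * Num.conj (c w g') * hdot (x g) (x g')).
    apply: eq_bigr => w _; rewrite -hdot_rnorm (form_suml hs); apply: eq_bigr => g _.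
    rewrite (formZl hs) (form_sumr hs) mulr_sumr; apply: eq_bigr => g' _.
    by rewrite (formZr hs) mulrA.
  rewrite exchange_big/=; apply: eq_bigr => g _.
  by rewrite exchange_big/=; apply: eq_bigr => g' _; rewrite mulr_suml.
rewrite mulr_sumr; apply: eq_bigr => g _.
rewrite (bigD1 g)//= [X in _ + X]big1 ?addr0; first by rewrite orth eqxx mul1r hdot_rnorm.
by move=> g' g'g; rewrite orth eq_sym (negbTE g'g) !mul0r.
Qed.

End parseval.

Section characters.
Context (R : realType) (M : nat) (M_gt0 : (0 < M)%N).

Lemma prim_root_exists : exists z : R[i], M.-primitive_root z.
Proof.
pose p : {poly R[i]} := 'X^M - 1.
have [r Dp] := closed_field_poly_normal p.
rewrite (monicP _) ?monicXnsubC // scale1r in Dp.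
have rn1: all M.-unity_root r by apply/allP=> z; rewrite -root_prod_XsubC -Dp.
have sz_r: (M < (size r).+1)%N.
  by rewrite -(size_prod_XsubC r id) -Dp size_XnsubC.
have [|z] := hasP (has_prim_root M_gt0 rn1 _ sz_r); last by exists z.
by rewrite -separable_prod_XsubC -Dp separable_Xn_sub_1 // pnatr_eq0 -lt0n.
Qed.

Context (zeta : R[i]) (zetaP : M.-primitive_root zeta) (k : nat).
Implicit Types (w g : {ffun 'I_k -> 'I_M}) (a b : 'I_k -> nat).

Lemma rnorm_zeta : rnorm zeta = 1.
Proof.
apply/eqP; rewrite -(@eqrXn2 _ M)// ?rnorm_ge0// -rnormX.
by rewrite (prim_expr_order zetaP) rnorm1 expr1n.
Qed.

Lemma conj_zeta : Num.conj zeta = zeta^-1.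
Proof.
have z0 : zeta != 0.
  by apply/eqP => z0; have := rnorm_zeta; rewrite z0 rnorm0 => /eqP; rewrite eq_sym oner_eq0.
by apply: (mulfI z0); rewrite mul_conj rnorm_zeta expr1n divff.
Qed.

Definition box_exponent g : 'I_k -> nat := fun i => g i.

Definition torus_pt w : 'I_k -> R[i] := fun i => zeta ^+ w i.

(** The dual of a finite box is the box itself; this symmetry gives the second
  orthogonality relation from the first one. *)
Lemma character_sym w g :
  monom (torus_pt w) (box_exponent g) = monom (torus_pt g) (box_exponent w).
Proof. by apply: eq_bigr => i _; rewrite -!exprM mulnC. Qed.

Lemma geometric_orthogonality (a b : nat) : (a < M)%N -> (b < M)%N ->
  \sum_(j < M) (zeta ^+ j) ^+ a * Num.conj ((zeta ^+ j) ^+ b) = (a == b)%:R * M%:R.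
Proof.
move=> aM bM; pose q := zeta ^+ a / zeta ^+ b.
rewrite (eq_bigr (fun j : 'I_M => q ^+ j)); last first.
  move=> j _; rewrite -!exprM rmorphXn/= conj_zeta /q.
  by rewrite exprMn !exprVn -!exprM [(a * j)%N]mulnC [(b * j)%N]mulnC.
have zb : zeta ^+ b != 0.
  rewrite expf_neq0//; apply/eqP => z0.
  by have := rnorm_zeta; rewrite z0 rnorm0 => /eqP; rewrite eq_sym oner_eq0.
have qM : q ^+ M = 1.
  by rewrite /q exprMn exprVn -!exprM ![(_ * M)%N]mulnC !exprM
    (prim_expr_order zetaP) !expr1n divff ?oner_neq0.
have [ab|ab] := eqVneq a b.
  rewrite mul1r /q ab divff// (eq_bigr (fun=> 1)); last by move=> j _; rewrite expr1n.
  by rewrite sumr_const card_ord.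
rewrite mul0r; apply/eqP; have := subrX1 q M; rewrite qM subrr => /esym/eqP.
rewrite mulf_eq0 => /orP[|//]; rewrite subr_eq0 => /eqP q1.
have : zeta ^+ a == zeta ^+ b by rewrite -[eqbLHS](divfK zb) -/q q1 mul1r.
by rewrite (eq_prim_root_expr zetaP) !modn_small// (negbTE ab).
Qed.

Lemma character_orthogonality a b : (forall i, a i < M)%N -> (forall i, b i < M)%N ->
  \sum_w monom (torus_pt w) a * Num.conj (monom (torus_pt w) b) =
  [forall i, a i == b i]%:R * ((M ^ k)%:R)%:C.
Proof.
move=> aM bM; pose F (i : 'I_k) (j : 'I_M) :=
  (zeta ^+ j) ^+ a i * Num.conj ((zeta ^+ j) ^+ b i).
transitivity (\sum_(w : {ffun 'I_k -> 'I_M}) \prod_i F i (w i)).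
  apply: eq_bigr => w _; rewrite /monom rmorph_prod -big_split/=.
  by apply: eq_bigr => i _.
rewrite -bigA_distr_bigA/= (eq_bigr (fun i => (a i == b i)%:R * M%:R)); last first.
  by move=> i _; rewrite geometric_orthogonality.
have [/forallP ab|] := boolP [forall i, a i == b i].
  rewrite mul1r (eq_bigr (fun=> M%:R)); last by move=> i _; rewrite ab mul1r.
  by rewrite prodr_const card_ord -natrX rmorph_nat.
rewrite negb_forall => /existsP[i /negbTE ab].
by rewrite (bigD1 i)//= ab !mul0r.
Qed.

Lemma character_orthogonality_fin g g' :
  \sum_w monom (torus_pt w) (box_exponent g) * Num.conj (monom (torus_pt w) (box_exponent g')) =
  (g == g')%:R * ((M ^ k)%:R)%:C.
Proof.
rewrite character_orthogonality /box_exponent//; congr ((nat_of_bool _)%:R * _).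
apply/forallP/eqP => [gg|->//].
by apply/ffunP => i; apply/val_inj; exact/eqP/gg.
Qed.

End characters.

(** * The von Neumann inequality for commuting isometries *)

Section isometries.
Context (R : realType) (K : hilbertType R) (k : nat) (V : 'I_k -> bop K).
Context (V_comm : forall i j, V i * V j = V j * V i).
Context (V_isom : forall i x, rnorm (V i x) = rnorm x).

Lemma monom_isom (m : 'I_k -> nat) x : rnorm (monom V m x) = rnorm x.
Proof.
rewrite /monom; elim/big_rec: _ x => // i S _ IH x.
rewrite -[LHS]/(rnorm ((V i ^+ m i) (S x))) -[RHS]IH; move: (S x) => y.
elim: (m i) => // j IHj; rewrite exprS -[LHS]/(rnorm (V i ((V i ^+ j) y))).
by rewrite V_isom.
Qed.

Lemma sum_bopE (W : normedModType R[i]) I (r : seq I) (F : I -> bop W) x :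
  (\sum_(i <- r) F i) x = \sum_(i <- r) F i x.
Proof. by elim/big_rec2: _ => // i y S _ <-. Qed.

Lemma poly_evalEx (p : mpoly k R[i]) x :
  poly_eval V p x = \sum_(m <- msupp p) mcoeff m p *: monom V m x.
Proof. by rewrite sum_bopE; apply: eq_bigr. Qed.

(** [C] bounds the matrix polynomial [p] uniformly on the torus. *)
Definition torus_bound n (p : 'M[mpoly k R[i]]_n) (C : R) : Prop :=
  forall (z : 'I_k -> R[i]) (x : 'I_n -> R[i]^o), (forall i, rnorm (z i) = 1) ->
    vnorm (fun i => \sum_j meval z (p i j) * x j : R[i]^o) <= C * vnorm x.

Lemma exponent_bound n (p : 'M[mpoly k R[i]]_n) : exists d,
  forall i j m, m \in msupp (p i j) -> forall l, (m l <= d)%N.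
Proof.
exists (\max_(ij : 'I_n * 'I_n) msize (p ij.1 ij.2))%N => i j m mp l.
apply: (@leq_trans (mdeg m)).
  by rewrite mdegE (bigD1 l)//= leq_addr.
apply: leq_trans (ltnW (msize_mdeg_lt mp)) _.
exact: (leq_bigmax (i, j)).
Qed.

(** Sample the orbit of [x] on the box of side [N + d] and take its discrete Fourier
  transform. At each frequency the scalar matrices [p(z)], with [z] on the torus, act
  with norm at most [C]; transforming back, they act as [p(V)] at all the points [b] of
  the box of side [N], from which shifts by exponents at most [d] do not leave the
  large box. As the [V i] are isometries, all the samples of an orbit have the same norm,
  so that the sums over both boxes are multiples of single squared norms. *)
Lemma isometry_box n (p : 'M[mpoly k R[i]]_n) (C : R) (d N : nat) (x : 'I_n -> K) :
  0 <= C -> torus_bound p C -> (0 < N + d)%N ->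
  (forall i j m, m \in msupp (p i j) -> forall l, (m l <= d)%N) ->
  (N ^ k)%:R * vnorm (fun i => \sum_j poly_eval V (p i j) (x j)) ^+ 2 <=
  ((N + d) ^ k)%:R * (C ^+ 2 * vnorm x ^+ 2).
Proof.
move=> C0 pC M0 pd; pose M := (N + d)%N.
have [zeta zetaP] := @prim_root_exists R M M0.
pose G := {ffun 'I_k -> 'I_M}.
pose chi (w g : G) : R[i] := monom (torus_pt zeta w) (box_exponent g).
pose L : R := (M ^ k)%:R.
have L0 : 0 < L by rewrite ltr0n expn_gt0 M0.
have chi_orth g g' : \sum_w chi w g * Num.conj (chi w g') = (g == g')%:R * L%:C.
  exact: character_orthogonality_fin.
(* the Fourier transform of the orbit of x j, and its image under p *)
pose eta j (w : G) := \sum_g Num.conj (chi w g) *: monom V (box_exponent g) (x j).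
pose y i (w : G) := \sum_j meval (torus_pt zeta w) (p i j) *: eta j w.
pose v i := \sum_j poly_eval V (p i j) (x j).
have eta_sum j : \sum_w rnorm (eta j w) ^+ 2 = L * (L * rnorm (x j) ^+ 2).
  rewrite (@parseval _ _ _ _ (fun w g => Num.conj (chi w g)) L); last first.
    move=> g g'; rewrite eq_sym -chi_orth; apply: eq_bigr => w _.
    by rewrite conjCK mulrC.
  congr (_ * _); rewrite (eq_bigr (fun=> rnorm (x j) ^+ 2)).
    by rewrite sumr_const card_ffun !card_ord -mulr_natl.
  by move=> g _; rewrite monom_isom.
have y_le w : \sum_i rnorm (y i w) ^+ 2 <= C ^+ 2 * \sum_j rnorm (eta j w) ^+ 2.
  have := @scalar_matrix_bound _ _ n
    (map_mx (meval (torus_pt zeta w)) p) C (fun j => eta j w) C0.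
  have zC (c : 'I_n -> R[i]^o) : vnorm (fun i => \sum_j
      map_mx (meval (torus_pt zeta w)) p i j * c j : R[i]^o) <= C * vnorm c.
    have := pC (torus_pt zeta w) c; set u := (X in _ -> X <= _).
    rewrite [leLHS](_ : _ = u) => [|]; last first.
      by apply: vnorm_ext => i; apply: eq_bigr => j _; rewrite mxE.
    by apply=> i; rewrite rnormX (rnorm_zeta M0 zetaP) expr1n.
  move=> /(_ zC)/(lerXn2r 2); rewrite !nnegrE ?mulr_ge0 ?vnorm_ge0// exprMn !vnorm_sqr.
  move=> /(_ isT isT); congr (_ <= _); apply: eq_bigr => i _.
  by congr (rnorm _ ^+ 2); apply: eq_bigr => j _; rewrite mxE.
pose good (b : G) := [forall l, b l < N]%N.
(* the inverse transform of y is p(V) x, shifted along the orbit *)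
have yhat i b : good b ->
    \sum_w chi b w *: y i w = L%:C *: monom V (box_exponent b) (v i).
  move=> /forallP gb.
  transitivity (\sum_j \sum_(a <- msupp (p i j)) \sum_g
      (mcoeff a (p i j) * \sum_w monom (torus_pt zeta w) (fun l => b l + a l)%N *
        Num.conj (chi w g)) *: monom V (box_exponent g) (x j)).
    rewrite /y; under eq_bigr do rewrite scaler_sumr.
    rewrite exchange_big/=; apply: eq_bigr => j _.
    under eq_bigr => w _.
      rewrite mevalE scalerA mulr_sumr scaler_suml.
      over.
    rewrite exchange_big/=; apply: eq_bigr => a _.
    under eq_bigr => w _ do rewrite /eta scaler_sumr.
    rewrite exchange_big/=; apply: eq_bigr => g _.
    rewrite mulr_sumr scaler_suml; apply: eq_bigr => w _.
    rewrite scalerA; congr (_ *: _); rewrite monom_addn; last first.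
      by move=> l l'; rewrite mulrC.
    by rewrite /chi -(character_sym _ w b) /monom/box_exponent; ring.
  rewrite linear_sum scaler_sumr; apply: eq_bigr => j _.
  rewrite poly_evalEx linear_sum scaler_sumr [LHS]big_seq [RHS]big_seq.
  apply: eq_bigr => a ap.
  have baM l : (b l + a l < M)%N.
    by rewrite /M (leq_trans (_ : _ < N + a l)%N) ?ltn_add2r// leq_add2l (pd i j).
  pose g0 : G := [ffun l => Ordinal (baM l)].
  rewrite (bigD1 g0)//= [X in _ + X]big1 ?addr0 => [|g gg0]; last first.
    rewrite /chi character_orthogonality//; last by move=> l; exact: ltn_ord.
    rewrite [X in nat_of_bool X](_ : _ = false).
      by rewrite mul0r mulr0 scale0r.
    apply/negbTE; apply: contra gg0 => /forallP h; apply/eqP/ffunP => l.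
    by rewrite ffunE; apply/val_inj/esym/eqP/h.
  rewrite /chi character_orthogonality//; last by move=> l; exact: ltn_ord.
  rewrite [X in nat_of_bool X](_ : _ = true); last first.
    by apply/forallP => l; rewrite /box_exponent ffunE.
  rewrite mul1r linearZ/= scalerA mulrC -/L; congr (_ *: _).
  rewrite -[RHS]/((monom V (box_exponent b) * monom V a) (x j)) -monom_addn//.
  by congr (bop_fun _ _); apply: monom_ext => l; rewrite /box_exponent ffunE.
have y_sum i : L ^+ 2 * ((N ^ k)%:R * rnorm (v i) ^+ 2) <= L * \sum_w rnorm (y i w) ^+ 2.
  rewrite -(@parseval _ _ _ _ (fun w b => chi w b) L)//.
  apply: (@le_trans _ _ (\sum_(b | good b) rnorm (\sum_w chi b w *: y i w) ^+ 2)).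
    rewrite (eq_bigr (fun=> L ^+ 2 * rnorm (v i) ^+ 2)) => [|b gb].
      by rewrite sumr_const card_box -[leRHS]mulr_natl mulrCA.
    by rewrite yhat// rnormZ monom_isom rnorm_real exprMn real_normK ?num_real.
  rewrite big_mkcond/=; apply: ler_sum => b _; case: ifP => // _; exact: sqr_ge0.
rewrite -(@ler_pM2l _ (L ^+ 2)) ?exprn_gt0//.
rewrite [vnorm (fun i => _) ^+ 2]vnorm_sqr -/v.
apply: (@le_trans _ _ (L * \sum_w \sum_i rnorm (y i w) ^+ 2)).
  rewrite exchange_big/= !mulr_sumr; apply: ler_sum => i _; exact: y_sum.
apply: (@le_trans _ _ (L * \sum_w (C ^+ 2 * \sum_j rnorm (eta j w) ^+ 2))).
  by rewrite ler_pM2l//; apply: ler_sum => w _; exact: y_le.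
rewrite -mulr_sumr exchange_big/= (eq_bigr _ (fun j _ => eta_sum j)) -!mulr_sumr.
by rewrite -vnorm_sqr -/M -/L le_eqVlt; apply/orP; left; apply/eqP; ring.
Qed.

Lemma isometry_von_neumann n (p : 'M[mpoly k R[i]]_n) (C : R) (x : 'I_n -> K) :
  0 <= C -> torus_bound p C ->
  vnorm (fun i => \sum_j poly_eval V (p i j) (x j)) <= C * vnorm x.
Proof.
move=> C0 pC; rewrite -(@ler_pXn2r _ 2)// ?nnegrE ?mulr_ge0 ?vnorm_ge0//.
have [d pd] := exponent_bound p.
apply: (@box_ratio_limit _ _ _ k d.+1) => [|N]; first exact: sqr_ge0.
rewrite exprMn; apply: isometry_box => //; first by rewrite addnS.
by move=> i j m mp l; rewrite leqW// (pd i j).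
Qed.

End isometries.

(** * The left regular representation *)

Section finite_support.
Context (R : realType) (I : choiceType).
Implicit Types (f : I -> R[i]^o).

Lemma l2psum_seq f (s : seq I) : uniq s ->
  l2psum f [fset x in s]%fset = \sum_(x <- s) rnorm (f x) ^+ 2.
Proof.
move=> su; apply: perm_big; apply: uniq_perm => //.
by move=> x; rewrite !inE.
Qed.

Lemma l2psum_supp f (s : seq I) (A : {fset I}) : uniq s ->
  (forall x, x \notin s -> f x = 0) ->
  l2psum f A <= \sum_(x <- s) rnorm (f x) ^+ 2.
Proof.
move=> su fs; rewrite /l2psum (bigID [in s])/= [X in _ + X]big1 ?addr0; last first.
  by move=> x /fs->; rewrite rnorm0 expr0n.
rewrite -big_filter [leLHS](_ : _ = \sum_(x <- s | x \in A) rnorm (f x) ^+ 2).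
  rewrite [leRHS](bigID [in A])/= lerDl sumr_ge0// => x _; exact: sqr_ge0.
rewrite -[RHS]big_filter; apply: perm_big; apply: uniq_perm.
- exact/filter_uniq/fset_uniq.
- exact: filter_uniq.
- by move=> x; rewrite !mem_filter andbC.
Qed.

End finite_support.

Section left_regular_tuple.
Context (R : realType) (k : nat).
Local Notation Nk := {ffun 'I_k -> nat}.

Definition gen_exponent (i : 'I_k) : Nk := [ffun j => (j == i : nat)].

Lemma semigroup_monom (E : pzRingType) (F : Nk -> E) :
  F 0 = 1 -> {morph F : p q / p + q >-> p * q} ->
  forall p, F p = monom (fun i => F (gen_exponent i)) p.
Proof.
move=> F0 FD p; have {1}-> : p = \sum_i gen_exponent i *+ p i.
  apply/ffunP => j; rewrite sum_ffunE (bigD1 j)//= big1 ?addr0.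
    rewrite ffunMnE ffunE eqxx; by rewrite -mulr_natl mulr1 natn.
  move=> i ij; rewrite ffunMnE ffunE eq_sym (negbTE ij).
  by rewrite mul0rn.
rewrite (big_morph F FD F0); apply: eq_bigr => i _.
elim: (p i) => [|n IH]; first by rewrite mulr0n.
by rewrite mulrS FD IH exprS.
Qed.

Lemma left_regular0 : left_regular R (0 : Nk) = 1.
Proof.
apply: bop_ext => f; apply: l2_ext => r.
change (shift_fun 0 f r = f r); rewrite /shift_fun ifT.
  by congr (l2_fun f _); apply/ffunP => i; rewrite !ffunE subn0.
by apply/forallP => i; rewrite ffunE.
Qed.

Lemma left_regularD : {morph (@left_regular R k) : p q / p + q >-> p * q}.
Proof.
move=> p q; apply: bop_ext => f; apply: l2_ext => r.
change (shift_fun (p + q) f r = shift_fun p (shift_fun q f) r).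
rewrite /shift_fun; have -> : lek (p + q) r = lek p r && lek q (subk r p).
  apply/forallP/andP => [h|[/forallP h1 /forallP h2] i].
    split; apply/forallP => i; have := h i; rewrite !ffunE.
      exact/leq_trans/leq_addr.
    by move=> h'; rewrite leq_subRL// (leq_trans _ h')// leq_addr.
  by have := h2 i; rewrite !ffunE leq_subRL.
case: (lek p r) => //=; case: (lek q _) => //; congr (l2_fun f _).
by apply/ffunP => i; rewrite !ffunE subnDA.
Qed.

Definition left_gen (i : 'I_k) : bop (l2 R Nk) := left_regular R (gen_exponent i).

Lemma left_regular_monom (p : Nk) : left_regular R p = monom left_gen p.
Proof. exact: semigroup_monom left_regular0 left_regularD p. Qed.

Lemma left_gen_comm i j : left_gen i * left_gen j = left_gen j * left_gen i.
Proof. by rewrite -!left_regularD addrC. Qed.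

Lemma l2_rnorm (I : choiceType) (x : l2 R I) : rnorm x = l2norm x.
Proof. by apply: complexI; rewrite rnormE. Qed.

Lemma l2_sumE (I : choiceType) J (r : seq J) (F : J -> l2 R I) x :
  (\sum_(j <- r) F j) x = \sum_(j <- r) F j x.
Proof. by elim/big_rec2: _ => // j y S _ <-. Qed.

Lemma left_gen_isom i (f : l2 R Nk) : rnorm (left_gen i f) = rnorm f.
Proof.
set p := gen_exponent i; rewrite !l2_rnorm; apply/eqP; rewrite eq_le; apply/andP; split.
  by have := @shift_le R k p f; rewrite !l2_normE lecR.
apply: l2norm_le => [|A]; first exact: l2norm_ge0.
rewrite l2norm_sqr.
apply: le_trans (l2psum_le [fset (p + r)%R | r in A]%fset (l2P (left_gen i f))).
rewrite /l2psum big_imfset/=; last by move=> r r1 _ _ e; rewrite -(addkK p r) e addkK.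
apply: ler_sum => r _.
by rewrite /shift_fun lek_addr addkK.
Qed.

Definition shifted_exponent m (g : {ffun 'I_k -> 'I_m}) (d : nat) : Nk :=
  [ffun i => g i + d]%N.

Lemma shifted_exponent_inj m d :
  injective (fun g : {ffun 'I_k -> 'I_m} => shifted_exponent g d).
Proof.
move=> g g' /ffunP gg; apply/ffunP => i; apply/val_inj.
by have := gg i; rewrite !ffunE => /addIn.
Qed.

Lemma monom_unit (z : 'I_k -> R[i]) (m : 'I_k -> nat) :
  (forall i, rnorm (z i) = 1) -> rnorm (monom z m) = 1.
Proof.
move=> z1; rewrite /monom; elim/big_rec: _ => [|i w _ w1]; first exact: rnorm1.
by rewrite rnormM rnormX z1 expr1n w1 mulr1.
Qed.

(** The functions [m |-> conj (z ^ m)], truncated to a large box, are approximate joint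
  eigenvectors of the shifts for the eigenvalues [z i]: at the points at distance
  at least [d] from the lower faces of the box, shifting by an exponent at most [d] multiplies them
  by the corresponding monomial in [z]. *)
Lemma left_regular_box n (p : 'M[mpoly k R[i]]_n) (C : R) (d N : nat)
    (z : 'I_k -> R[i]) (c : 'I_n -> R[i]^o) :
  (forall x : 'I_n -> l2 R Nk,
    vnorm (fun i => \sum_j poly_eval left_gen (p i j) (x j)) <= C * vnorm x) ->
  (forall i, rnorm (z i) = 1) ->
  (forall i j m, m \in msupp (p i j) -> forall l, (m l <= d)%N) ->
  (N ^ k)%:R * vnorm (fun i => \sum_j meval z (p i j) * c j : R[i]^o) ^+ 2 <=
  ((N + d) ^ k)%:R * (C ^+ 2 * vnorm c ^+ 2).
Proof.
move=> pC z1 pd; pose G := {ffun 'I_k -> 'I_(N + d)}.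
pose w (m : Nk) : R[i]^o :=
  if [forall i, m i < N + d]%N then Num.conj (monom z m) else 0.
pose box := [seq shifted_exponent g 0 | g : G].
have box_uniq : uniq box.
  by rewrite map_inj_uniq ?enum_uniq//; exact: shifted_exponent_inj.
have w_supp m : m \notin box -> w m = 0.
  rewrite /w; case: ifP => // /forallP mM /negP[].
  apply/mapP; exists [ffun i => Ordinal (mM i)]; first by rewrite mem_enum.
  by apply/ffunP => i; rewrite !ffunE addn0.
have w_le (a : R[i]^o) A : l2psum (a *: w) A <= ((N + d) ^ k)%:R * rnorm a ^+ 2.
  apply: le_trans (l2psum_supp A box_uniq _) _.
    by move=> m /w_supp wm; rewrite -[_ m]/(a *: w m) wm scaler0.
  rewrite big_map -[leRHS](_ : \sum_(g : G) rnorm a ^+ 2 = _); last first.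
    by rewrite sumr_const card_ffun !card_ord mulr_natl.
  rewrite big_enum/=; apply: ler_sum => g _.
  rewrite -[X in rnorm X]/(a * w (shifted_exponent g 0)) rnormM exprMn ler_piMr ?sqr_ge0//.
  rewrite /w; case: ifP => _; last by rewrite rnorm0 expr0n.
  by rewrite rnorm_conj monom_unit// expr1n.
pose xi j : l2 R Nk := L2 (l2sqP (w_le (c j))).
have xi_norm : vnorm xi ^+ 2 <= ((N + d) ^ k)%:R * vnorm c ^+ 2.
  rewrite !vnorm_sqr mulr_sumr; apply: ler_sum => j _.
  by rewrite l2_rnorm l2norm_sqr; apply: l2sqr_le; exact: w_le.
pose u i : R[i]^o := \sum_j meval z (p i j) * c j.
pose y i : l2 R Nk := \sum_j poly_eval left_gen (p i j) (xi j).
have yE i (g : {ffun 'I_k -> 'I_N}) :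
    y i (shifted_exponent g d) = Num.conj (monom z (shifted_exponent g d)) * u i.
  rewrite /y l2_sumE mulr_sumr; apply: eq_bigr => j _.
  rewrite poly_evalEx l2_sumE mevalE mulr_suml mulr_sumr big_seq [RHS]big_seq.
  apply: eq_bigr => a ap; pose a' : Nk := [ffun l => a l].
  have -> : monom left_gen a = left_regular R a'.
    by rewrite left_regular_monom; apply: monom_ext => l; rewrite ffunE.
  rewrite -[LHS]/(mcoeff a (p i j) * shift_fun a' (c j *: w) (shifted_exponent g d)).
  have ad l : (a l <= d)%N by exact: (pd i j).
  rewrite /shift_fun ifT; last first.
    by apply/forallP => l; rewrite !ffunE (leq_trans (ad l))// leq_addl.
  set m := subk _ _; rewrite -[(c j *: w) m]/(c j * w m).
  have mE : shifted_exponent g d = a' + m.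
    by apply/ffunP => l; rewrite /m !ffunE; apply/esym/subnKC;
      rewrite (leq_trans (ad l))// leq_addl.
  rewrite /w ifT; last first.
    apply/forallP => l; rewrite /m !ffunE (leq_ltn_trans (leq_subr _ _))//.
    by rewrite ltn_add2r.
  rewrite mE monomD; last by move=> l l'; rewrite mulrC.
  have za : Num.conj (monom z a') * monom z a = 1.
    rewrite mulrC [monom z a'](_ : _ = monom z a).
      by rewrite mul_conj monom_unit// expr1n.
    by apply: monom_ext => l; rewrite ffunE.
  rewrite rmorphM/= -[\prod_i z i ^+ a i]/(monom z a).
  rewrite [RHS](_ : _ = (Num.conj (monom z a') * monom z a) *
    (mcoeff a (p i j) * (c j * Num.conj (monom z m)))); last by ring.
  by rewrite za mul1r.
have y_norm i : (N ^ k)%:R * rnorm (u i) ^+ 2 <= rnorm (y i) ^+ 2.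
  pose s := [seq shifted_exponent g d | g : {ffun 'I_k -> 'I_N}].
  have su : uniq s by rewrite map_inj_uniq ?enum_uniq//; exact: shifted_exponent_inj.
  rewrite l2_rnorm l2norm_sqr.
  apply: le_trans (l2psum_le [fset x in s]%fset (l2P _)).
  rewrite (l2psum_seq _ su) big_map big_enum/=.
  rewrite (eq_bigr (fun=> rnorm (u i) ^+ 2)).
    by rewrite sumr_const card_ffun !card_ord mulr_natl.
  by move=> g _; rewrite yE rnormM rnorm_conj monom_unit// mul1r.
rewrite [vnorm (fun i => _) ^+ 2]vnorm_sqr mulr_sumr.
apply: (@le_trans _ _ (vnorm y ^+ 2)).
  by rewrite vnorm_sqr; apply: ler_sum => i _; exact: y_norm.
apply: (@le_trans _ _ (C ^+ 2 * vnorm xi ^+ 2)).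
  rewrite -exprMn lerXn2r ?nnegrE ?vnorm_ge0//; last exact: pC.
  by apply: le_trans (pC xi); exact: vnorm_ge0.
by rewrite [leRHS]mulrCA ler_wpM2l ?sqr_ge0.
Qed.

(** The converse of the von Neumann inequality for the isometries [left_gen i]: both
  together make the algebra that they generate completely isometric to the algebra of
  polynomials on the torus. *)
Lemma left_regular_lower_bound n (p : 'M[mpoly k R[i]]_n) (C : R) : 0 <= C ->
  (forall x : 'I_n -> l2 R Nk,
    vnorm (fun i => \sum_j poly_eval left_gen (p i j) (x j)) <= C * vnorm x) ->
  torus_bound p C.
Proof.
move=> C0 pC z c z1.
rewrite -(@ler_pXn2r _ 2)// ?nnegrE ?mulr_ge0 ?vnorm_ge0//.
have [d pd] := exponent_bound p.
apply: (@box_ratio_limit _ _ _ k d) => [|N]; first exact: sqr_ge0.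
by rewrite exprMn; exact: left_regular_box.
Qed.

End left_regular_tuple.

(** * Extension of completely contractive maps to the closure *)

Section rate.
Context (R : realType).

Definition rate (l : nat) : R := l.+1%:R^-1.

Lemma rate_ge0 l : 0 <= rate l. Proof. by rewrite invr_ge0. Qed.

Lemma rate_gt0 l : 0 < rate l. Proof. by rewrite invr_gt0. Qed.

Lemma rate_le1 l : rate l <= 1.
Proof. by rewrite invf_le1// ler1n. Qed.

Lemma rate_lt (e : R) : 0 < e -> exists N, forall l, (N <= l)%N -> rate l < e.
Proof.
move=> e0; exists (Num.bound e^-1) => l Nl.
rewrite -[e]invrK ltf_pV2 ?posrE ?invr_gt0//.
apply: lt_le_trans (archi_boundP _) _; first by rewrite invr_ge0 ltW.
by rewrite ler_nat leqW.
Qed.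

Lemma le_eps1 (x y c : R) :
  (forall e, 0 < e -> e <= 1 -> x <= y + e * c) -> x <= y.
Proof.
move=> h; apply: (@le_eps _ _ _ (Num.max c 0)) => [|e e0].
  by rewrite le_max lexx orbT.
have m0 : 0 < Num.min e 1 by rewrite lt_min e0 ltr01.
have := h _ m0; rewrite ge_min lexx orbT => /(_ isT)/le_trans; apply.
rewrite lerD2l; apply: (@le_trans _ _ (Num.min e 1 * Num.max c 0)).
  by rewrite ler_wpM2l ?(ltW m0)// le_max lexx.
by rewrite ler_wpM2r// ?le_max ?lexx ?orbT// ge_min lexx.
Qed.

Lemma le_rate (x y c : R) : (forall l, x <= y + rate l * c) -> x <= y.
Proof.
move=> h; apply: (@le_eps _ _ _ (Num.max c 0)) => [|e e0].
  by rewrite le_max lexx orbT.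
have [N Ne] := rate_lt e0; apply: le_trans (h N) _; rewrite lerD2l.
apply: (@le_trans _ _ (rate N * Num.max c 0)).
  by rewrite ler_wpM2l ?rate_ge0// le_max lexx.
by rewrite ler_wpM2r ?le_max ?lexx ?orbT// ltW// Ne.
Qed.

Lemma eq_eps1 (V : normedModType R[i]) (x y : V) (c : R) :
  (forall e, 0 < e -> e <= 1 -> rnorm (x - y) <= e * c) -> x = y.
Proof.
move=> h; apply/subr0_eq/rnorm_eq0/eqP; rewrite eq_le rnorm_ge0 andbT.
by apply: (@le_eps1 _ _ c) => e e0 e1; rewrite add0r h.
Qed.

Lemma eq_rate (V : normedModType R[i]) (x y : V) (c : R) :
  (forall l, rnorm (x - y) <= rate l * c) -> x = y.
Proof.
move=> h; apply/subr0_eq/rnorm_eq0/eqP; rewrite eq_le rnorm_ge0 andbT.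
by apply: (@le_rate _ _ c) => l; rewrite add0r h.
Qed.

(** All the limits below are limits of sequences with this modulus. Completeness is a
  hypothesis, rather than a structure on [V], so that the scalars are covered. *)
Lemma cauchy_rate (V : normedModType R[i]) (u : nat -> V) (c : R) :
  (forall F : set_system V, ProperFilter F -> cauchy F -> cvg F) ->
  0 <= c -> (forall l m, rnorm (u l - u m) <= (rate l + rate m) * c) ->
  exists y, forall l, rnorm (u l - y) <= rate l * c.
Proof.
move=> Vc c0 uc.
have small (e : R) : 0 < e -> exists N, forall l, (N <= l)%N -> rate l * c < e.
  move=> e0; have e1 : 0 < e / (c + 1) by rewrite divr_gt0// ltr_wpDl.
  have [N Ne] := rate_lt e1; exists N => l /Ne; rewrite ltr_pdivlMr ?ltr_wpDl//.
  by apply: le_lt_trans; rewrite ler_wpM2l ?rate_ge0// lerDl.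
have : cvg (u @ \oo).
  apply: Vc; apply/cauchy_ballP => e e0.
  have eE : e = (complex.Re e)%:C by rewrite RRe_real// gtr0_real.
  have e1 : 0 < complex.Re e by rewrite -ltcR -eE.
  have e2 : 0 < complex.Re e / 2 by rewrite divr_gt0.
  have [N Ne] := small _ e2.
  rewrite near_map2; exists ([set l | (N <= l)%N], [set l | (N <= l)%N]).
    by split; exists N.
  move=> [l m] [/= Nl Nm]; rewrite -ball_normE/= eE -rnormE ltcR.
  apply: le_lt_trans (uc l m) _; rewrite mulrDl (splitr (complex.Re e)).
  exact: ltrD (Ne _ Nl) (Ne _ Nm).
move=> /cvg_ex[y /cvgrPdist_lt uy]; exists y => l.
apply: (@le_eps _ _ _ 2) => // e e0.
have [N Ne] := small _ e0.
have := uy e%:C; rewrite ltcR => /(_ e0) [N' _ N'y].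
pose m := maxn N N'.
have h1 : rnorm (u m - y) < e.
  by rewrite -ltcR rnormE distrC; apply: N'y; rewrite /= leq_maxr.
apply: le_trans (rnorm_triangle _ (u m) _) _.
have := uc l m; rewrite mulrDl => h2.
have h3 : rate m * c < e by apply: Ne; rewrite leq_maxl.
by rewrite mulr2n mulrDr mulr1; move: (rate l * c) (rate m * c) h2 h3 => r1 r2; lra.
Qed.

End rate.

Section extension.
Context (R : realType) (E : lmodType R[i]) (one : E) (mul : E -> E -> E).
Context (Omega : Type) (W : normedModType R[i]) (act : Omega -> E -> W -> W).
Context (actP : forall w a x y v,
  act w (a *: x + y) v = a *: act w x v + act w y v).
Context (actM : forall w x y v, act w (mul x y) v = act w x (act w y v)).
Context (actB : forall w x v v', act w x (v - v') = act w x v - act w x v').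

(** [E] acts on the spaces [W], one action for each [w]. The functions on the torus are
  covered by their multiplications of scalars, the operators on a space by their only
  action on it. *)
Definition act_bound (x : E) (c : R) : Prop :=
  forall w v, rnorm (act w x v) <= c * rnorm v.

Definition mxact_bound n (M : 'M[E]_n) (c : R) : Prop :=
  forall w (v : 'I_n -> W),
    vnorm (fun i => \sum_j act w (M i j) (v j)) <= c * vnorm v.

Context (N1 : E -> \bar R) (Nm : forall n, 'M[E]_n -> \bar R).
Context (N1_le : forall x c, (N1 x <= c%:E)%E -> act_bound x c).
Context (Nm_le : forall n (M : 'M[E]_n) c, (Nm M <= c%:E)%E -> 0 <= c /\ mxact_bound M c).
Context (Nm_ge0 : forall n (M : 'M[E]_n), (0 <= Nm M)%E).

Context (k : nat) (e : mpoly k R[i] -> E).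
Context (eP : forall a p q, e (a *: p + q) = a *: e p + e q).
Context (eM : forall p q, e (p * q) = mul (e p) (e q)).
Context (e1 : e 1 = one).
Context (e_bounded : forall p, exists2 c, 0 <= c & act_bound (e p) c).

Context (H : hilbertType R) (T : 'I_k -> bop H).
Context (T_comm : forall i j, T i * T j = T j * T i).
Context (T_contr : forall n (p : 'M[mpoly k R[i]]_n) c, 0 <= c ->
  mxact_bound (map_mx e p) c -> forall x : 'I_n -> H,
  vnorm (fun i => \sum_j poly_eval T (p i j) (x j)) <= c * vnorm x).

Context (A : set E).
Context (A_closure : A `<=` norm_closure N1 (range e)).

Let actD w x y v : act w (x + y) v = act w x v + act w y v.
Proof. by rewrite -[x]scale1r actP !scale1r. Qed.

Let act0 w v : act w 0 v = 0.
Proof. by apply: (addrI (act w 0 v)); rewrite -actD !addr0. Qed.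

Let actZ w a x v : act w (a *: x) v = a *: act w x v.
Proof. by rewrite -[a *: x]addr0 actP act0 addr0. Qed.

Let actN w x v : act w (- x) v = - act w x v.
Proof. by rewrite -scaleN1r actZ scaleN1r. Qed.

Let eD p q : e (p + q) = e p + e q.
Proof. by rewrite -[p]scale1r eP !scale1r. Qed.

Let e0 : e 0 = 0.
Proof. by apply: (addrI (e 0)); rewrite -eD !addr0. Qed.

Let eZ a p : e (a *: p) = a *: e p.
Proof. by rewrite -[a *: p]addr0 eP e0 addr0. Qed.

Let eB p q : e (p - q) = e p - e q.
Proof. by rewrite eD -[- q]scaleN1r eZ scaleN1r. Qed.

Lemma act_boundD x y c d : act_bound x c -> act_bound y d ->
  act_bound (x + y) (c + d).
Proof.
move=> xc yd w v; rewrite actD mulrDl; apply: le_trans (rnormD _ _) _.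
exact: lerD.
Qed.

Lemma act_boundN x c : act_bound x c -> act_bound (- x) c.
Proof. by move=> xc w v; rewrite actN rnormN. Qed.

Lemma act_boundZ a x c : act_bound x c -> act_bound (a *: x) (rnorm a * c).
Proof.
move=> xc w v; rewrite actZ rnormZ -mulrA ler_wpM2l ?rnorm_ge0//; exact: xc.
Qed.

Lemma poly_contr p c x : 0 <= c -> act_bound (e p) c ->
  rnorm (poly_eval T p x) <= c * rnorm x.
Proof.
move=> c0 pc.
have := @T_contr 1 (\matrix_(i, j) p) c c0 _ (fun=> x).
rewrite !vnorm1/= big_ord1 mxE; apply.
by move=> w v; rewrite !vnorm1/= big_ord1 !mxE; exact: pc.
Qed.

Definition approximable (a : E) : Prop :=
  forall d, 0 < d -> exists p, act_bound (e p - a) d.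

Lemma A_approximable a : A a -> approximable a.
Proof.
move=> /A_closure Ca d d0; have [_ [p _ <-] pa] := Ca d d0.
by exists p; rewrite -opprB; apply/act_boundN/N1_le/ltW.
Qed.

(** The value [S] of the extension at [a] is pinned down, without a choice of
  approximations, by the inequality that a contractive map satisfies at all the
  differences [e p - a]. *)
Definition extends_at (a : E) (S : bop H) : Prop :=
  forall p c, 0 <= c -> act_bound (e p - a) c ->
    forall x, rnorm (poly_eval T p x - S x) <= c * rnorm x.

Lemma poly_eval_lipschitz p q a c d x : 0 <= c -> 0 <= d ->
  act_bound (e p - a) c -> act_bound (e q - a) d ->
  rnorm (poly_eval T p x - poly_eval T q x) <= (c + d) * rnorm x.
Proof.
move=> c0 d0 pa qa; have := @poly_contr (p - q) (c + d) x (addr_ge0 c0 d0).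
rewrite poly_evalB; apply.
rewrite eB -(subrK a (e p)) -addrA.
by apply: act_boundD => //; rewrite -opprB; exact: act_boundN.
Qed.

Lemma extends_at_exists a : approximable a -> exists S, extends_at a S.
Proof.
move=> aa; have /choice[p pa] : forall l, exists p, act_bound (e p - a) (rate R l).
  by move=> l; apply: aa; exact: rate_gt0.
pose u l x := poly_eval T (p l) x.
have uc x l m : rnorm (u l x - u m x) <= (rate R l + rate R m) * rnorm x.
  by apply: (poly_eval_lipschitz x _ _ (pa l) (pa m)); exact: rate_ge0.
have /choice[S0 S0u] : forall x, exists y, forall l,
    rnorm (u l x - y) <= rate R l * rnorm x.
  by move=> x; apply: cauchy_rate; [exact: cauchy_cvg|exact: rnorm_ge0|exact: uc].
have S0lin : linear S0.
  move=> b x y; apply: (@eq_rate _ _ _ _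
    (rnorm (b *: x + y) + (rnorm b * rnorm x + rnorm y))) => l.
  apply: le_trans (rnorm_triangle _ (u l (b *: x + y)) _) _.
  rewrite mulrDr lerD//; first by rewrite rnormB_sym.
  rewrite {1}/u linearP opprD addrACA -scalerBr.
  apply: le_trans (rnormD _ _) _; rewrite rnormZ mulrDr lerD//; last exact: (S0u y l).
  by rewrite [leRHS]mulrCA ler_wpM2l ?rnorm_ge0//; exact: (S0u x l).
pose D0 x := S0 x - u 0%N x.
have D0lin : linear D0.
  by move=> b x y; rewrite /D0 S0lin /u linearP opprD addrACA -scalerBr.
have D0le x : `|D0 x| <= `|x|.
  rewrite -!rnormE lecR rnormB_sym; apply: le_trans (S0u x 0%N) _.
  by rewrite /rate invr1 mul1r.
exists (Bop (bounded_bop D0lin D0le) + poly_eval T (p 0%N)) => q c c0 qa x.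
rewrite -[X in rnorm X]/(poly_eval T q x - (S0 x - u 0%N x + u 0%N x)) subrK.
apply: (@le_rate _ _ _ (2 * rnorm x)) => l.
apply: le_trans (rnorm_triangle _ (u l x) _) _.
have h1 : rnorm (poly_eval T q x - u l x) <= (c + rate R l) * rnorm x.
  by apply: (poly_eval_lipschitz x _ _ qa (pa l)) => //; exact: rate_ge0.
have h2 := S0u x l.
apply: le_trans (lerD h1 h2) _.
by rewrite le_eqVlt; apply/orP; left; apply/eqP; ring.
Qed.

Definition extension (a : E) : bop H := xget 0 [set S | extends_at a S].

Lemma extensionP a : approximable a -> extends_at a (extension a).
Proof.
by move=> /extends_at_exists[S aS]; apply: (@xgetPex _ 0 [set S | extends_at a S]); exists S.
Qed.

Lemma approximable_poly p : approximable (e p).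
Proof.
move=> d d0; exists p => w v; rewrite subrr act0 rnorm0.
by rewrite mulr_ge0 ?rnorm_ge0// ltW.
Qed.

(** To identify the value at [a], it suffices to compare it with the values at
  polynomials close to [a]. *)
Lemma extension_unique a (S : bop H) : approximable a ->
  (forall x, exists C, forall d, 0 < d -> d <= 1 -> exists p c, [/\ 0 <= c,
    c <= d * C, act_bound (e p - a) c & rnorm (poly_eval T p x - S x) <= d * C]) ->
  extension a = S.
Proof.
move=> aa h; apply: bop_ext => x; have [C hC] := h x.
apply: (@eq_eps1 _ _ _ _ (C * rnorm x + C)) => d d0 d1.
have [p [c [c0 cC pa pS]]] := hC d d0 d1.
apply: le_trans (rnorm_triangle _ (poly_eval T p x) _) _.
rewrite mulrDr lerD//; rewrite rnormB_sym.
apply: le_trans (extensionP aa c0 pa x) _.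
by rewrite mulrA ler_wpM2r ?rnorm_ge0.
Qed.

Lemma extension_poly p : extension (e p) = poly_eval T p.
Proof.
apply: extension_unique; first exact: approximable_poly.
move=> x; exists 0 => d d0 _; exists p, 0; rewrite mulr0 !subrr rnorm0 !lexx; split=> //.
by move=> w v; rewrite act0 rnorm0 mul0r.
Qed.

Lemma approximable_lin (b : R[i]) a a' : approximable a -> approximable a' ->
  approximable (b *: a + a') /\ extension (b *: a + a') =
    b *: extension a + extension a'.
Proof.
move=> aa aa'.
have key d : 0 < d -> exists p q, [/\ act_bound (e p - a) d, act_bound (e q - a') d &
    act_bound (e (b *: p + q) - (b *: a + a')) (d * (rnorm b + 1))].
  move=> d0; have [p pa] := aa d d0; have [q qa] := aa' d d0.
  exists p, q; split=> //; rewrite eP opprD addrACA -scalerBr mulrDr mulr1 mulrC.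
  by apply: act_boundD => //; exact: act_boundZ.
have b0 : 0 < rnorm b + 1 by rewrite ltr_wpDl ?rnorm_ge0.
have ab : approximable (b *: a + a').
  move=> d d0; have [|p [q [_ _ h]]] := key (d / (rnorm b + 1)).
    by rewrite divr_gt0.
  by exists (b *: p + q); rewrite divfK ?gt_eqF// in h.
split=> //; apply: extension_unique => // x.
exists ((rnorm b + 1) * (1 + rnorm x)) => d d0 d1.
have [p [q [pa qa h]]] := key d d0.
exists (b *: p + q), (d * (rnorm b + 1)); split=> //.
- by rewrite mulr_ge0// ltW.
- by rewrite ler_wpM2l ?(ltW d0)// ler_peMr ?(ltW b0)// lerDl rnorm_ge0.
- rewrite poly_evalP -[X in rnorm X]/(b *: poly_eval T p x + poly_eval T q x -
    (b *: extension a x + extension a' x)) opprD addrACA -scalerBr.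
  apply: le_trans (rnormD _ _) _; rewrite rnormZ.
  have h1 := extensionP aa (ltW d0) pa x; have h2 := extensionP aa' (ltW d0) qa x.
  apply: (@le_trans _ _ (rnorm b * (d * rnorm x) + d * rnorm x)).
    by rewrite lerD// ler_wpM2l ?rnorm_ge0.
  rewrite [leLHS](_ : _ = d * ((rnorm b + 1) * rnorm x)); last by ring.
  by rewrite ler_wpM2l ?(ltW d0)// ler_wpM2l ?(ltW b0)// lerDr.
Qed.

Lemma approximable_bounded a : approximable a -> exists2 c, 0 <= c & act_bound a c.
Proof.
move=> aa; have [p pa] := aa 1 ltr01; have [c c0 pc] := e_bounded p.
exists (c + 1); first exact: addr_ge0.
rewrite -(subKr (e p) a); apply: act_boundD => //; exact: act_boundN.
Qed.

Lemma approximable_mul a a' : approximable a -> approximable a' ->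
  extension (mul a a') = extension a * extension a'.
Proof.
move=> aa aa'.
have [al al0 aal] := approximable_bounded aa.
have [be be0 abe] := approximable_bounded aa'.
have key d : 0 < d -> d <= 1 -> exists p q, [/\ act_bound (e p - a) d,
    act_bound (e q - a') d, act_bound (e p) (al + 1) &
    act_bound (e (p * q) - mul a a') (d * (al + be + 1))].
  move=> d0 d1; have [p pa] := aa d d0; have [q qa] := aa' d d0.
  have pb : act_bound (e p) (al + 1).
    move=> w v; rewrite -(subrK a (e p)) addrC.
    have := act_boundD aal pa w v; move/le_trans; apply.
    by rewrite ler_wpM2r ?rnorm_ge0// lerD2l.
  exists p, q; split=> // w v.
  rewrite eM actD actN !actM.
  have -> : act w (e p) (act w (e q) v) - act w a (act w a' v) =
      act w (e p) (act w (e q - a') v) + act w (e p - a) (act w a' v).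
    by rewrite (actD w (e q)) (actD w (e p)) !actN actB addrA subrK.
  apply: le_trans (rnormD _ _) _.
  have h1 : rnorm (act w (e p) (act w (e q - a') v)) <= (al + 1) * (d * rnorm v).
    by apply: le_trans (pb _ _) _; rewrite ler_wpM2l ?addr_ge0//; exact: qa.
  have h2 : rnorm (act w (e p - a) (act w a' v)) <= d * (be * rnorm v).
    by apply: le_trans (pa _ _) _; rewrite ler_wpM2l ?(ltW d0)//; exact: abe.
  apply: le_trans (lerD h1 h2) _.
  by rewrite le_eqVlt; apply/orP; left; apply/eqP; ring.
have g0 : 0 < al + be + 1 by rewrite ltr_wpDl// addr_ge0.
have ab : approximable (mul a a').
  move=> d d0; pose d' := Num.min 1 (d / (al + be + 1)).
  have d'0 : 0 < d' by rewrite lt_min ltr01 divr_gt0.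
  have d'1 : d' <= 1 by rewrite ge_min lexx.
  have [p [q [_ _ _ h]]] := key _ d'0 d'1; exists (p * q) => w v.
  apply: le_trans (h w v) _; rewrite ler_wpM2r ?rnorm_ge0//.
  by rewrite -ler_pdivlMr// ge_min lexx orbT.
apply: extension_unique => // x.
pose y := extension a' x.
exists (al + be + 1 + (al + 1) * rnorm x + rnorm y) => d d0 d1.
have [p [q [pa qa pb h]]] := key d d0 d1.
have al1 : 0 <= al + 1 by rewrite addr_ge0.
exists (p * q), (d * (al + be + 1)); split=> //.
- by rewrite mulr_ge0// ltW.
- by rewrite ler_wpM2l ?(ltW d0)// -[leRHS]addrA lerDl addr_ge0 ?mulr_ge0 ?rnorm_ge0.
- rewrite poly_evalM// -[X in rnorm X]/(poly_eval T p (poly_eval T q x) - extension a y).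
  apply: le_trans (rnorm_triangle _ (poly_eval T p y) _) _.
  have h1 : rnorm (poly_eval T p (poly_eval T q x) - poly_eval T p y) <=
      (al + 1) * (d * rnorm x).
    rewrite -linearB; apply: le_trans (poly_contr _ al1 pb) _.
    by rewrite ler_wpM2l//; exact: (extensionP aa' (ltW d0) qa x).
  have h2 := extensionP aa (ltW d0) pa y.
  apply: le_trans (lerD h1 h2) _.
  rewrite mulrCA -mulrDr ler_wpM2l ?(ltW d0)//.
  by rewrite lerD2r lerDr ltW.
Qed.

Lemma extension_cc n (M : 'M[E]_n) : (forall i j, approximable (M i j)) ->
  (opmxnorm (map_mx extension M) <= Nm M)%E.
Proof.
move=> aM; apply: le_of_bounds; first exact: Nm_ge0.
move=> c /Nm_le[c0 Mc]; apply/opmxnorm_le; split=> // x.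
apply: (@le_eps _ _ _ (2 * (n%:R * (n%:R * vnorm x)))) => [|d d0].
  by rewrite !mulr_ge0 ?vnorm_ge0.
have /choice[p pM] : forall ij : 'I_n * 'I_n, exists p,
    act_bound (e p - M ij.1 ij.2) d by move=> [i j]; exact: aM.
pose P := \matrix_(i, j) p (i, j).
have PM : mxact_bound (map_mx e P) (c + d * (n%:R * n%:R)).
  move=> w v; rewrite (@vnorm_ext _ _ _ _ (fun i => \sum_j act w (M i j) (v j) +
    \sum_j act w (e (p (i, j)) - M i j) (v j))); last first.
    move=> i; rewrite -big_split/=; apply: eq_bigr => j _.
    by rewrite !mxE (actD w (e _)) actN addrC subrK.
  apply: le_trans (vnormD _ _) _; rewrite mulrDl lerD// -!mulrA.
  by apply: (vnorm_entries (ltW d0)) => i j; exact: (pM (i, j)).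
have cd0 : 0 <= c + d * (n%:R * n%:R) by rewrite addr_ge0 ?mulr_ge0// ltW.
rewrite (@vnorm_ext _ _ _ _ (fun i => \sum_j poly_eval T (P i j) (x j) +
  \sum_j (extension (M i j) (x j) - poly_eval T (P i j) (x j)))); last first.
  move=> i; rewrite -big_split/=; apply: eq_bigr => j _.
  by rewrite mxE addrC subrK.
apply: le_trans (vnormD _ _) _.
have h1 := T_contr cd0 PM x.
have h2 : vnorm (fun i => \sum_j (extension (M i j) (x j) - poly_eval T (P i j) (x j)))
    <= d * (n%:R * (n%:R * vnorm x)).
  apply: (vnorm_entries (ltW d0)) => i j; rewrite rnormB_sym.
  by apply: (extensionP (aM i j) (ltW d0)); rewrite mxE; exact: (pM (i, j)).
apply: le_trans (lerD h1 h2) _.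
by rewrite le_eqVlt; apply/orP; left; apply/eqP; ring.
Qed.

(** The assignment [e p |-> poly_eval T p] is contractive on differences, hence Cauchy
  along approximations of a point of the closure; all the properties of its extension
  are limits of properties at polynomials. *)
Lemma cc_extension : exists phi : E -> bop H,
  cc_representation one mul Nm A phi /\ forall p, phi (e p) = poly_eval T p.
Proof.
exists extension; split; last exact: extension_poly.
split.
- by rewrite -e1 extension_poly poly_eval1.
- move=> a b /set_mem/A_approximable aa /set_mem/A_approximable ab.
  by have [_] := approximable_lin 1 aa ab; rewrite !scale1r.
- move=> b a /set_mem/A_approximable aa.
  have := (approximable_lin b aa (approximable_poly 0)).2.
  by rewrite extension_poly poly_eval0 e0 !addr0.
- move=> a b /set_mem/A_approximable aa /set_mem/A_approximable ab.
  exact: approximable_mul.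
- by move=> n M AM; apply: extension_cc => i j; exact/A_approximable/AM.
Qed.

End extension.

(** * The extension theorem of M. Riesz *)

Section riesz_extension.
Context (R : realType) (V : lmodType R) (C : set V).
Context (C0 : C 0).
Context (CD : forall u v, C u -> C v -> C (u + v)).
Context (CZ : forall (t : R) v, 0 < t -> C v -> C (t *: v)).

(** Graphs of positive linear functionals defined on subspaces of [V]; positivity
  makes such a relation single-valued. *)
Definition positive_graph (G : set (V * R)) : Prop :=
  [/\ G (0, 0),
      forall (a : R) p q, G p -> G q -> G (a *: p.1 + q.1, a * p.2 + q.2)
    & forall p, G p -> C p.1 -> 0 <= p.2].

Lemma positive_graph_mono G p q : positive_graph G -> G p -> G q ->
  C (q.1 - p.1) -> p.2 <= q.2.
Proof.
move=> [_ GP Gpos] Gp Gq; have := Gpos _ (GP (-1) _ _ Gp Gq); rewrite /=.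
by rewrite scaleN1r mulN1r addrC => h /h; rewrite addrC subr_ge0.
Qed.

Lemma positive_graph_fun G v s t : positive_graph G -> G (v, s) -> G (v, t) -> s = t.
Proof.
move=> PG Gs Gt; apply/eqP; rewrite eq_le.
by rewrite (positive_graph_mono PG Gs Gt) ?(positive_graph_mono PG Gt Gs)//= subrr.
Qed.

(** The value of the extension at [v] can be any number between the values at the
  elements of the domain below [v] and the values at the elements above [v]. *)
Lemma positive_graph_step G v p q : positive_graph G -> G p -> G q ->
  C (v - p.1) -> C (q.1 - v) ->
  exists G', [/\ positive_graph G', G `<=` G' & exists t, G' (v, t)].
Proof.
move=> PG Gp Gq vp qv; have [G0 GP Gpos] := PG.
pose S := [set r.2 | r in [set r | G r /\ C (v - r.1)]].
have Sub : has_ubound S.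
  exists q.2 => _ [r [Gr vr] <-]; apply: (positive_graph_mono PG Gr Gq).
  by have := CD qv vr; rewrite addrA subrK.
have S0 : S !=set0 by exists p.2, p.
pose a := sup S.
have aS r : G r -> C (v - r.1) -> r.2 <= a.
  by move=> Gr vr; apply: ub_le_sup => //; exists r.
have Sa r : G r -> C (r.1 - v) -> a <= r.2.
  move=> Gr rv; apply: ge_sup => // _ [r' [Gr' vr'] <-].
  apply: (positive_graph_mono PG Gr' Gr).
  by have := CD rv vr'; rewrite addrA subrK.
have GZ (b : R) r : G r -> G (b *: r.1, b * r.2).
  by move=> Gr; have := GP b _ _ Gr G0; rewrite /= !addr0.
exists [set r | exists (b : R) r', G r' /\ r = (b *: v + r'.1, b * a + r'.2)].
split; last by exists a, 1, (0, 0); rewrite scale1r mul1r !addr0.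
- split.
  + by exists 0, (0, 0); rewrite scale0r mul0r !addr0.
  + move=> b _ _ [c [r [Gr ->]]] [d [r' [Gr' ->]]] /=.
    exists (b * c + d), (b *: r.1 + r'.1, b * r.2 + r'.2); split; first exact: GP.
    congr (_, _) => /=; last by ring.
    by rewrite scalerDr scalerDl scalerA addrACA.
  + move=> _ [b [r [Gr ->]]] /= Cb.
    have [b0|b0|b0] := ltgtP b 0.
    * have nb : 0 < - b^-1 by rewrite oppr_gt0 invr_lt0.
      have := Sa _ (GZ (- b^-1) _ Gr); rewrite /=.
      have := CZ nb Cb; rewrite scalerDr scalerA mulNr mulVf ?lt_eqF// scaleN1r addrC.
      move=> h /(_ h); rewrite -subr_ge0 [X in 0 <= X -> _](_ : _ = - b^-1 * (b * a + r.2)).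
        by rewrite pmulr_rge0.
      by field; rewrite lt_eqF.
    * have nb : 0 < b^-1 by rewrite invr_gt0.
      have := aS _ (GZ (- b^-1) _ Gr); rewrite /=.
      have := CZ nb Cb; rewrite scalerDr scalerA mulVf ?gt_eqF// scale1r scaleNr opprK.
      move=> h /(_ h); rewrite -subr_ge0 [X in 0 <= X -> _](_ : _ = b^-1 * (b * a + r.2)).
        by rewrite pmulr_rge0.
      by field; rewrite gt_eqF.
    * by move: Cb; rewrite b0 scale0r mul0r !add0r; exact: Gpos.
- by move=> [s t] Gr; exists 0, (s, t); rewrite scale0r mul0r !add0r.
Qed.

(** M. Riesz: by Zorn's lemma there is a maximal positive extension, and by the
  one-step extension its domain contains all the elements that lie between two
  elements of the initial domain. *)
Lemma riesz_extension (G0 : set (V * R)) : positive_graph G0 ->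
  exists G, [/\ positive_graph G, G0 `<=` G &
    forall v p q, G0 p -> G0 q -> C (v - p.1) -> C (q.1 - v) -> exists t, G (v, t)].
Proof.
move=> PG0.
(* the union of an empty chain is empty, hence the first alternative *)
pose P (G : set (V * R)) := G = set0 \/ positive_graph G /\ G0 `<=` G.
have [F FP Ftot|G [PG Gmax]] := @Zorn_bigcup _ P.
  have [[G [FG G_neq0]]|F0] := pselect (exists G, F G /\ G <> set0); last first.
    left; apply/seteqP; split=> // x [G FG Gx].
    by case: F0; exists G; split=> // G0'; move: Gx; rewrite G0'.
  have PF G' : F G' -> G' <> set0 -> positive_graph G' /\ G0 `<=` G'.
    by move=> /FP[].
  have Fpos G' x : F G' -> G' x -> positive_graph G' /\ G0 `<=` G'.
    by move=> FG' Gx; apply: PF => // G0'; move: Gx; rewrite G0'.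
  right; split; last first.
    by apply: (subset_trans (PF _ FG G_neq0).2); exact: bigcup_sup.
  split.
  - by exists G => //; have [[]] := PF _ FG G_neq0.
  - move=> a p q [G1 FG1 G1p] [G2 FG2 G2q].
    have [[_ P1 _] _] := Fpos _ _ FG1 G1p; have [[_ P2 _] _] := Fpos _ _ FG2 G2q.
    have [G12|G21] := Ftot _ _ FG1 FG2.
      by exists G2 => //; apply: P2 => //; exact: G12.
    by exists G1 => //; apply: P1 => //; exact: G21.
  - move=> p [G1 FG1 G1p]; have [[_ _ pos] _] := Fpos _ _ FG1 G1p; exact: pos.
have nG : G <> set0.
  move=> Ge; apply: (Gmax G0); last by right; split.
  rewrite Ge; split=> // h; have [G00 _ _] := PG0; exact: (h _ G00).
have [//|[PG' G0G]] := PG.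
exists G; split=> // v p q G0p G0q vp qv.
have [G' [PG1 GG' [t G't]]] := positive_graph_step PG' (G0G _ G0p) (G0G _ G0q) vp qv.
exists t; apply: contrapT => nGt; apply: (Gmax G').
  by split=> // h; apply: nGt; exact: h.
by right; split=> //; exact: subset_trans GG'.
Qed.

End riesz_extension.

(** * Completion of a semi-inner product space *)

Record preHilbert (R : realType) := PreHilbert {
  pre_sort :> lmodType R[i];
  pre_form : pre_sort -> pre_sort -> R[i];
  pre_formP : semi_inner pre_form }.

Section completion_def.
Context (R : realType) (X : preHilbert R).
Local Notation s := (@pre_form R X).
Local Notation hs := (@pre_formP R X).
Local Notation nrm := (seminorm s).

(** The completion is the closure of the functionals [s f] among the bounded
  functionals on [X]; a vector of seminorm zero gives the zero functional, so that the
  quotient by these vectors is implicit. *)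
Definition completion_pred : {pred (X -> R[i]^o)} :=
  mem [set l : X -> R[i]^o | forall d, 0 < d -> exists f,
    forall g, rnorm (l g - s f g) <= d * nrm g].

Record completion := Completion {
  completion_fun :> X -> R[i]^o;
  completionP : completion_fun \in completion_pred }.

HB.instance Definition _ := [isSub for completion_fun].
HB.instance Definition _ := [Choice of completion by <:].

Lemma completion_submod_closed : submod_closed completion_pred.
Proof.
split.
  rewrite inE => d d0; exists 0 => g.
  by rewrite -[X in rnorm X]/(0 - s 0 g) (form0l hs) subrr rnorm0 mulr_ge0 ?seminorm_ge0 ?ltW.
move=> a l l'; rewrite !inE => hl hl' d d0.
have b0 : 0 < rnorm a + 1 by rewrite ltr_wpDl ?rnorm_ge0.
have e0 : 0 < d / (rnorm a + 1) by rewrite divr_gt0.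
have [f hf] := hl _ e0; have [f' hf'] := hl' _ e0.
exists (a *: f + f') => g; rewrite (semi_innerPl hs).
rewrite -[X in rnorm X]/(a * l g + l' g - (a * s f g + s f' g)) opprD addrACA -mulrBr.
apply: le_trans (rnormD _ _) _; rewrite rnormM.
apply: (@le_trans _ _ (rnorm a * (d / (rnorm a + 1) * nrm g) +
  d / (rnorm a + 1) * nrm g)).
  by apply: lerD (hf' g); apply: ler_wpM2l (hf g); exact: rnorm_ge0.
by rewrite le_eqVlt; apply/orP; left; apply/eqP; field; rewrite gt_eqF.
Qed.

HB.instance Definition _ := GRing.isSubmodClosed.Build _ _ completion_pred
  completion_submod_closed.
HB.instance Definition _ := [SubChoice_isSubLmodule of completion by <:].

Implicit Types (l : completion) (f g : X).

Lemma completion_ext l l' : l =1 l' -> l = l'.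
Proof. by move=> ll; apply/val_inj/funext. Qed.

Lemma completion_approx l d : 0 < d -> exists f,
  forall g, rnorm (l g - s f g) <= d * nrm g.
Proof. by have := completionP l; rewrite inE; apply. Qed.

Lemma functional_bounded l :
  exists2 c, 0 <= c & forall g, rnorm (l g) <= c * nrm g.
Proof.
have [f hf] := completion_approx l ltr01.
exists (1 + nrm f) => [|g]; first by rewrite addr_ge0 ?seminorm_ge0.
rewrite -(subrK (s f g) (l g)); apply: le_trans (rnormD _ _) _.
by rewrite mulrDl; apply: lerD; [exact: hf|exact: (cauchy_schwarz hs)].
Qed.

Definition dual_norm l : R :=
  inf [set c | 0 <= c /\ forall g, rnorm (l g) <= c * nrm g].

Let dual_norm_inf l : has_inf [set c | 0 <= c /\ forall g, rnorm (l g) <= c * nrm g].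
Proof.
split; first by have [c c0 lc] := functional_bounded l; exists c.
by exists 0 => c [].
Qed.

Lemma dual_norm_ge0 l : 0 <= dual_norm l.
Proof. by apply: lb_le_inf; [have [] := dual_norm_inf l|move=> c []]. Qed.

Lemma dual_norm_le l c : 0 <= c -> (forall g, rnorm (l g) <= c * nrm g) -> dual_norm l <= c.
Proof. by move=> c0 lc; apply: ge_inf; [have [] := dual_norm_inf l|]. Qed.

Lemma dual_norm_bound l g : rnorm (l g) <= dual_norm l * nrm g.
Proof.
apply: (@le_eps _ _ _ (nrm g)) => [|e e0]; first exact: seminorm_ge0.
have [c [c0 lc] ce] := inf_adherent e0 (dual_norm_inf l).
by apply: le_trans (lc g) _; rewrite -mulrDl ler_wpM2r ?seminorm_ge0// ltW.
Qed.

Lemma dual_normD l l' : dual_norm (l + l') <= dual_norm l + dual_norm l'.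
Proof.
apply: dual_norm_le => [|g]; first by rewrite addr_ge0 ?dual_norm_ge0.
rewrite mulrDl; apply: le_trans (rnormD _ _) _; apply: lerD; exact: dual_norm_bound.
Qed.

Lemma dual_normZ_le (a : R[i]) l : dual_norm (a *: l) <= rnorm a * dual_norm l.
Proof.
apply: dual_norm_le => [|g]; first by rewrite mulr_ge0 ?rnorm_ge0 ?dual_norm_ge0.
rewrite -[(a *: l) g]/(a * l g) rnormM -mulrA ler_wpM2l ?rnorm_ge0//.
exact: dual_norm_bound.
Qed.

Lemma dual_normZ (a : R[i]) l : dual_norm (a *: l) = rnorm a * dual_norm l.
Proof.
apply/eqP; rewrite eq_le dual_normZ_le/=.
have [->|a0] := eqVneq a 0; first by rewrite rnorm0 mul0r dual_norm_ge0.
have := dual_normZ_le a^-1 (a *: l); rewrite scalerA mulVf// scale1r => h.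
apply: le_trans (ler_wpM2l (rnorm_ge0 a) h) _.
by rewrite mulrA -rnormM divff// rnorm1 mul1r.
Qed.

Lemma dual_norm0_eq0 l : dual_norm l = 0 -> l = 0.
Proof.
move=> l0; apply: completion_ext => g; apply: rnorm_eq0.
by apply/eqP; rewrite eq_le rnorm_ge0 andbT; have := dual_norm_bound l g; rewrite l0 mul0r.
Qed.

Lemma dual_normC_le l l' : (dual_norm (l + l'))%:C <= (dual_norm l)%:C + (dual_norm l')%:C.
Proof. by rewrite -rmorphD lecR dual_normD. Qed.

Lemma dual_normC_Z (a : R[i]) l : (dual_norm (a *: l))%:C = `|a| * (dual_norm l)%:C.
Proof. by rewrite dual_normZ rmorphM/= rnormE. Qed.

Lemma dual_normC_eq0 l : (dual_norm l)%:C = 0 -> l = 0.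
Proof. by move/complexI/dual_norm0_eq0. Qed.

HB.instance Definition _ := @Lmodule_isNormed.Build R[i] completion
  (fun l => (dual_norm l)%:C) dual_normC_le dual_normC_Z dual_normC_eq0.

Lemma dual_normE l : rnorm l = dual_norm l.
Proof. by apply: complexI; rewrite rnormE. Qed.

Lemma embed_subproof f : (s f : X -> R[i]^o) \in completion_pred.
Proof.
rewrite inE => d d0; exists f => g; rewrite subrr rnorm0.
by rewrite mulr_ge0 ?seminorm_ge0 ?ltW.
Qed.

Definition embed f : completion := Completion (embed_subproof f).

Lemma embed_linear : linear embed.
Proof. by move=> a f g; apply: completion_ext => h; exact: (semi_innerPl hs). Qed.

HB.instance Definition _ := GRing.isLinear.Build _ _ _ _ embed embed_linear.

Lemma embed_rnorm f : rnorm (embed f) = nrm f.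
Proof.
rewrite dual_normE; apply/eqP; rewrite eq_le; apply/andP; split.
  apply: dual_norm_le => [|g]; first exact: seminorm_ge0.
  exact: (cauchy_schwarz hs).
have := dual_norm_bound (embed f) f; rewrite -[embed f f]/(s f f) (form_diag hs).
rewrite rnorm_real ger0_norm ?sqr_ge0//.
have [->|f0] := eqVneq (nrm f) 0; first by rewrite dual_norm_ge0.
by rewrite expr2 ler_pM2r// lt_def f0 seminorm_ge0.
Qed.

Lemma embed_dense l d : 0 < d -> exists f, rnorm (l - embed f) <= d.
Proof.
move=> d0; have [f hf] := completion_approx l d0; exists f.
by rewrite dual_normE; apply: dual_norm_le => //; exact: ltW.
Qed.

Lemma completion_complete (F : set_system completion) :
  ProperFilter F -> cauchy F -> cvg F.
Proof.
move=> FF /cauchy_ballP Fc.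
have /choice[l Fl] : forall n, exists l, \forall y \near F, rnorm (l - y) < rate R n.
  move=> n; have := Fc (rate R n)%:C; rewrite ltcR rate_gt0 => /(_ isT).
  move=> [[P Q] /= [FP FQ] PQ]; have /filter_ex[l Pl] := FP.
  exists l; apply: filterS FQ => y Qy.
  by have := PQ (l, y) (conj Pl Qy); rewrite -ball_normE/= -rnormE ltcR.
have /choice[f fl] : forall n, exists f, rnorm (l n - embed f) <= rate R n.
  by move=> n; apply: embed_dense; exact: rate_gt0.
have ff n m : nrm (f n - f m) <= (rate R n + rate R m) * 2.
  rewrite -embed_rnorm linearB.
  have /filter_ex[y [/= ny my]] : F ([set y | rnorm (l n - y) < rate R n] `&`
      [set y | rnorm (l m - y) < rate R m]).
    by apply: filterI; [exact: (Fl n)|exact: (Fl m)].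
  have h1 := rnorm_triangle (embed (f n)) (l n) (embed (f m)).
  have h2 := rnorm_triangle (l n) (l m) (embed (f m)).
  have h3 := rnorm_triangle (l n) y (l m).
  rewrite (rnormB_sym _ (l n)) in h1; rewrite (rnormB_sym y) in h3.
  rewrite [leRHS](_ : _ = rate R n + (rate R n + rate R m + rate R m)); last by ring.
  apply: le_trans h1 (lerD (fl n) _); apply: le_trans h2 (lerD _ (fl m)).
  exact: le_trans h3 (lerD (ltW ny) (ltW my)).
have /choice[lim limf] : forall g, exists c : R[i]^o, forall n,
    rnorm (s (f n) g - c : R[i]^o) <= rate R n * (2 * nrm g).
  move=> g; apply: (@cauchy_rate _ _ (fun n => s (f n) g : R[i]^o)).
  - exact: complexC_complete.
  - by rewrite mulr_ge0 ?seminorm_ge0.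
  - move=> n m; rewrite -(formNl hs) -(formDl hs).
    apply: le_trans (cauchy_schwarz hs _ _) _; rewrite mulrA.
    by rewrite ler_wpM2r ?seminorm_ge0.
have limP : lim \in completion_pred.
  rewrite inE => d d0; have [N Nd] := @rate_lt R (d / 2) (divr_gt0 d0 (ltr0Sn _ _)).
  exists (f N) => g; rewrite rnormB_sym; apply: le_trans (limf g N) _.
  rewrite mulrA ler_wpM2r ?seminorm_ge0//.
  by have := Nd N (leqnn N); lra.
apply/cvg_ex; exists (Completion limP); apply/cvgrPdist_lt => e e0.
have eE : e = (complex.Re e)%:C by rewrite RRe_real// gtr0_real.
have e1 : 0 < complex.Re e by rewrite -ltcR -eE.
have [N Ne] := @rate_lt R (complex.Re e / 4) (divr_gt0 e1 (ltr0Sn _ _)).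
apply: filterS (Fl N) => y yN; rewrite eE -rnormE ltcR.
have h1 := rnorm_triangle (Completion limP) (embed (f N)) y.
have h2 := rnorm_triangle (embed (f N)) (l N) y.
have h3 : rnorm (Completion limP - embed (f N)) <= rate R N * 2.
  rewrite dual_normE; apply: dual_norm_le => [|g]; first by rewrite mulr_ge0 ?rate_ge0.
  by rewrite -mulrA -[X in rnorm X]/(lim g - s (f N) g) rnormB_sym; exact: limf.
have h4 : rnorm (embed (f N) - l N) <= rate R N by rewrite rnormB_sym.
apply: le_lt_trans h1 _; apply: le_lt_trans (lerD h3 h2) _.
rewrite addrA; apply: (@lt_le_trans _ _ (rate R N * 2 + rate R N + rate R N)).
  by apply: ler_ltD yN; rewrite lerD2l.
rewrite [leLHS](_ : _ = rate R N * 4); last by ring.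
by rewrite -ler_pdivlMr// ltW// Ne.
Qed.

HB.instance Definition _ := Uniform_isComplete.Build completion completion_complete.

(** The inner product [c] of [l] and [l'] is pinned down by an estimate that is
  symmetric in [l] and [l'] and does not depend on a choice of approximations. *)
Definition is_completion_dot l l' (c : R[i]) : Prop := forall f f' d, 0 <= d ->
  rnorm (l - embed f) <= d -> rnorm (l' - embed f') <= d ->
  rnorm (c - s f f') <= d * (rnorm l + rnorm l' + d).

Lemma form_lipschitz l l' f f' g g' d e : 0 <= d -> 0 <= e ->
  rnorm (l - embed f) <= d -> rnorm (l' - embed f') <= d ->
  rnorm (l - embed g) <= e -> rnorm (l' - embed g') <= e ->
  rnorm (s f f' - s g g') <= (d + e) * (rnorm l + rnorm l' + d + e).
Proof.
move=> d0 e0 lf lf' lg lg'.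
have -> : s f f' - s g g' = s (f - g) f' + s g (f' - g').
  by rewrite (formDl hs) (formNl hs) (formDr hs) (formNr hs) addrA subrK.
apply: le_trans (rnormD _ _) _.
have fg : nrm (f - g) <= d + e.
  rewrite -embed_rnorm linearB; apply: le_trans (rnorm_triangle _ l _) _.
  by rewrite lerD// rnormB_sym.
have fg' : nrm (f' - g') <= d + e.
  rewrite -embed_rnorm linearB; apply: le_trans (rnorm_triangle _ l' _) _.
  by rewrite lerD// rnormB_sym.
have nf' : nrm f' <= rnorm l' + d.
  rewrite -embed_rnorm -[embed f'](subrK l') addrC; apply: le_trans (rnormD _ _) _.
  by rewrite lerD2l rnormB_sym.
have ng : nrm g <= rnorm l + e.
  rewrite -embed_rnorm -[embed g](subrK l) addrC; apply: le_trans (rnormD _ _) _.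
  by rewrite lerD2l rnormB_sym.
have h1 : rnorm (s (f - g) f') <= (d + e) * (rnorm l' + d).
  by apply: le_trans (cauchy_schwarz hs _ _) _; rewrite ler_pM ?seminorm_ge0.
have h2 : rnorm (s g (f' - g')) <= (rnorm l + e) * (d + e).
  by apply: le_trans (cauchy_schwarz hs _ _) _; rewrite ler_pM ?seminorm_ge0.
apply: le_trans (lerD h1 h2) _.
by rewrite le_eqVlt; apply/orP; left; apply/eqP; ring.
Qed.

Lemma completion_dot_exists l l' : exists c, is_completion_dot l l' c.
Proof.
have /choice[f fl] : forall n, exists f, rnorm (l - embed f) <= rate R n.
  by move=> n; apply: embed_dense; exact: rate_gt0.
have /choice[f' fl'] : forall n, exists f', rnorm (l' - embed f') <= rate R n.
  by move=> n; apply: embed_dense; exact: rate_gt0.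
have [||n m|c cf] := @cauchy_rate _ _ (fun n => s (f n) (f' n) : R[i]^o)
    (rnorm l + rnorm l' + 2).
- exact: complexC_complete.
- by rewrite !addr_ge0 ?rnorm_ge0.
- apply: le_trans (form_lipschitz (rate_ge0 _ n) (rate_ge0 _ m) (fl n) (fl' n)
    (fl m) (fl' m)) _.
  rewrite ler_wpM2l ?addr_ge0 ?rate_ge0// -addrA lerD2l.
  by have := rate_le1 R n; have := rate_le1 R m; lra.
exists c => g g' d d0 lg lg'.
apply: (@le_rate _ _ _ (rnorm l + rnorm l' + 2 + (rnorm l + rnorm l' + d + d + 1))) => n.
apply: le_trans (rnorm_triangle (c : R[i]^o) (s (f n) (f' n)) _) _.
have h1 := cf n; rewrite rnormB_sym in h1.
have h2 := form_lipschitz (rate_ge0 _ n) d0 (fl n) (fl' n) lg lg'.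
apply: le_trans (lerD h1 h2) _.
move: (rnorm l) (rnorm l') (rnorm_ge0 l) (rnorm_ge0 l') => a b a0 b0.
have r0 := rate_ge0 R n; have r1 := rate_le1 R n.
rewrite -subr_ge0 [X in 0 <= X](_ : _ = rate R n * (1 - rate R n)); last by ring.
by rewrite mulr_ge0// subr_ge0.
Qed.

Definition completion_dot l l' : R[i] := xget 0 [set c | is_completion_dot l l' c].

Lemma completion_dotP l l' : is_completion_dot l l' (completion_dot l l').
Proof.
have [c lc] := completion_dot_exists l l'.
by apply: (@xgetPex _ 0 [set c | is_completion_dot l l' c]); exists c.
Qed.

Lemma completion_dot_unique l l' c C : 0 <= C ->
  (forall d, 0 < d -> d <= 1 -> exists f f', [/\ rnorm (l - embed f) <= d * C,
    rnorm (l' - embed f') <= d * C & rnorm (c - s f f') <= d * C]) ->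
  completion_dot l l' = c.
Proof.
move=> C0 h; apply: (@eq_eps1 _ R[i]^o _ _
  (C * (rnorm l + rnorm l' + C) + C)) => d d0 d1.
have [f [f' [lf lf' cf]]] := h d d0 d1.
apply: le_trans (rnorm_triangle (completion_dot l l' : R[i]^o) (s f f') _) _.
have h2 : rnorm (s f f' - c : R[i]^o) <= d * C by rewrite rnormB_sym.
have dC : 0 <= d * C by rewrite mulr_ge0// ltW.
apply: le_trans (lerD (completion_dotP dC lf lf') h2) _.
rewrite [leRHS]mulrDr lerD2r -mulrA ler_wpM2l ?(ltW d0)// ler_wpM2l// lerD2l.
by rewrite ler_piMl.
Qed.

Lemma completion_dot_embed f g : completion_dot (embed f) (embed g) = s f g.
Proof.
apply: (@completion_dot_unique _ _ _ 0) => // d _ _.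
by exists f, g; rewrite !subrr !rnorm0 mulr0.
Qed.

Lemma completion_dotC l l' : completion_dot l' l = Num.conj (completion_dot l l').
Proof.
apply: (@completion_dot_unique _ _ _ (rnorm l + rnorm l' + 2)) => [|d d0 d1].
  by rewrite !addr_ge0 ?rnorm_ge0.
have [f lf] := embed_dense l d0; have [f' lf'] := embed_dense l' d0.
have ll := rnorm_ge0 l; have ll' := rnorm_ge0 l'.
exists f', f; split.
- by apply: le_trans lf' _; rewrite ler_peMr ?(ltW d0)//; lra.
- by apply: le_trans lf _; rewrite ler_peMr ?(ltW d0)//; lra.
- rewrite (semi_innerC hs f f') -rmorphB rnorm_conj.
  apply: le_trans (completion_dotP (ltW d0) lf lf') _.
  by rewrite ler_wpM2l ?(ltW d0)//; lra.
Qed.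

Lemma completion_dot_linearl a l1 l2 l' :
  completion_dot (a *: l1 + l2) l' = a * completion_dot l1 l' + completion_dot l2 l'.
Proof.
have a0 := rnorm_ge0 a; have n1 := rnorm_ge0 l1; have n2 := rnorm_ge0 l2.
have n' := rnorm_ge0 l'.
pose C := rnorm a * (rnorm l1 + rnorm l' + 1) + (rnorm l2 + rnorm l' + 1).
have aC : 0 <= rnorm a * (rnorm l1 + rnorm l') by rewrite mulr_ge0// addr_ge0.
have Ca : rnorm a + 1 <= C by rewrite /C !mulrDr mulr1; rewrite mulrDr in aC; lra.
apply: (@completion_dot_unique _ _ _ C) => [|d d0 d1]; first by lra.
have [f1 lf1] := embed_dense l1 d0; have [f2 lf2] := embed_dense l2 d0.
have [f' lf'] := embed_dense l' d0.
exists (a *: f1 + f2), f'; split.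
- rewrite linearP opprD addrACA -scalerBr; apply: le_trans (rnormD _ _) _.
  rewrite rnormZ; apply: (@le_trans _ _ (d * (rnorm a + 1))); last first.
    by rewrite ler_wpM2l ?(ltW d0).
  by rewrite mulrDr mulr1 lerD// mulrC ler_wpM2r.
- by apply: le_trans lf' _; rewrite ler_peMr ?(ltW d0)//; lra.
- rewrite (semi_innerPl hs) opprD addrACA -mulrBr; apply: le_trans (rnormD _ _) _.
  rewrite rnormM /C mulrDr; apply: lerD.
    rewrite mulrCA ler_wpM2l//; apply: le_trans (completion_dotP (ltW d0) lf1 lf') _.
    by rewrite ler_wpM2l ?(ltW d0)//; lra.
  apply: le_trans (completion_dotP (ltW d0) lf2 lf') _.
  by rewrite ler_wpM2l ?(ltW d0)//; lra.
Qed.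

Lemma completion_dot_norm l : completion_dot l l = `|l| ^+ 2.
Proof.
have n0 := rnorm_ge0 l.
rewrite -rnormE -rmorphXn/=.
apply: (@completion_dot_unique _ _ _ (2 * rnorm l + 1)) => [|d d0 d1]; first by lra.
have [f lf] := embed_dense l d0.
have dC : rnorm (l - embed f) <= d * (2 * rnorm l + 1).
  by apply: le_trans lf _; rewrite ler_peMr ?(ltW d0)//; lra.
exists f, f; split=> //; rewrite (form_diag hs) -rmorphB rnorm_real -embed_rnorm.
have h1 : rnorm (embed f) <= rnorm l + d.
  rewrite -[embed f](subrK l) addrC; apply: le_trans (rnormD _ _) _.
  by rewrite lerD2l rnormB_sym.
have h2 : rnorm l <= rnorm (embed f) + d.
  rewrite -[X in rnorm X <= _](subrK (embed f) l) addrC.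
  by apply: le_trans (rnormD _ _) _; rewrite lerD2l.
move: (rnorm l) (rnorm (embed f)) n0 (rnorm_ge0 (embed f)) h1 h2 => x y x0 y0 h1 h2.
rewrite subr_sqr normrM [X in _ * X <= _]ger0_norm ?addr_ge0//.
apply: ler_pM; rewrite ?addr_ge0//; last by lra.
by rewrite ler_norml; apply/andP; split; lra.
Qed.

Lemma completion_dot_addl l' : zmod_morphism (completion_dot^~ l').
Proof.
by move=> a b; rewrite addrC -scaleN1r completion_dot_linearl mulN1r addrC.
Qed.

Lemma completion_dot_scalel l' : scalable_for *%R (completion_dot^~ l').
Proof.
move=> a l; have := completion_dot_linearl a l 0 l'; rewrite addr0 => ->.
by rewrite -[0]/(0 : completion) -(subrr l) completion_dot_addl subrr addr0.
Qed.

Lemma completion_dot_addr l : zmod_morphism (completion_dot l).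
Proof. by move=> a b; rewrite !(completion_dotC _ l) -rmorphB/= -completion_dot_addl. Qed.

Lemma completion_dot_scaler l : scalable_for (@Num.conj R[i] \; *%R) (completion_dot l).
Proof.
by move=> a l'; rewrite completion_dotC completion_dot_scalel rmorphM/= -completion_dotC.
Qed.

HB.instance Definition _ := isBilinear.Build R[i] completion completion R[i]
  *%R (@Num.conj R[i] \; *%R) completion_dot
  completion_dot_addl completion_dot_addr completion_dot_scalel completion_dot_scaler.

Lemma completion_dot_herm l l' :
  completion_dot l l' = (-1) ^+ false * Num.conj (completion_dot l' l).
Proof. by rewrite expr0 mul1r -completion_dotC. Qed.

HB.instance Definition _ := isHermitianSesquilinear.Build R[i] completion
  false (@Num.conj R[i]) completion_dot completion_dot_herm.

Lemma completion_dot_gt0 l : l != 0 -> 0 < completion_dot l l.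
Proof. by move=> l0; rewrite completion_dot_norm exprn_gt0// normr_gt0. Qed.

HB.instance Definition _ := isDotProduct.Build R[i] completion completion_dot
  completion_dot_gt0.

HB.instance Definition _ := isHilbert.Build R completion completion_dot_norm.

Lemma completion_hdot_embed f g : hdot (embed f) (embed g) = s f g.
Proof. exact: completion_dot_embed. Qed.

(** A bijection of [X] that preserves the form acts on functionals by
  precomposition with its inverse. *)
Definition form_unitary (A B : X -> X) : Prop :=
  [/\ forall f g, s (A f) g = s f (B g), cancel A B & cancel B A].

Section unitary_action.
Context (A B : X -> X) (AB : form_unitary A B).

Let sB f g : s (A f) g = s f (B g). Proof. by have [] := AB. Qed.
Let BA : cancel A B. Proof. by have [] := AB. Qed.
Let nB g : nrm (B g) = nrm g.
Proof. by rewrite /seminorm -sB; have [_ _ ->] := AB. Qed.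

Lemma precomp_subproof l : (l \o B : X -> R[i]^o) \in completion_pred.
Proof.
rewrite inE => d d0; have [f lf] := completion_approx l d0.
by exists (A f) => g; rewrite sB -(nB g); exact: lf.
Qed.

Definition precomp_fun l : completion := Completion (precomp_subproof l).

Lemma precomp_linear : linear precomp_fun.
Proof. by move=> a l l'; exact: completion_ext. Qed.

Lemma precomp_le l : `|precomp_fun l| <= `|l|.
Proof.
rewrite -!rnormE lecR !dual_normE; apply: dual_norm_le => [|g]; first exact: dual_norm_ge0.
by rewrite -(nB g); exact: (dual_norm_bound l (B g)).
Qed.

Definition precomp : bop completion := Bop (bounded_bop precomp_linear precomp_le).

Lemma precomp_embed f : precomp (embed f) = embed (A f).
Proof. by apply: completion_ext => g; rewrite [RHS]sB. Qed.

End unitary_action.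

Lemma form_unitaryC A B : form_unitary A B -> form_unitary B A.
Proof.
move=> [sB AK BK]; split=> // f g.
by rewrite (semi_innerC hs g) -sB -(semi_innerC hs).
Qed.

Lemma precomp_unitary A B (AB : form_unitary A B) : unitary (precomp AB).
Proof.
have [sB AK BK] := AB.
exists (precomp (form_unitaryC AB)); split; last 2 first.
- by apply: bop_ext => l; apply: completion_ext => g /=; rewrite AK.
- by apply: bop_ext => l; apply: completion_ext => g /=; rewrite BK.
move=> l l'; set U := precomp AB; set V := precomp _.
have n0 := rnorm_ge0 l; have n1 := rnorm_ge0 (V l').
apply: (@completion_dot_unique _ _ _ (rnorm l + rnorm (V l') + 2)) => [|d d0 d1]; first by lra.
have [f lf] := embed_dense l d0; have [f' lf'] := embed_dense l' d0.
have Uf : rnorm (U l - embed (A f)) <= d.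
  rewrite -(precomp_embed AB) -linearB; apply: le_trans lf.
  by rewrite -lecR !rnormE; exact: precomp_le.
have Vf' : rnorm (V l' - embed (B f')) <= d.
  rewrite -(precomp_embed (form_unitaryC AB)) -linearB; apply: le_trans lf'.
  by rewrite -lecR !rnormE; exact: precomp_le.
have dC : d <= d * (rnorm l + rnorm (V l') + 2).
  by rewrite ler_peMr ?(ltW d0)//; lra.
exists (A f), f'; split; [exact: le_trans dC|exact: le_trans dC|].
rewrite sB; apply: le_trans (completion_dotP (ltW d0) lf Vf') _.
by rewrite ler_wpM2l ?(ltW d0)//; lra.
Qed.

End completion_def.

(** * Orthogonal projections onto isometric images *)

Section projection.
Context (R : realType) (H K : hilbertType R) (J : {linear H -> K}).
Context (J_isom : forall x y : H, hdot (J x) (J y) = hdot x y).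

Let hK := hdot_semi_inner K.

Lemma isometry_rnorm x : rnorm (J x) = rnorm x.
Proof. by rewrite -!hdot_seminorm /seminorm J_isom. Qed.

Lemma parallelogram (a b : K) : rnorm (a + b) ^+ 2 + rnorm (a - b) ^+ 2 =
  2 * (rnorm a ^+ 2 + rnorm b ^+ 2).
Proof.
have := seminorm_sqrD hK a b; have := seminorm_sqrB hK a b.
by rewrite !hdot_seminorm => -> ->; ring.
Qed.

(** A minimizing sequence [J (y n)] is Cauchy by the parallelogram law; as [J] is
  isometric, the sequence [y n] is Cauchy too, and it converges in [H]. *)
Lemma nearest_point (v : K) : exists y : H, forall x, rnorm (v - J y) <= rnorm (v - J x).
Proof.
pose D := [set rnorm (v - J y) ^+ 2 | y in [set: H]].
have Dinf : has_inf D.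
  by split; [exists (rnorm (v - J 0) ^+ 2), 0|exists 0 => _ [y _ <-]; exact: sqr_ge0].
pose q := inf D.
have qle x : q <= rnorm (v - J x) ^+ 2 by apply: ge_inf; [have [] := Dinf|exists x].
have /choice[y yq] : forall n, exists y,
    rnorm (v - J y) ^+ 2 < q + (rate R n / 2) ^+ 2.
  move=> n; have e0 : 0 < (rate R n / 2) ^+ 2 by rewrite exprn_gt0// divr_gt0 ?rate_gt0.
  by have [_ [y _ <-] h] := inf_adherent e0 Dinf; exists y.
have yc n m : rnorm (y n - y m) <= (rate R n + rate R m) * 1.
  rewrite mulr1 -(@ler_pXn2r _ 2)// ?nnegrE ?addr_ge0 ?rnorm_ge0 ?rate_ge0//.
  have := parallelogram (v - J (y n)) (v - J (y m)).
  have -> : v - J (y n) - (v - J (y m)) = J (y m - y n).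
    by rewrite [RHS]linearB opprB addrC addrA subrK.
  have -> : v - J (y n) + (v - J (y m)) = 2 *: (v - J (2^-1 *: (y n + y m))).
    rewrite linearZ linearD scalerBr scalerA divff ?pnatr_eq0// scale1r.
    by rewrite opprD addrACA scaler_nat mulr2n.
  rewrite isometry_rnorm rnormZ (rnormB_sym (y n)).
  rewrite (_ : rnorm (2 : R[i]) = 2); last first.
    by rewrite -[2](rmorph_nat (real_complex R)) rnorm_real ger0_norm.
  have := qle (2^-1 *: (y n + y m)); have := yq n; have := yq m.
  have := rate_ge0 R n; have := rate_ge0 R m.
  move: (rate R n) (rate R m) => r r' r0 r'0.
  have rr : 0 <= r * r' by rewrite mulr_ge0.
  rewrite !expr2 => h1 h2 h3 h4; nra.
have [z zP] := cauchy_rate (@cauchy_cvg H) ler01 yc.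
exists z => x; apply: (@le_rate _ _ _ 2) => n.
apply: le_trans (rnorm_triangle _ (J (y n)) _) _.
have h1 : rnorm (J (y n) - J z) <= rate R n by rewrite -linearB isometry_rnorm -[leRHS]mulr1.
suff h2 : rnorm (v - J (y n)) <= rnorm (v - J x) + rate R n by lra.
have r0 := rate_ge0 R n.
rewrite -(@ler_pXn2r _ 2)// ?nnegrE ?addr_ge0 ?rnorm_ge0//.
apply: le_trans (ltW (yq n)) _.
have := qle x; have := rnorm_ge0 (v - J x); move: (rnorm _) (rate _ _) r0 => a r r0 a0 ha.
have ar : 0 <= a * r by rewrite mulr_ge0.
by rewrite !expr2 in ha *; nra.
Qed.

Lemma nearest_orthogonal (v : K) y :
  (forall x, rnorm (v - J y) <= rnorm (v - J x)) -> forall x, hdot (v - J y) (J x) = 0.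
Proof.
move=> ymin x; set r := v - J y; set c := hdot r (J x).
have [x0|x0] := eqVneq (rnorm x) 0.
  by rewrite /c (rnorm_eq0 x0) linear0 (form0r hK).
have x1 : 0 < rnorm x ^+ 2 by rewrite exprn_gt0// lt_def x0 rnorm_ge0.
(* moving along [x] by the optimal amount would bring [J y] closer to [v] *)
pose t : R := (rnorm x ^+ 2)^-1.
have := ymin (y + (t%:C * c) *: x).
have -> : v - J (y + (t%:C * c) *: x) = r - (t%:C * c) *: J x.
  by rewrite linearD linearZ opprD addrA.
move=> /(lerXn2r 2); rewrite !nnegrE !rnorm_ge0 => /(_ isT isT).
have := seminorm_sqrB hK r ((t%:C * c) *: J x); rewrite !hdot_seminorm => ->.
rewrite rnormZ rnormM rnorm_real isometry_rnorm (formZr hK) -/c rmorphM/= conjC_rmul.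
rewrite -[_ * _ * c]mulrA [_ * c]mulrC mul_conj -rmorphM/= !exprMn real_normK ?num_real//.
rewrite [X in _ <= X -> _](_ : _ = rnorm r ^+ 2 - t * rnorm c ^+ 2); last first.
  by rewrite /t; field.
rewrite lerBrDr gerDl pmulr_rle0 ?invr_gt0// => c0.
apply/(@rnorm_eq0 R R[i]^o)/eqP; rewrite -sqrf_eq0 eq_le c0 sqr_ge0//.
Qed.

Lemma orthogonal_projection_exists : exists P : bop K,
  orthogonal_projection (range J) P.
Proof.
have /choice[a aP] : forall v, exists y, forall x, hdot (v - J y) (J x) = 0.
  by move=> v; have [y /nearest_orthogonal] := nearest_point v; exists y.
have aU v y : (forall x, hdot (v - J y) (J x) = 0) -> J (a v) = J y.
  move=> yP; apply/subr0_eq/rnorm_eq0/eqP.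
  rewrite -sqrf_eq0; apply/eqP/complexI; rewrite -hdot_rnorm -linearB.
  rewrite {1}(_ : J (a v - y) = (v - J y) - (v - J (a v))); last first.
    by rewrite linearB opprB [RHS]addrC addrA subrK.
  by rewrite (formDl hK) (formNl hK) yP aP subrr.
have Plin : linear (fun v => J (a v)).
  move=> b v w; rewrite -linearP; apply: aU => x.
  rewrite linearP opprD addrACA -scalerBr (formDl hK) (formZl hK) !aP mulr0 addr0//.
have Ple v : `|J (a v)| <= `|v|.
  rewrite -!rnormE lecR -(@ler_pXn2r _ 2)// ?nnegrE ?rnorm_ge0//.
  have := seminorm_sqrD hK (v - J (a v)) (J (a v)).
  by rewrite subrK !hdot_seminorm aP mulr0 addr0 => ->; rewrite lerDr sqr_ge0.
exists (Bop (bounded_bop Plin Ple)) => v; split; first by exists (a v).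
by move=> _ [x _ <-]; exact: aP.
Qed.

End projection.

(** * From contractivity to positivity *)

Section contractive_positive.
Context (R : realType) (H : hilbertType R) (k : nat) (T : 'I_k -> bop H).

Definition von_neumann : Prop := forall n (p : 'M[mpoly k R[i]]_n) (C : R),
  0 <= C -> torus_bound p C -> forall x : 'I_n -> H,
  vnorm (fun i => \sum_j poly_eval T (p i j) (x j)) <= C * vnorm x.

Context (T_vN : von_neumann).

Lemma rnorm_sqrB (a b : R[i]) : rnorm (a - b) ^+ 2 =
  rnorm a ^+ 2 + rnorm b ^+ 2 - 2 * complex.Re (b * Num.conj a).
Proof.
rewrite !rnormC ReM Re_conj Im_conj; case: a b => [a1 a2] [b1 b2] /=; ring.
Qed.

Lemma meval_bounded n (p : 'M[mpoly k R[i]]_n) : exists2 B, 0 <= B & torus_bound p B.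
Proof.
pose b i j : R := \sum_(m <- msupp (p i j)) rnorm (mcoeff m (p i j)).
pose B : R := \sum_i \sum_j b i j.
have b0 i j : 0 <= b i j by apply: sumr_ge0 => m _; exact: rnorm_ge0.
have B0 : 0 <= B by apply: sumr_ge0 => i _; apply: sumr_ge0 => j _; exact: b0.
have bB i j : b i j <= B.
  rewrite /B (bigD1 i)//= (bigD1 j)//= -addrA lerDl addr_ge0 ?sumr_ge0// => i' _.
  by apply: sumr_ge0.
exists (B * (n%:R * n%:R)) => [|z c z1]; first by rewrite !mulr_ge0.
rewrite -!mulrA; apply: (@vnorm_entries R R[i]^o R[i]^o) => // i j.
rewrite rnormM ler_wpM2r ?rnorm_ge0//; apply: le_trans (bB i j).
rewrite mevalE; apply: le_trans (@rnorm_sum _ R[i]^o _ _ _) _.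
apply: ler_sum => m _; rewrite rnormM ler_piMr ?rnorm_ge0//.
by rewrite [rnorm _](_ : _ = 1)//; exact: monom_unit.
Qed.

(** A unital contractive map is positive: where [p] has positive real part on the
  torus, the norm of [1 - d p] is at most [1 + O(d ^ 2)], hence so is the norm of
  its image, which bounds the real part of the image from below by [- O(d)]. *)
Lemma contractive_positive n (p : 'M[mpoly k R[i]]_n) (x : 'I_n -> H) :
  (forall (z : 'I_k -> R[i]) (c : 'I_n -> R[i]), (forall i, rnorm (z i) = 1) ->
    0 <= complex.Re (\sum_i (\sum_j meval z (p i j) * c j) * Num.conj (c i))) ->
  0 <= complex.Re (\sum_i hdot (\sum_j poly_eval T (p i j) (x j)) (x i)).
Proof.
move=> ppos; have [B B0 pB] := meval_bounded p.
pose y i := \sum_j poly_eval T (p i j) (x j).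
set t := complex.Re _.
apply: (@le_eps1 _ _ _ (B ^+ 2 * vnorm x ^+ 2)) => d d0 d1.
pose q : 'M[mpoly k R[i]]_n := \matrix_(i, j) ((if i == j then 1 else 0) - d%:C *: p i j).
have C0 : 0 <= 1 + d ^+ 2 * B ^+ 2 by rewrite -exprMn addr_ge0 ?ler01 ?sqr_ge0.
have pick (W : normedModType R[i]) (v : 'I_n -> W) i :
    \sum_j (if i == j then v j else 0) = v i.
  by rewrite -big_mkcond/= (eq_bigl (pred1 i)) ?big_pred1_eq// => j; rewrite eq_sym.
have qC : torus_bound q (Num.sqrt (1 + d ^+ 2 * B ^+ 2)).
  move=> z c z1; rewrite -(@ler_pXn2r _ 2)// ?nnegrE ?mulr_ge0 ?sqrtr_ge0 ?vnorm_ge0//.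
  rewrite exprMn (sqr_sqrtr C0); pose w i : R[i]^o := \sum_j meval z (p i j) * c j.
  rewrite (@vnorm_ext _ _ _ _ (fun i => c i - d%:C * w i : R[i]^o)); last first.
    move=> i; rewrite /w mulr_sumr -[in RHS](pick _ c i) -sumrB.
    apply: eq_bigr => j _; rewrite mxE mevalB mevalZ mulrBl mulrA.
    by case: eqP => _; rewrite ?meval1 ?meval0 ?mul1r ?mul0r.
  have := pB z c z1; move/(lerXn2r 2); rewrite !nnegrE ?mulr_ge0 ?vnorm_ge0//.
  move=> /(_ isT isT); rewrite exprMn !vnorm_sqr => hw.
  have := ppos z c z1; rewrite Re_sum => hp.
  under eq_bigr => i _ do rewrite rnorm_sqrB rnormM rnorm_real exprMn
    real_normK ?num_real// -mulrA ReM/= mul0r subr0.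
  rewrite !sumrB big_split/= -!mulr_sumr.
  have : 0 <= d * \sum_i complex.Re (w i * Num.conj (c i)) by rewrite mulr_ge0// ltW.
  have := ler_wpM2l (sqr_ge0 d) hw; rewrite -/(w _).
  move: (\sum_i complex.Re _) (\sum_i rnorm (w i) ^+ 2) (\sum_i rnorm (c i) ^+ 2).
  by move=> a b e h1 h2; rewrite mulrDl mul1r -mulrA; lra.
have := T_vN (sqrtr_ge0 _) qC x.
rewrite (@vnorm_ext _ _ _ _ (fun i => x i - d%:C *: y i)); last first.
  move=> i; rewrite /y scaler_sumr -[in RHS](pick _ x i) -sumrB.
  apply: eq_bigr => j _; rewrite mxE poly_evalB poly_evalZ.
  by case: eqP => _; rewrite ?poly_eval1 ?poly_eval0.
move/(lerXn2r 2); rewrite !nnegrE ?mulr_ge0 ?sqrtr_ge0 ?vnorm_ge0// => /(_ isT isT).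
rewrite exprMn (sqr_sqrtr C0) !vnorm_sqr.
have hs := hdot_semi_inner H.
under eq_bigr => i _.
  have := seminorm_sqrB hs (x i) (d%:C *: y i); rewrite !hdot_seminorm => ->.
  rewrite rnormZ rnorm_real exprMn real_normK ?num_real// (formZr hs) conjC_rmul.
  rewrite ReM/= mul0r subr0 (Re_formC hs (y i) (x i)).
  over.
rewrite !sumrB big_split/= -!mulr_sumr -Re_sum -/t.
have b0 : 0 <= d ^+ 2 * \sum_i rnorm (y i) ^+ 2.
  by rewrite mulr_ge0 ?sqr_ge0// sumr_ge0// => i _; exact: sqr_ge0.
have e0 : 0 <= \sum_i rnorm (x i) ^+ 2 by apply: sumr_ge0 => i _; exact: sqr_ge0.
move: (\sum_i rnorm (y i) ^+ 2) (\sum_i rnorm (x i) ^+ 2) b0 e0 => b e b0 e0 h.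
rewrite -(@pmulr_rge0 _ (2 * d)) ?mulr_gt0//.
have Be : 0 <= d ^+ 2 * B ^+ 2 * e by rewrite -exprMn mulr_ge0 ?sqr_ge0.
have -> : 2 * d * (t + d * (B ^+ 2 * e)) = 2 * (d * t) + 2 * (d ^+ 2 * B ^+ 2 * e) by ring.
by move: h; rewrite mulrDl mul1r; lra.
Qed.

(** A polynomial [f] whose coefficients are operators of finite rank is encoded by the
  scalar function [(z, h) |-> <f(z) h, h>], which determines it; positivity of [f] on
  the torus becomes pointwise nonnegativity. *)
Definition vpoint : Type := (torus R k * H)%type.

Definition tor (w : vpoint) : 'I_k -> R[i] := \val w.1 0.

(** The encoding of [p] times the operator [h |-> <h, y> x]. *)
Definition tensor (p : mpoly k R[i]) (x y : H) (w : vpoint) : R[i] :=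
  meval (tor w) p * hdot x w.2 * Num.conj (hdot y w.2).

Lemma tor_unit w i : rnorm (tor w i) = 1. Proof. exact: torus_rnorm. Qed.

Lemma torE (z : 'I_k -> R[i]) (h : H) : (forall i, rnorm (z i) = 1) ->
  exists w : vpoint, w.2 = h /\ tor w =1 z.
Proof.
move=> z1; have zt : torus R k (\row_i z i : 'rV[R[i]^o]_k).
  by move=> i; rewrite mxE -rnormE z1.
by exists (SigSub (mem_set zt), h); split=> // i; rewrite /tor/= mxE.
Qed.

Definition term : Type := (mpoly k R[i] * H * H)%type.

Definition tensor_graph : set ((vpoint -> R^o) * R) :=
  [set r | exists s : seq term,
    r = ((fun w => complex.Re (\sum_(a <- s) tensor a.1.1 a.1.2 a.2 w)),
         complex.Re (\sum_(a <- s) hdot (poly_eval T a.1.1 a.1.2) a.2))].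

Definition nonneg_fun : set (vpoint -> R^o) := [set f | forall w, 0 <= f w].

(** In an orthonormal family that spans all the vectors involved, a combination of
  tensors becomes a matrix polynomial; evaluating it at suitable vectors [h] shows that
  nonnegativity of the combination is positivity of the real part of that matrix. *)
Lemma tensor_graph_positive : positive_graph nonneg_fun tensor_graph.
Proof.
have hs := hdot_semi_inner H.
split.
- exists [::]; rewrite big_nil; congr (_, _); apply/funext => w.
  by rewrite big_nil.
- move=> b _ _ [s ->] [s' ->] /=.
  exists ([seq (b%:C *: a.1.1, a.1.2, a.2) | a : term <- s] ++ s').
  rewrite big_cat big_map/= ReD; congr (_, _).
    apply/funext => w; rewrite big_cat big_map/= ReD.
    rewrite -[LHS]/(b * complex.Re (\sum_(a <- s) tensor a.1.1 a.1.2 a.2 w) +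
      complex.Re (\sum_(a <- s') tensor a.1.1 a.1.2 a.2 w)).
    congr (_ + _); rewrite !Re_sum mulr_sumr; apply: eq_bigr => a _.
    by rewrite /tensor mevalZ -!mulrA [RHS]ReM/= mul0r subr0.
  congr (_ + _); rewrite !Re_sum mulr_sumr; apply: eq_bigr => a _.
  by rewrite poly_evalZ bopZE (formZl hs) [RHS]ReM/= mul0r subr0.
- move=> _ [s ->] /= pos.
  have [n [e [eo es]]] :=
    gram_schmidt ([seq a.1.2 | a : term <- s] ++ [seq a.2 | a : term <- s]).
  have e1 (a : term) : a \in s -> a.1.2 = \sum_j hdot a.1.2 (e j) *: e j.
    by move=> sa; apply: es; rewrite mem_cat (map_f (fun a : term => a.1.2)).
  have e2 (a : term) : a \in s -> a.2 = \sum_j hdot a.2 (e j) *: e j.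
    by move=> sa; apply: es; rewrite mem_cat (map_f (fun a : term => a.2)) ?orbT.
  pose P : 'M[mpoly k R[i]]_n := \matrix_(i, j) \sum_(a <- s)
    (hdot a.1.2 (e j) * Num.conj (hdot a.2 (e i))) *: a.1.1.
  have -> : \sum_(a <- s) hdot (poly_eval T a.1.1 a.1.2) a.2 =
      \sum_i hdot (\sum_j poly_eval T (P i j) (e j)) (e i).
    transitivity (\sum_i \sum_j \sum_(a <- s) hdot a.1.2 (e j) *
        Num.conj (hdot a.2 (e i)) * hdot (poly_eval T a.1.1 (e j)) (e i)).
      rewrite big_seq; under [RHS]eq_bigr do rewrite exchange_big/=.
      rewrite exchange_big/= [RHS]big_seq; apply: eq_bigr => a sa.
      rewrite {1}(e1 a sa) {1}(e2 a sa) (form_sumr hs); apply: eq_bigr => i _.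
      rewrite (formZr hs) linear_sum (form_suml hs) mulr_sumr; apply: eq_bigr => j _.
      by rewrite linearZ (formZl hs) mulrCA mulrA.
    apply: eq_bigr => i _; rewrite (form_suml hs); apply: eq_bigr => j _.
    rewrite mxE poly_eval_sum sum_bopE (form_suml hs); apply: eq_bigr => a _.
    by rewrite poly_evalZ bopZE (formZl hs).
  apply: contractive_positive => z c z1.
  (* this vector has the coordinates <e j, h> = c j *)
  have [w [wh wz]] := torE (\sum_j Num.conj (c j) *: e j) z1.
  have := pos w; congr (0 <= complex.Re _).
  have hE x : hdot x w.2 = \sum_j hdot x (e j) * c j.
    rewrite wh (form_sumr hs); apply: eq_bigr => j _.
    by rewrite (formZr hs) conjCK mulrC.
  transitivity (\sum_i \sum_j \sum_(a <- s) (hdot a.1.2 (e j) *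
      Num.conj (hdot a.2 (e i))) * meval z a.1.1 * c j * Num.conj (c i)).
    under [RHS]eq_bigr do rewrite exchange_big/=.
    rewrite exchange_big/=; apply: eq_bigr => a _.
    rewrite /tensor !hE (meval_eq _ wz) rmorph_sum mulr_sumr; apply: eq_bigr => i _.
    rewrite rmorphM mulr_sumr mulr_suml; apply: eq_bigr => j _ /=.
    by move: (Num.conj (c i)) (Num.conj (hdot a.2 (e i))) => u v; ring.
  apply: eq_bigr => i _; rewrite mulr_suml; apply: eq_bigr => j _.
  rewrite mxE raddf_sum !mulr_suml; apply: eq_bigr => a _.
  by rewrite /= mevalZ.
Qed.

End contractive_positive.

(** * Construction of the unitary dilation *)

Section dominated_functions.
Context (R : realType) (H : hilbertType R) (k : nat).
Local Notation Omega := (vpoint H k).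

Definition dominator (s : seq H) (w : Omega) : R := \sum_(x <- s) rnorm (hdot x w.2) ^+ 2.

Lemma dominator_ge0 s w : 0 <= dominator s w.
Proof. by apply: sumr_ge0 => x _; exact: sqr_ge0. Qed.

Lemma dominator_cat s s' w : dominator (s ++ s') w = dominator s w + dominator s' w.
Proof. by rewrite /dominator big_cat. Qed.

Lemma dominatorZ (a : R) s w :
  dominator [seq a%:C *: x | x <- s] w = a ^+ 2 * dominator s w.
Proof.
rewrite /dominator big_map mulr_sumr; apply: eq_bigr => x _.
by rewrite (formZl (hdot_semi_inner H)) rnormM rnorm_real exprMn real_normK ?num_real.
Qed.

Definition dominated (f : Omega -> R^o) : Prop :=
  exists s, forall w, `|f w| <= dominator s w.

Lemma dominated_le (f : Omega -> R^o) (C : R) s :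
  (forall w, `|f w| <= C * dominator s w) -> dominated f.
Proof.
move=> fC; exists [seq (Num.sqrt `|C|)%:C *: x | x <- s] => w.
rewrite dominatorZ sqr_sqrtr//; apply: le_trans (fC w) _.
by rewrite ler_wpM2r ?dominator_ge0// ler_norm.
Qed.

Lemma dominatedP (a : R) (f g : Omega -> R^o) : dominated f -> dominated g ->
  dominated (a *: f + g).
Proof.
move=> [s fs] [s' gs]; apply: (@dominated_le _ (`|a| + 1) (s ++ s')) => w.
rewrite -[X in `|X|]/(a * f w + g w) dominator_cat.
apply: le_trans (ler_normD _ _) _; rewrite normrM.
have h1 := fs w; have h2 := gs w.
apply: (@le_trans _ _ (`|a| * dominator s w + dominator s' w)).
  by rewrite lerD// ler_wpM2l.
have := dominator_ge0 s w; have := dominator_ge0 s' w.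
move: (dominator s w) (dominator s' w) => x y y0 x0.
have : 0 <= `|a| * y by rewrite mulr_ge0.
by rewrite mulrDl mul1r mulrDr; lra.
Qed.

(** The space on which the dilation lives before completion: it contains the functions
  [(z, h) |-> <x, h>], it is stable under multiplication by the coordinates [z i] and
  their conjugates, and the products of its elements are in the domain of the state. *)
Definition sqdom_pred : {pred (Omega -> R[i]^o)} :=
  mem [set f : Omega -> R[i]^o | exists s, forall w, rnorm (f w) ^+ 2 <= dominator s w].

Record sqdom := SqDom { sqdom_fun :> Omega -> R[i]^o; sqdomP : sqdom_fun \in sqdom_pred }.

HB.instance Definition _ := [isSub for sqdom_fun].
HB.instance Definition _ := [Choice of sqdom by <:].

Lemma sqdom_submod_closed : submod_closed sqdom_pred.
Proof.
split.
  rewrite inE; exists [::] => w.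
  by rewrite -[X in rnorm X]/(0 : R[i]^o) rnorm0 expr0n dominator_ge0.
move=> a f g; rewrite !inE => -[s fs] [s' gs].
exists ([seq (Num.sqrt 2 * rnorm a)%:C *: x | x <- s] ++
        [seq (Num.sqrt 2)%:C *: x | x <- s']) => w.
rewrite dominator_cat !dominatorZ exprMn sqr_sqrtr//.
rewrite -[X in rnorm X]/(a * f w + g w).
apply: (@le_trans _ _ ((rnorm a * rnorm (f w) + rnorm (g w)) ^+ 2)).
  rewrite lerXn2r ?nnegrE ?addr_ge0 ?mulr_ge0 ?rnorm_ge0//.
  by rewrite -rnormM; exact: rnormD.
apply: (@le_trans _ _ (2 * (rnorm a * rnorm (f w)) ^+ 2 + 2 * rnorm (g w) ^+ 2)).
  rewrite -subr_ge0 [leRHS](_ : _ = (rnorm a * rnorm (f w) - rnorm (g w)) ^+ 2).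
    exact: sqr_ge0.
  by ring.
rewrite exprMn mulrA; apply: lerD.
  by apply: ler_wpM2l (fs w); rewrite mulr_ge0 ?sqr_ge0.
by apply: ler_wpM2l (gs w).
Qed.

HB.instance Definition _ := GRing.isSubmodClosed.Build _ _ sqdom_pred sqdom_submod_closed.
HB.instance Definition _ := [SubChoice_isSubLmodule of sqdom by <:].

Lemma sqdom_ext (f g : sqdom) : f =1 g -> f = g.
Proof. by move=> fg; apply/val_inj/funext. Qed.

Lemma sqdom_mul (f g : sqdom) :
  dominated (fun w => complex.Re (f w * Num.conj (g w))) /\
  dominated (fun w => complex.Im (f w * Num.conj (g w))).
Proof.
have [s fs] : exists s, forall w, rnorm (f w) ^+ 2 <= dominator s w.
  by have := sqdomP f; rewrite inE.
have [s' gs] : exists s, forall w, rnorm (g w) ^+ 2 <= dominator s w.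
  by have := sqdomP g; rewrite inE.
have fg w : rnorm (f w * Num.conj (g w)) <= dominator (s ++ s') w.
  rewrite dominator_cat rnormM rnorm_conj.
  apply: le_trans (lerD (fs w) (gs w)).
  have := sqr_ge0 (rnorm (f w) - rnorm (g w)).
  have := mulr_ge0 (rnorm_ge0 (f w)) (rnorm_ge0 (g w)).
  move: (rnorm (f w)) (rnorm (g w)) => x y xy h.
  have : (x - y) ^+ 2 = x ^+ 2 + y ^+ 2 - 2 * (x * y) by ring.
  by lra.
split; exists (s ++ s') => w; apply: le_trans (fg w);
  rewrite -(@ler_pXn2r _ 2)// ?nnegrE ?rnorm_ge0// rnormC real_normK ?num_real//;
  by rewrite ?lerDl ?lerDr sqr_ge0.
Qed.

Lemma vec_subproof (x : H) : (fun w : Omega => hdot x w.2 : R[i]^o) \in sqdom_pred.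
Proof. by rewrite inE; exists [:: x] => w; rewrite /dominator big_seq1. Qed.

Definition vec (x : H) : sqdom := SqDom (vec_subproof x).

Lemma vec_linear : linear vec.
Proof.
by move=> a x y; apply: sqdom_ext => w; exact: (semi_innerPl (hdot_semi_inner H)).
Qed.

HB.instance Definition _ := GRing.isLinear.Build _ _ _ _ vec vec_linear.

Definition unimodular (c : Omega -> R[i]) : Prop := forall w, rnorm (c w) = 1.

Lemma sqdom_mul_subproof c (cu : unimodular c) (f : sqdom) :
  (fun w => c w * f w : R[i]^o) \in sqdom_pred.
Proof.
have := sqdomP f; rewrite !inE => -[s fs]; exists s => w.
by rewrite rnormM cu mul1r.
Qed.

Definition modulate c (cu : unimodular c) (f : sqdom) : sqdom :=
  SqDom (sqdom_mul_subproof cu f).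

Lemma unimodular_conj c : unimodular c -> unimodular (fun w => Num.conj (c w)).
Proof. by move=> cu w; rewrite rnorm_conj. Qed.

Lemma unimodular_tor i : unimodular (fun w => tor w i).
Proof. by move=> w; exact: tor_unit. Qed.

End dominated_functions.

Section state.
Context (R : realType) (H : hilbertType R) (k : nat) (T : 'I_k -> bop H).
Context (T_vN : von_neumann T).
Local Notation Omega := (vpoint H k).

(** The prescribed values on tensors are positive, and a dominated function lies between
  two combinations of the tensors [|<x, h>| ^ 2]: the extension theorem applies. It
  plays the part of the extension of completely positive maps. *)
Lemma state_exists : exists phi : (Omega -> R^o) -> R,
  [/\ forall a f g, dominated f -> dominated g -> phi (a *: f + g) = a * phi f + phi g,
      forall f, dominated f -> (forall w, 0 <= f w) -> 0 <= phi f &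
      forall p x y, dominated (fun w => complex.Re (tensor p x y w)) ->
        phi (fun w => complex.Re (tensor p x y w)) =
        complex.Re (hdot (poly_eval T p x) y)].
Proof.
have hs := hdot_semi_inner H.
have C0 : nonneg_fun (0 : Omega -> R^o) by move=> w; exact: lexx.
have CD (f g : Omega -> R^o) : nonneg_fun f -> nonneg_fun g -> nonneg_fun (f + g).
  by move=> f0 g0 w; exact: addr_ge0 (f0 w) (g0 w).
have CZ (t : R) (f : Omega -> R^o) : 0 < t -> nonneg_fun f -> nonneg_fun (t *: f).
  by move=> t0 f0 w; exact: mulr_ge0 (ltW t0) (f0 w).
have PT := tensor_graph_positive T_vN.
have [G [PG TG domG]] := riesz_extension CD CZ PT.
have gdom (b : R) s : exists t, tensor_graph T (b *: (@dominator R H k s : Omega -> R^o), t).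
  pose s' : seq (term H k) := [seq (b%:C *: 1, x, x) | x <- s].
  exists (complex.Re (\sum_(a <- s') hdot (poly_eval T a.1.1 a.1.2) a.2)).
  exists s'; congr (_, _); apply/funext => w.
  rewrite -[LHS]/(b * dominator s w) /s' big_map Re_sum /dominator mulr_sumr.
  apply: eq_bigr => x _; rewrite /tensor/= mevalZ meval1 mulr1 -mulrA mul_conj.
  by rewrite -rmorphM.
have Gdom f : dominated f -> exists t, G (f, t).
  move=> [s fs]; have [t1 h1] := gdom (-1) s; have [t2 h2] := gdom 1 s.
  apply: (domG _ _ _ h1 h2) => w.
    rewrite -[X in 0 <= X]/(f w - (-1) * dominator s w) mulN1r opprK addrC -lerBlDl sub0r.
    by have := fs w; rewrite ler_norml => /andP[].
  rewrite -[X in 0 <= X]/(1 * dominator s w - f w) mul1r subr_ge0.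
  by have := fs w; rewrite ler_norml => /andP[].
pose phi f : R := xget 0 [set t | G (f, t)].
have Gphi f : dominated f -> G (f, phi f).
  by move=> /Gdom[t ft]; apply: (@xgetPex _ 0 [set t | G (f, t)]); exists t.
have [_ GP Gpos] := PG.
exists phi; split.
- move=> a f g fd gd; apply: (positive_graph_fun C0 PG (Gphi _ (dominatedP a fd gd))).
  exact: (GP a _ _ (Gphi _ fd) (Gphi _ gd)).
- by move=> f fd f0; exact: (Gpos _ (Gphi _ fd)).
- move=> p x y pd; apply: (positive_graph_fun C0 PG (Gphi _ pd)).
  apply: TG; exists [:: (p, x, y)]; rewrite big_seq1/=; congr (_, _).
  by apply/funext => w; rewrite big_seq1.
Qed.

End state.

Section gns.
Context (R : realType) (H : hilbertType R) (k : nat) (T : 'I_k -> bop H).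
Local Notation Omega := (vpoint H k).
Local Notation X := (sqdom H k).
Context (phi : (Omega -> R^o) -> R).
Context (phiP : forall a f g, dominated f -> dominated g ->
  phi (a *: f + g) = a * phi f + phi g).
Context (phi_ge0 : forall f, dominated f -> (forall w, 0 <= f w) -> 0 <= phi f).
Context (phi_tensor : forall p x y,
  dominated (fun w => complex.Re (tensor p x y w)) ->
  phi (fun w => complex.Re (tensor p x y w)) = complex.Re (hdot (poly_eval T p x) y)).

(** The complex-linear extension of [phi]. *)
Definition cstate (F : Omega -> R[i]) : R[i] :=
  phi (fun w => complex.Re (F w)) +i* phi (fun w => complex.Im (F w)).

Definition cdominated (F : Omega -> R[i]) : Prop :=
  dominated (fun w => complex.Re (F w) : R^o) /\
  dominated (fun w => complex.Im (F w) : R^o).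

Lemma cstateP (a : R[i]) F G : cdominated F -> cdominated G ->
  cstate (fun w => a * F w + G w) = a * cstate F + cstate G.
Proof.
move=> [F1 F2] [G1 G2].
have E1 : (fun w => complex.Re (a * F w + G w) : R^o) =
    complex.Re a *: (fun w => complex.Re (F w) : R^o) +
    ((- complex.Im a) *: (fun w => complex.Im (F w) : R^o) +
     (fun w => complex.Re (G w) : R^o)).
  apply/funext => w; rewrite ReD ReM.
  rewrite -[RHS]/(complex.Re a * complex.Re (F w) +
    (- complex.Im a * complex.Im (F w) + complex.Re (G w))); ring.
have E2 : (fun w => complex.Im (a * F w + G w) : R^o) =
    complex.Re a *: (fun w => complex.Im (F w) : R^o) +
    (complex.Im a *: (fun w => complex.Re (F w) : R^o) +
     (fun w => complex.Im (G w) : R^o)).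
  apply/funext => w; rewrite ImD ImM.
  rewrite -[RHS]/(complex.Re a * complex.Im (F w) +
    (complex.Im a * complex.Re (F w) + complex.Im (G w))); ring.
apply: ReIm_eq; rewrite ?(ReD, ReM, ImD, ImM) [LHS]/= ?E1 ?E2.
  rewrite !phiP//=; last exact: dominatedP.
  by ring.
rewrite !phiP//=; last exact: dominatedP.
by ring.
Qed.

Definition state_form (f g : X) : R[i] := cstate (fun w => f w * Num.conj (g w)).

Lemma phi0 (f : Omega -> R^o) : f = 0 -> phi f = 0.
Proof.
move=> ->; have d0 : dominated (0 : Omega -> R^o).
  by exists [::] => w; rewrite normr0 dominator_ge0.
have := phiP 0 d0 d0; rewrite scaler0 addr0 mul0r add0r => h.
have := phiP 1 d0 d0; rewrite scale1r addr0 mul1r => h'.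
by move: h'; set t := phi _ => /eqP; rewrite -subr_eq0 opprD addrA subrr sub0r oppr_eq0 => /eqP.
Qed.

Lemma phiN f : dominated f -> phi (- f) = - phi f.
Proof.
move=> fd; have d0 : dominated (0 : Omega -> R^o).
  by exists [::] => w; rewrite normr0 dominator_ge0.
by have := phiP (-1) fd d0; rewrite addr0 scaleN1r (phi0 erefl) addr0 mulN1r.
Qed.

Lemma state_form_semi_inner : semi_inner state_form.
Proof.
split.
- move=> a f g h; rewrite /state_form -cstateP; [|exact: sqdom_mul|exact: sqdom_mul].
  congr cstate; apply/funext => w.
  by rewrite -[(a *: f + g) w]/(a * f w + g w) mulrDl mulrA.
- move=> f g; have [d1 d2] := sqdom_mul f g.
  apply: ReIm_eq; rewrite ?(Re_conj, Im_conj) /=.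
    by congr phi; apply/funext => w; rewrite -Re_conj rmorphM/= conjCK mulrC.
  rewrite -phiN//; congr phi; apply/funext => w.
  by rewrite -[RHS]/(- complex.Im (f w * Num.conj (g w))) -Im_conj rmorphM/= conjCK mulrC.
- move=> f; have [d1 d2] := sqdom_mul f f.
  have fE w : f w * Num.conj (f w) = (rnorm (f w) ^+ 2)%:C by exact: mul_conj.
  rewrite lecE /= phi0/=; last by apply/funext => w; rewrite fE.
  by rewrite eqxx/=; apply: phi_ge0 => // w; rewrite fE sqr_ge0.
Qed.

Definition gns_space : preHilbert R := PreHilbert state_form_semi_inner.

Lemma state_tensor (F : Omega -> R[i]) p x y : F =1 tensor p x y ->
  cdominated F -> cstate F = hdot (poly_eval T p x) y.
Proof.
move=> /funext -> [d1 d2]; apply: ReIm_eq => /=; first exact: phi_tensor.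
(* the imaginary part is the real part of the value at [-i p] *)
have E (c : R[i]) : complex.Im c = complex.Re (- 'i * c).
  by case: c => a b /=; rewrite /=; ring.
have {}E w : complex.Im (tensor p x y w) = complex.Re (tensor (- 'i *: p) x y w).
  by rewrite E /tensor mevalZ -!mulrA.
have Eh : complex.Im (hdot (poly_eval T p x) y) =
    complex.Re (hdot (poly_eval T (- 'i *: p) x) y).
  rewrite poly_evalZ bopZE (formZl (hdot_semi_inner H)).
  by case: (hdot _ _) => a b /=; ring.
rewrite (funext E) Eh; apply: phi_tensor.
by move: d2; rewrite (funext E).
Qed.

Let embedX (f : X) : completion gns_space := @embed R gns_space f.

Lemma modulate_unitary c (cu : unimodular c) :
  @form_unitary R gns_space (modulate cu) (modulate (unimodular_conj cu)).
Proof.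
split.
- move=> f g; congr cstate; apply/funext => w /=.
  by rewrite rmorphM/= conjCK; ring.
- move=> f; apply: sqdom_ext => w /=.
  by rewrite mulrA [_ * c w]mulrC mul_conj cu expr1n mul1r.
- move=> f; apply: sqdom_ext => w /=.
  by rewrite mulrA mul_conj cu expr1n mul1r.
Qed.

Definition gns_unitary (i : 'I_k) : bop (completion gns_space) :=
  precomp (modulate_unitary (unimodular_tor i)).

Lemma gns_comm i j : gns_unitary i * gns_unitary j = gns_unitary j * gns_unitary i.
Proof.
apply: bop_ext => l; apply: completion_ext => g /=; congr (completion_fun l _).
by apply: sqdom_ext => w /=; rewrite mulrCA.
Qed.

Lemma gns_monom (m : 'I_k -> nat) (f g : X) :
  (forall w, g w = monom (tor w) m * f w) ->
  monom gns_unitary m (embedX f) = embedX g.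
Proof.
pose acts (S : bop (completion gns_space)) (c : Omega -> R[i]) : Prop :=
  unimodular c /\ forall f g : X, (forall w, g w = c w * f w) -> S (embedX f) = embedX g.
have acts1 : acts 1 (fun=> 1).
  split=> [w|f' g' fg]; first exact: rnorm1.
  by congr embed; apply: sqdom_ext => w; rewrite fg mul1r.
have actsM S S' c c' : acts S c -> acts S' c' -> acts (S * S') (fun w => c w * c' w).
  move=> [cu Sc] [cu' Sc']; split=> [w|f' g' fg]; first by rewrite rnormM cu cu' mulr1.
  rewrite -[LHS]/(S (S' (embedX f'))) (Sc' _ (modulate cu' f'))//.
  by apply: Sc => w; rewrite fg mulrA.
have actsU i : acts (gns_unitary i) (fun w => tor w i).
  split=> [w|f' g' fg]; first exact: tor_unit.
  rewrite /gns_unitary precomp_embed; congr embed.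
  by apply: sqdom_ext => w; rewrite fg.
have actsX i e : acts (gns_unitary i ^+ e) (fun w => tor w i ^+ e).
  elim: e => [|e IH]; first exact: acts1.
  rewrite exprS; have := actsM _ _ _ _ (actsU i) IH.
  by congr acts; apply/funext => w; rewrite exprS.
suff [_] : acts (monom gns_unitary m) (fun w => monom (tor w) m) by apply.
rewrite /monom; elim: (index_enum _) => [|i r IH].
  rewrite big_nil; have := acts1; congr acts; apply/funext => w.
  by rewrite big_nil.
rewrite big_cons; have := actsM _ _ _ _ (actsX i (m i)) IH; congr acts.
by apply/funext => w; rewrite big_cons.
Qed.

Definition gns_embed (x : H) : completion gns_space := embedX (vec k x).

Lemma gns_embed_linear : linear gns_embed.
Proof.
move=> a x y; rewrite /gns_embed linearP /embedX.
exact: (@linearP _ _ _ _ (@embed R gns_space)).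
Qed.

HB.instance Definition _ := GRing.isLinear.Build _ _ _ _ gns_embed gns_embed_linear.

(** The prescribed values of the state are the matrix coefficients of [T]. *)
Lemma gns_hdot (m : 'I_k -> nat) x y :
  hdot (monom gns_unitary m (gns_embed x)) (gns_embed y) = hdot (monom T m x) y.
Proof.
have mu : unimodular (fun w : Omega => monom (tor w) m).
  by move=> w; apply: monom_unit => i; exact: tor_unit.
rewrite (gns_monom (g := modulate mu (vec k x)))//.
rewrite completion_hdot_embed.
pose m' : multinom k := Multinom [tuple m i | i < k].
have -> : monom T m = poly_eval T (mpolyX R[i] m').
  by rewrite poly_evalX; apply: monom_ext => i; rewrite mnmE.
apply: state_tensor; last exact: sqdom_mul.
move=> w /=; rewrite /tensor mevalX; congr (_ * _ * _).
by apply: monom_ext => i; rewrite mnmE.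
Qed.

End gns.

Section dilation.
Context (R : realType) (H : hilbertType R) (k : nat) (T : 'I_k -> bop H).

(** The Gelfand-Naimark-Segal construction for the state: multiplication by [z i] is
  unitary because [z i] is unimodular, and compression to the copy of [H] gives back
  the monomials of [T] by the choice of the state. *)
Lemma unitary_dilation : von_neumann T ->
  exists (K : hilbertType R) (J : {linear H -> K}) (P : bop K) (U : 'I_k -> bop K),
     [/\ forall x y : H, hdot (J x) (J y) = hdot x y,
         orthogonal_projection (range J) P,
         forall i, unitary (U i),
         forall i j, U i * U j = U j * U i
       & forall (m : 'I_k -> nat) (x : H),
           J (monom T m x) = P (monom U m (J x))].
Proof.
move=> /state_exists[phi [phiP phi_ge0 phi_tensor]].
pose K : hilbertType R := completion (gns_space phiP phi_ge0).
pose J : {linear H -> K} := @gns_embed R H k phi phiP phi_ge0.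
pose U : 'I_k -> bop K := @gns_unitary R H k phi phiP phi_ge0.
have JU m x y : hdot (monom U m (J x)) (J y) = hdot (monom T m x) y.
  exact: gns_hdot.
have Jisom x y : hdot (J x) (J y) = hdot x y.
  have := JU (fun=> 0%N) x y; rewrite /monom !big1// => i _; exact: expr0.
have [P PJ] := orthogonal_projection_exists Jisom.
exists K, J, P, U; split=> // [i|i j|m x].
- exact: precomp_unitary.
- exact: gns_comm.
set v := monom U m (J x); have [[a _ aP] Porth] := PJ v.
have hK := hdot_semi_inner K.
rewrite -aP; congr (J _).
apply/subr0_eq/rnorm_eq0/eqP; rewrite -sqrf_eq0; apply/eqP/complexI.
rewrite -hdot_rnorm -Jisom; set b := monom T m x - a.
have Jb : J b = J (monom T m x) - J a by rewrite linearB.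
rewrite {1}Jb (formDl hK) (formNl hK) Jisom -JU -/v aP -(formNl hK) -(formDl hK).
by rewrite Porth//; exists b.
Qed.

End dilation.

(** * The equivalences *)

Section von_neumann_isometries.
Context (R : realType) (k : nat).

Lemma meval_bounded1 (p : mpoly k R[i]) : exists2 B, 0 <= B &
  forall z, (forall i, rnorm (z i) = 1) -> rnorm (meval z p) <= B.
Proof.
have [B B0 pB] := meval_bounded (\matrix_(i < 1, j < 1) p).
exists B => // z z1; have := pB z (fun=> 1) z1; rewrite !vnorm1/= big_ord1 mxE.
by rewrite mulr1 (rnorm1 R) mulr1.
Qed.

Lemma isometry_bounded (K : hilbertType R) (V : 'I_k -> bop K) (p : mpoly k R[i]) :
  (forall i j, V i * V j = V j * V i) -> (forall i x, rnorm (V i x) = rnorm x) ->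
  exists2 B, 0 <= B & forall x, rnorm (poly_eval V p x) <= B * rnorm x.
Proof.
move=> VC VI; have [B B0 pB] := meval_bounded (\matrix_(i < 1, j < 1) p).
exists B => // x; have := isometry_von_neumann VC VI (fun=> x) B0 pB.
by rewrite !vnorm1/= big_ord1 mxE.
Qed.

Lemma unitary_isom (K : hilbertType R) (U : bop K) : unitary U ->
  forall x, rnorm (U x) = rnorm x.
Proof.
move=> [V [VU VU1 _]] x; rewrite -!hdot_seminorm /seminorm VU.
by rewrite -[V (U x)]/((V * U) x) VU1.
Qed.

(** Compression to the copy of [H] does not increase norms. *)
Lemma dilation_von_neumann (H K : hilbertType R) (T : 'I_k -> bop H)
    (J : {linear H -> K}) (P : bop K) (U : 'I_k -> bop K) :
  (forall x y : H, hdot (J x) (J y) = hdot x y) ->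
  orthogonal_projection (range J) P ->
  (forall i, unitary (U i)) -> (forall i j, U i * U j = U j * U i) ->
  (forall (m : 'I_k -> nat) (x : H), J (monom T m x) = P (monom U m (J x))) ->
  von_neumann T.
Proof.
move=> Jisom PJ Uu UC JT n p C C0 pC x.
have JE q y : J (poly_eval T q y) = P (poly_eval U q (J y)).
  rewrite !poly_evalEx !linear_sum; apply: eq_bigr => m _.
  by rewrite !linearZ; congr (_ *: _); exact: JT.
have Ple v : rnorm (P v) <= rnorm v.
  have [Pv Porth] := PJ v.
  rewrite -(@ler_pXn2r _ 2)// ?nnegrE ?rnorm_ge0//.
  have := seminorm_sqrD (hdot_semi_inner K) (v - P v) (P v).
  by rewrite subrK !hdot_seminorm Porth// mulr0 addr0 => ->; rewrite lerDr sqr_ge0.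
have -> : vnorm x = vnorm (fun j => J (x j)).
  by congr (Num.sqrt _); apply: eq_bigr => j _; rewrite (isometry_rnorm Jisom).
apply: le_trans (isometry_von_neumann UC (fun i => unitary_isom (Uu i)) _ C0 pC).
apply: vnorm_mono => i.
rewrite -(isometry_rnorm Jisom) linear_sum/=; under eq_bigr do rewrite JE.
by rewrite -linear_sum; exact: Ple.
Qed.

End von_neumann_isometries.

Section torus_norms.
Context (R : realType) (k : nat).
Local Notation E := (torus R k -> R[i]^o).

Lemma supnorm_le (f : E) c : (supnorm f <= c%:E)%E <-> forall z, rnorm (f z) <= c.
Proof.
split=> [fc z|fc].
  by rewrite -lee_fin; apply: le_trans fc; apply: ereal_sup_ubound; exists z.
by apply: ge_ereal_sup => _ [z _ <-]; rewrite lee_fin.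
Qed.

Lemma torus_mxnorm_le n (M : 'M[E]_n) c : (torus_mxnorm M <= c%:E)%E <->
  0 <= c /\ forall z (v : 'I_n -> R[i]^o),
    vnorm (fun i => \sum_j M i j z * v j : R[i]^o) <= c * vnorm v.
Proof.
have ME z (v : 'I_n -> R[i]^o) :
    (fun i => \sum_j map_mx (fun f : E => f z : R[i]) M i j * v j : R[i]^o) =
    (fun i => \sum_j M i j z * v j : R[i]^o).
  by apply/funext => i; apply: eq_bigr => j _; rewrite mxE.
split=> [Mc|[c0 Mc]].
  have Mz z : (cmxnorm (map_mx (fun f : E => f z : R[i]) M) <= c%:E)%E.
    by apply: le_trans Mc; apply: ereal_sup_ubound; exists z.
  split; first by have /cmxnorm_le[] := Mz (torus_one R k).
  by move=> z v; have /cmxnorm_le[_ /(_ v)] := Mz z; rewrite ME.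
apply: ge_ereal_sup => _ [z _ <-]; apply/cmxnorm_le; split=> // v.
by rewrite ME; exact: Mc.
Qed.

Lemma torus_mxnorm_ge0 n (M : 'M[E]_n) : (0 <= torus_mxnorm M)%E.
Proof.
apply: le_trans (cmxnorm_ge0 (map_mx (fun f : E => f (torus_one R k) : R[i]) M)) _.
by apply: ereal_sup_ubound; exists (torus_one R k).
Qed.

Lemma von_neumannP (H : hilbertType R) (T : 'I_k -> bop H) :
  von_neumann T <->
  forall (n : nat) (p : 'M[mpoly k R[i]]_n),
    (opmxnorm (map_mx (poly_eval T) p) <=
     ereal_sup [set cmxnorm (map_mx (meval (z 0%R)) p) | z in torus R k])%E.
Proof.
have pE n (p : 'M[mpoly k R[i]]_n) (z : 'rV[R[i]^o]_k) (v : 'I_n -> R[i]^o) :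
    (fun i => \sum_j map_mx (meval (z 0)) p i j * v j : R[i]^o) =
    (fun i => \sum_j meval (z 0) (p i j) * v j : R[i]^o).
  by apply/funext => i; apply: eq_bigr => j _; rewrite mxE.
have TE n (p : 'M[mpoly k R[i]]_n) (x : 'I_n -> H) :
    (fun i => \sum_j map_mx (poly_eval T) p i j (x j)) =
    (fun i => \sum_j poly_eval T (p i j) (x j)).
  by apply/funext => i; apply: eq_bigr => j _; rewrite mxE.
split=> [TvN n p|TvN n p C C0 pC x].
  apply: le_of_bounds => [|c pc].
    apply: le_trans (cmxnorm_ge0 (map_mx (meval ((\val (torus_one R k)) 0)) p)) _.
    by apply: ereal_sup_ubound; exists (\val (torus_one R k)) => //; exact: torus_one_subproof.
  have pz z : torus R k z -> (cmxnorm (map_mx (meval (z 0%R)) p) <= c%:E)%E.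
    by move=> tz; apply: le_trans pc; apply: ereal_sup_ubound; exists z.
  have c0 : 0 <= c by have /cmxnorm_le[] := pz _ (@torus_one_subproof R k).
  apply/opmxnorm_le; split=> // x; rewrite TE; apply: TvN => // z v z1.
  have tz : torus R k (\row_i z i) by move=> i; rewrite mxE -rnormE z1.
  have zE : (\row_i z i : 'rV[R[i]^o]_k) 0 =1 z by move=> l; rewrite mxE.
  have /cmxnorm_le[_ /(_ v)] := pz _ tz.
  rewrite pE (@vnorm_ext _ _ _ _ (fun i => \sum_j meval z (p i j) * v j : R[i]^o))//.
  by move=> i; apply: eq_bigr => j _; rewrite (meval_eq _ zE).
rewrite -TE.
have /opmxnorm_le[_] : (opmxnorm (map_mx (poly_eval T) p) <= C%:E)%E; last exact.
apply: le_trans (TvN n p) _; apply: ge_ereal_sup => _ [z tz <-].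
apply/cmxnorm_le; split=> // v; rewrite pE; apply: pC => i.
by apply: complexI; rewrite rnormE tz.
Qed.

Lemma meval_continuous (Y : topologicalType) (x : 'I_k -> Y -> R[i]^o)
    (p : mpoly k R[i]) : (forall i, continuous (x i)) ->
  continuous (fun y => meval (fun i => x i y) p : R[i]^o).
Proof.
move=> xc.
pose X i e (y : Y) : R[i]^o := x i y ^+ e.
pose M r (m : multinom k) (y : Y) : R[i]^o := \prod_(i <- r) X i (m i) y.
pose S s (y : Y) : R[i]^o :=
  \sum_(m <- s) mcoeff m p * M (index_enum 'I_k) m y.
have cX i e : continuous (X i e).
  elim: e => [|e IH].
    have -> : X i 0%N = cst 1 by exact/funext.
    exact: cst_continuous.
  have -> : X i e.+1 = fun y => x i y * X i e y.
    by apply/funext => y; rewrite /X exprS.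
  by move=> y; apply: cvgM; [exact: xc|exact: IH].
have cM r m : continuous (M r m).
  elim: r => [|i r IH].
    have -> : M [::] m = cst 1 by apply/funext => y; rewrite /M big_nil.
    exact: cst_continuous.
  have -> : M (i :: r) m = fun y => X i (m i) y * M r m y.
    by apply/funext => y; rewrite /M big_cons.
  by move=> y; apply: cvgM; [exact: cX|exact: IH].
have -> : (fun y => meval (fun i => x i y) p : R[i]^o) = S (msupp p).
  by apply/funext => y; rewrite mevalE.
elim: (msupp p) => [|m s IH].
  have -> : S [::] = cst 0 by apply/funext => y; rewrite /S big_nil.
  exact: cst_continuous.
have -> : S (m :: s) = fun y => mcoeff m p * M (index_enum 'I_k) m y + S s y.
  by apply/funext => y; rewrite /S big_cons.
move=> y; apply: cvgD; last exact: IH.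
by apply: cvgM; [exact: cvg_cst|exact: cM].
Qed.

Lemma torus_poly_continuous (p : mpoly k R[i]) : continuous (@torus_poly R k p).
Proof.
apply: (@meval_continuous _ (fun i (z : torus R k) => (\val z) 0 i)) => i z.
apply: (@continuous_comp _ _ _ (\val : torus R k -> 'rV[R[i]^o]_k)
  (fun v => v 0 i)); first exact: initial_continuous.
exact: coord_continuous.
Qed.

End torus_norms.

Section representations.
Context (R : realType) (H : hilbertType R) (k : nat) (T : 'I_k -> bop H).
Context (T_comm : forall i j, T i * T j = T j * T i).
Local Notation Nk := {ffun 'I_k -> nat}.

(** The representations of the torus algebra and of the left regular algebra are
  prescribed at monomials; this recovers their values at polynomials. *)
Lemma representation_poly (E : lmodType R[i]) one mul N (A : set E) (phi : E -> bop H)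
    (e : mpoly k R[i] -> E) :
  @cc_representation R E one mul N A H phi ->
  (forall a p q, e (a *: p + q) = a *: e p + e q) ->
  (forall p, A (e p)) -> (forall m, phi (e (mpolyX R[i] m)) = monom T m) ->
  forall p, phi (e p) = poly_eval T p.
Proof.
move=> [_ phiD phiZ _ _] eP Ae phiX p.
have e0 : e 0 = 0.
  have := eP 1 0 0; rewrite !scale1r addr0 => h.
  by apply: (addrI (e 0)); rewrite addr0 -h.
have eZ a q : e (a *: q) = a *: e q by rewrite -[a *: q]addr0 eP e0 addr0.
have phi0 : phi 0 = 0.
  by rewrite -e0 -[0](scale0r 0) eZ phiZ ?scale0r//; exact: mem_set.
rewrite [in LHS](mpolyE p) /poly_eval.
elim: (msupp p) => [|m s IH]; first by rewrite !big_nil e0.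
have hm : mcoeff m p *: e (mpolyX R[i] m) \in A by rewrite -eZ; apply/mem_set/Ae.
rewrite !big_cons eP phiD//; last exact/mem_set/Ae.
by rewrite phiZ ?phiX ?IH//; exact/mem_set/Ae.
Qed.

Lemma multinom_of (m : 'I_k -> nat) : exists m' : multinom k, m' =1 m.
Proof. by exists (Multinom [tuple m i | i < k]) => i; rewrite mnmE. Qed.

Lemma torus_polyP (a : R[i]) (p q : mpoly k R[i]) :
  torus_poly (a *: p + q) = a *: torus_poly p + torus_poly q :> (torus R k -> R[i]^o).
Proof. by apply/funext => z; rewrite /torus_poly mevalD mevalZ. Qed.

Lemma torus_monomE (m : multinom k) :
  torus_monom m = torus_poly (mpolyX R[i] m) :> (torus R k -> R[i]^o).
Proof. by apply/funext => z; rewrite /torus_poly mevalX. Qed.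

Lemma torus_monom_ext (m m' : 'I_k -> nat) : m =1 m' ->
  torus_monom m = torus_monom m' :> (torus R k -> R[i]^o).
Proof. by move=> mm; apply/funext => z; exact: monom_ext. Qed.

Lemma torus_representation : von_neumann T ->
  exists phi : (torus R k -> R[i]^o) -> bop H,
    @cc_representation R (torus R k -> R[i]^o) 1 *%R (@torus_mxnorm R k)
       (@torus_algebra R k) H phi /\
    forall m : 'I_k -> nat, phi (torus_monom m) = monom T m.
Proof.
move=> TvN.
pose act (z : torus R k) (f : torus R k -> R[i]^o) (v : R[i]^o) : R[i]^o := f z * v.
have actP z a f g v : act z (a *: f + g) v = a *: act z f v + act z g v.
  by rewrite /act -[X in X * v]/(a * f z + g z) mulrDl -mulrA.
have actM z f g v : act z (f * g) v = act z f (act z g v).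
  by rewrite /act mulrA.
have actB z f v v' : act z f (v - v') = act z f v - act z f v'.
  by rewrite /act mulrBr.
have N1_le f c : (supnorm f <= c%:E)%E -> act_bound act f c.
  by move=> /supnorm_le fc z v; rewrite /act rnormM ler_wpM2r ?rnorm_ge0.
have Nm_le n (M : 'M[torus R k -> R[i]^o]_n) c :
    (torus_mxnorm M <= c%:E)%E -> 0 <= c /\ mxact_bound act M c.
  by move/torus_mxnorm_le.
have eM p q : torus_poly (p * q) = torus_poly p * torus_poly q :> (torus R k -> R[i]^o).
  by apply/funext => z; rewrite /torus_poly mevalM.
have e1 : torus_poly 1 = 1 :> (torus R k -> R[i]^o).
  by apply/funext => z; rewrite /torus_poly meval1.
have eb (p : mpoly k R[i]) : exists2 c, 0 <= c & act_bound act (torus_poly p) c.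
  have [B B0 pB] := meval_bounded1 p; exists B => // z v.
  by rewrite /act rnormM ler_wpM2r ?rnorm_ge0//; apply: pB => i; exact: torus_rnorm.
have Tc n (p : 'M[mpoly k R[i]]_n) c : 0 <= c ->
    mxact_bound act (map_mx (@torus_poly R k) p) c -> forall x : 'I_n -> H,
    vnorm (fun i => \sum_j poly_eval T (p i j) (x j)) <= c * vnorm x.
  move=> c0 pc; apply: TvN => // z v z1.
  have tz : torus R k (\row_i z i) by move=> i; rewrite mxE -rnormE z1.
  have := pc (SigSub (mem_set tz)) v; congr (_ <= _); congr vnorm; apply/funext => i.
  apply: eq_bigr => j _; rewrite /act mxE; congr (_ * _).
  by apply: meval_eq => l; rewrite /= mxE.
have Acl : @torus_algebra R k `<=` norm_closure (@supnorm R k) (range (@torus_poly R k)).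
  by move=> f [].
have [phi [ccphi phiE]] := cc_extension actP actM actB N1_le Nm_le
  (@torus_mxnorm_ge0 R k) torus_polyP eM e1 eb T_comm Tc Acl.
exists phi; split=> // m; have [m' mm] := multinom_of m.
rewrite -(torus_monom_ext mm) torus_monomE phiE poly_evalX; exact: monom_ext.
Qed.

Lemma torus_representation_vN (phi : (torus R k -> R[i]^o) -> bop H) :
  @cc_representation R (torus R k -> R[i]^o) 1 *%R (@torus_mxnorm R k)
     (@torus_algebra R k) H phi ->
  (forall m : 'I_k -> nat, phi (torus_monom m) = monom T m) -> von_neumann T.
Proof.
move=> ccphi phiX.
have Ap p : torus_algebra (@torus_poly R k p).
  split; first exact: torus_poly_continuous.
  move=> e e0; exists (torus_poly p); first by exists p.
  rewrite subrr; apply: le_lt_trans (_ : _ <= 0%:E)%E _; last by rewrite lte_fin.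
  by apply/supnorm_le => z; rewrite -[X in rnorm X]/(0 : R[i]^o) rnorm0.
have phiE : forall p, phi (torus_poly p) = poly_eval T p.
  apply: (representation_poly ccphi torus_polyP Ap) => m.
  by rewrite -torus_monomE phiX.
move=> n p C C0 pC.
have [_ _ _ _ cc] := ccphi.
have := cc n (map_mx (@torus_poly R k) p) _.
rewrite (_ : map_mx phi _ = map_mx (poly_eval T) p); last first.
  by apply/matrixP => i j; rewrite !mxE phiE.
have Ap' i j : torus_algebra (map_mx (@torus_poly R k) p i j) by rewrite mxE.
have pC' : (torus_mxnorm (map_mx (@torus_poly R k) p) <= C%:E)%E.
  apply/torus_mxnorm_le; split=> // z v.
  have := pC _ v (torus_rnorm z); congr (_ <= _); congr vnorm; apply/funext => i.
  by apply: eq_bigr => j _; rewrite mxE.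
move=> /(_ Ap')/le_trans/(_ pC')/opmxnorm_le[_ TC] x.
have := TC x; congr (_ <= _); congr vnorm; apply/funext => i.
by apply: eq_bigr => j _; rewrite mxE.
Qed.

Local Notation V := (@left_gen R k).

Lemma generated_left_regular :
  generated_algebra (range (@left_regular R k)) = range (poly_eval V).
Proof.
apply/seteqP; split.
  apply: smallest_sub.
    split.
    - by exists 1 => //; exact: poly_eval1.
    - by move=> a _ _ [p _ <-] [q _ <-]; exists (a *: p + q) => //; exact: poly_evalP.
    - move=> _ _ [p _ <-] [q _ <-]; exists (p * q) => //.
      by apply: poly_evalM; exact: left_gen_comm.
  move=> _ [p _ <-]; have [m mp] := multinom_of p.
  by exists (mpolyX R[i] m) => //; rewrite poly_evalX left_regular_monom; exact: monom_ext.
move=> _ [p _ <-] B [[B1 BP BM] XB].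
have B0 : B 0.
  by have := BP (-1) 1 1 B1 B1; rewrite scaleN1r addNr.
rewrite /poly_eval; elim: (msupp p) => [|m s IH]; first by rewrite big_nil.
rewrite big_cons; apply: BP => //; apply: XB.
exists [ffun i => m i] => //; rewrite left_regular_monom.
by apply: monom_ext => i; rewrite ffunE.
Qed.

Lemma left_regular_representation : von_neumann T ->
  extension_property_A (fun m : Nk => monom T m).
Proof.
move=> TvN; rewrite /extension_property_A.
pose W := l2 R Nk.
pose act (_ : unit) (S : bop W) (v : W) : W := S v.
have actP (z : unit) a (S S' : bop W) v :
  act z (a *: S + S') v = a *: act z S v + act z S' v by [].
have actM (z : unit) (S S' : bop W) v : act z (S * S') v = act z S (act z S' v) by [].
have actB (z : unit) (S : bop W) v v' : act z S (v - v') = act z S v - act z S v'.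
  exact: linearB.
have N1_le (S : bop W) c : (opnorm S <= c%:E)%E -> act_bound act S c.
  by move=> /opnorm_le[_ Sc] z v; exact: Sc.
have Nm_le n (M : 'M[bop W]_n) c :
    (opmxnorm M <= c%:E)%E -> 0 <= c /\ mxact_bound act M c.
  by move=> /opmxnorm_le[c0 Mc]; split=> // z v; exact: Mc.
have VC := @left_gen_comm R k; have VI := @left_gen_isom R k.
have eb (p : mpoly k R[i]) : exists2 c, 0 <= c & act_bound act (poly_eval V p) c.
  by have [B B0 pB] := isometry_bounded p VC VI; exists B => // z v; exact: pB.
have Tc n (p : 'M[mpoly k R[i]]_n) c : 0 <= c ->
    mxact_bound act (map_mx (poly_eval V) p) c -> forall x : 'I_n -> H,
    vnorm (fun i => \sum_j poly_eval T (p i j) (x j)) <= c * vnorm x.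
  move=> c0 pc; apply: TvN => //; apply: left_regular_lower_bound => // v.
  have := pc tt v; congr (_ <= _); congr vnorm; apply/funext => i.
  by apply: eq_bigr => j _; rewrite /act mxE.
have Acl : @left_regular_algebra R k `<=`
    norm_closure (@opnorm R W) (range (poly_eval V)).
  by rewrite /left_regular_algebra generated_left_regular.
have [phi [ccphi phiE]] := cc_extension actP actM actB N1_le Nm_le
  (@opmxnorm_ge0 R W) (poly_evalP V) (poly_evalM VC) (poly_eval1 V) eb T_comm Tc Acl.
exists phi; split=> // p; have [m mp] := multinom_of p.
rewrite left_regular_monom -(monom_ext V mp) -poly_evalX phiE poly_evalX.
exact: monom_ext.
Qed.

Lemma left_regular_representation_vN :
  extension_property_A (fun m : Nk => monom T m) -> von_neumann T.
Proof.
move=> [phi [ccphi phiX]].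
have Ap p : left_regular_algebra (poly_eval V p).
  move=> e e0; exists (poly_eval V p).
    by rewrite generated_left_regular; exists p.
  rewrite subrr; apply: le_lt_trans (_ : _ <= 0%:E)%E _; last by rewrite lte_fin.
  by apply/opnorm_le; split=> // x; rewrite -[X in rnorm X]/(0 : l2 R Nk) rnorm0 mul0r.
have phiE : forall p, phi (poly_eval V p) = poly_eval T p.
  apply: (representation_poly ccphi (poly_evalP V) Ap) => m.
  pose m' : Nk := [ffun i => m i].
  have mm : m' =1 m by move=> i; rewrite ffunE.
  by rewrite poly_evalX -(monom_ext V mm) -left_regular_monom phiX; exact: monom_ext.
move=> n p C C0 pC.
have [_ _ _ _ cc] := ccphi.
have := cc n (map_mx (poly_eval V) p) _.
rewrite (_ : map_mx phi _ = map_mx (poly_eval T) p); last first.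
  by apply/matrixP => i j; rewrite !mxE phiE.
have Ap' i j : left_regular_algebra (map_mx (poly_eval V) p i j) by rewrite mxE.
have pC' : (opmxnorm (map_mx (poly_eval V) p) <= C%:E)%E.
  apply/opmxnorm_le; split=> // x.
  have := isometry_von_neumann (@left_gen_comm R k) (@left_gen_isom R k) x C0 pC.
  congr (_ <= _); congr vnorm; apply/funext => i.
  by apply: eq_bigr => j _; rewrite mxE.
move=> /(_ Ap')/le_trans/(_ pC')/opmxnorm_le[_ TC] x.
have := TC x; congr (_ <= _); congr vnorm; apply/funext => i.
by apply: eq_bigr => j _; rewrite mxE.
Qed.

End representations.

Theorem theorem6p16 (R : realType) (H : hilbertType R) (k : nat)
    (T : 'I_k -> bop H)
    (T_contraction : forall i, (opnorm (T i) <= 1)%E)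
    (T_comm : forall i j, T i * T j = T j * T i) :
  [<->
   exists (K : hilbertType R) (J : {linear H -> K}) (P : bop K)
     (U : 'I_k -> bop K),
     [/\ forall x y : H, hdot (J x) (J y) = hdot x y,
         orthogonal_projection (range J) P,
         forall i, unitary (U i),
         forall i j, U i * U j = U j * U i
       & forall (m : 'I_k -> nat) (x : H),
           J (monom T m x) = P (monom U m (J x))];
   forall (n : nat) (p : 'M[mpoly k R[i]]_n),
     (opmxnorm (map_mx (poly_eval T) p) <=
      ereal_sup [set cmxnorm (map_mx (meval (z 0%R)) p) | z in torus R k])%E;
   exists phi : (torus R k -> R[i]^o) -> bop H,
     @cc_representation R (torus R k -> R[i]^o) 1 *%R (@torus_mxnorm R k)
       (@torus_algebra R k) H phi /\
     forall m : 'I_k -> nat, phi (torus_monom m) = monom T m;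
   extension_property_A (fun m : {ffun 'I_k -> nat} => monom T m)].
Proof.
tfae.
- move=> [K [J [P [U [Jisom PJ Uu UC JT]]]]]; apply/von_neumannP.
  exact: dilation_von_neumann JT.
- by move/von_neumannP; exact: torus_representation.
- move=> [phi [ccphi phiX]]; apply: left_regular_representation => //.
  exact: torus_representation_vN phiX.
- by move/left_regular_representation_vN; exact: unitary_dilation.
Qed.
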